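(* Let $\boldsymbol{\omega}=(\omega_1,\omega_2,\dots)$ with $\Re\omega_j>0$ for all $j$, let $f$ be an LLD meromorphic function on $\mathbb{C}$ of finite order with $f(1)=1$, and let $N\ge1$. Assume that for $1\le n\le N$, $$[\mathbb{Q}[\omega_1,\dots,\omega_n]:\mathbb{Q}[\omega_1,\dots,\omega_{n-1}]]\ge n+1.$$ If $(g_n(s|\boldsymbol{\omega}_n))_{n\ge0}$ and $(\tilde g_n(s|\boldsymbol{\omega}_n))_{n\ge0}$ are two normalized general multiple Gamma hierarchies associated to $f$ such that $g_N(r|\boldsymbol{\omega}_N)=\tilde g_N(r|\boldsymbol{\omega}_N)$ for some rational $r>0$, $r\neq1$, then $g_n=\tilde g_n$ for all $1\le n\le N$. (That is, the hierarchy up to level $N$ is uniquely determined by the value $\Gamma^f_N(r|\boldsymbol{\omega}_N)$.)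
   Context: LLD: no zeros nor poles in $\{\Re s>0\}$. Finite order: quotient of entire functions of finite order. $\boldsymbol{\omega}_n=(\omega_1,\dots,\omega_n)$. The bracket $[\,\cdot:\cdot\,]$ denotes the degree of the extension generated by adjoining $\omega_n$ to $\mathbb{Q}[\omega_1,\dots,\omega_{n-1}]$ (possibly infinite, e.g. if $\omega_n$ is transcendental over it). A normalized general multiple Gamma hierarchy associated to $f$ is a sequence $(\Gamma^f_n(s|\boldsymbol{\omega}_n))_{n\ge0}$ with $\Gamma^f_0(s)=f(s)^{-1}$, $\Gamma^f_{n+1}(s+\omega_{n+1}|\boldsymbol{\omega}_{n+1})=\Gamma^f_n(s|\boldsymbol{\omega}_n)^{-1}\Gamma^f_{n+1}(s|\boldsymbol{\omega}_{n+1})$ for $n\ge0$, each $\Gamma^f_n(\cdot|\boldsymbol{\omega}_n)$ meromorphic of finite order and LLD, and $\Gamma^f_n(1|\boldsymbol{\omega}_n)=1$ for $n\ge1$. *)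

(* Defs.v *)
From Stdlib Require Import Reals QArith.
From Coquelicot Require Import Coquelicot.
Open Scope R_scope.

Definition C_differentiable_at (f : C -> C) (z : C) : Prop :=
  exists l : C, @is_derive C_AbsRing C_NormedModule f z l.

Definition entire (f : C -> C) : Prop := forall z, C_differentiable_at f z.

Definition finite_order_growth (h : C -> C) : Prop :=
  exists rho Rr : R, 0 < Rr /\
    forall z : C, Rr <= Cmod z -> Cmod (h z) <= exp (Rpower (Cmod z) rho).

Definition entire_finite_order (h : C -> C) : Prop :=
  entire h /\ finite_order_growth h.

(* equality as meromorphic functions: the set where f and g differ has no
   accumulation point in C (every point has a punctured neighbourhood on
   which f = g). *)
Definition mer_eq (f g : C -> C) : Prop :=
  forall z : C, exists eps : R, 0 < eps /\
    forall w : C, 0 < Cmod (w - z) < eps -> f w = g w.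

Definition meromorphic_finite_order (f : C -> C) : Prop :=
  exists g h : C -> C, entire_finite_order g /\ entire_finite_order h /\
    (exists z, h z <> 0%C) /\ mer_eq f (fun z => (g z / h z)%C).

Definition LLD (f : C -> C) : Prop :=
  forall z : C, 0 < Re z -> C_differentiable_at f z /\ f z <> 0%C.

Inductive in_gen_field (om : nat -> C) (m : nat) : C -> Prop :=
| gen_rat : forall q : Q, in_gen_field om m (RtoC (Q2R q))
| gen_om : forall i : nat, (1 <= i <= m)%nat -> in_gen_field om m (om i)
| gen_add : forall x y, in_gen_field om m x -> in_gen_field om m y ->
            in_gen_field om m (x + y)%C
| gen_mul : forall x y, in_gen_field om m x -> in_gen_field om m y ->
            in_gen_field om m (x * y)%C
| gen_opp : forall x, in_gen_field om m x -> in_gen_field om m (- x)%C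
| gen_inv : forall x, in_gen_field om m x -> x <> 0%C ->
            in_gen_field om m (/ x)%C.

Definition ext_degree_ge (om : nat -> C) (n d : nat) : Prop :=
  exists b : nat -> C,
    (forall i, (i < d)%nat -> in_gen_field om n (b i)) /\
    forall c : nat -> C,
      (forall i, (i < d)%nat -> in_gen_field om (n - 1) (c i)) ->
      @sum_n C_AbelianMonoid (fun i => (c i * b i)%C) (d - 1) = RtoC 0 ->
      forall i, (i < d)%nat -> c i = 0%C.

(* normalized general multiple Gamma hierarchy associated to f;
   G n s stands for Gamma^f_n(s | om_1, ..., om_n) *)
Definition normalized_hierarchy (om : nat -> C) (f : C -> C)
    (G : nat -> C -> C) : Prop :=
  mer_eq (G 0%nat) (fun s => / f s)%C /\
  (forall n : nat,
     mer_eq (fun s => G (S n) (s + om (S n))%C)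
            (fun s => (/ G n s * G (S n) s)%C)) /\
  (forall n : nat, meromorphic_finite_order (G n) /\ LLD (G n)) /\
  (forall n : nat, (1 <= n)%nat -> G n 1%C = 1%C).

(* Main.v *)
Require Import Defs.
From Stdlib Require Import Reals QArith.
From Stdlib Require Import ZArith Lra Lia Psatz ClassicalEpsilon.
From Coquelicot Require Import Coquelicot.
From Stdlib Require Import List.
Open Scope R_scope.

(* The quotients h_n of corresponding members of two hierarchies satisfy the
   functional equations with h_0 = 1.  Continued to the left they become entire
   and zero-free, so h_n = exp(2 pi i Q_n) with Q_n entire; since h_n is a
   quotient of entire functions of finite order, Q_n is a polynomial, and
     Q_n(s + om_n) - Q_n(s) = k_n - Q_(n-1)(s),  Q_n(1) = 0,  k_n an integer.
   Hence om_n Q_n(s) is a polynomial in s and om_n of total degree at most n over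
   Q(om_1, ..., om_(n-1)), and Q_n(r) = l is an algebraic relation for om_n of
   degree at most n, so it holds identically; comparing it at om_n and - om_n
   shows that Q_(n-1)(r) = 2 l.  Integrality at r therefore descends to level 0,
   and going up again every k_n and every Q_n vanishes. *)

(** * Complex differentiation *)

(** Why the sign comparison yields [2 l]: put [A = k_n - Q_(n-1)]. With the step [w] treated as an
    indeterminate there is a polynomial [G(s, w)] with [G(s + w, w) - G(s, w) = w A(s)], and
    [om_n Q_n(s) = G(s, om_n) - G(1, om_n)]. Using the step [- w] in the same equation shows that
    [G(s, w) - G(s, - w) + w A(s)] has period [w], so it does not depend on [s]; for [A = s^j] this
    is the reflection formula of the Bernoulli polynomials. The relation [G(r, x) - G(1, x) = l x]
    has degree at most [n] in [x] and coefficients in the field of the previous [om_j], because [r]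
    and [l] are rational. The degree bound makes [1, om_n, ..., om_n^n] independent over that field,
    so the relation survives at [x = - om_n], and subtracting the two instances gives
    [A(r) - A(1) = - 2 l]. The functional equations are used pointwise only for [Re s > 0], where
    LLD makes all values finite and nonzero; the identity theorem carries the consequences to the
    whole plane. *)

Definition Ccont (f : C -> C) (z : C) : Prop :=
  forall eps, 0 < eps -> exists d, 0 < d /\
    forall w, Cmod (w - z) < d -> Cmod (f w - f z) < eps.

(** The bound is not strict and scales with the increment, so it holds at [w = z] and no quotient
    has to be formed. *)
Definition Cderiv (f : C -> C) (z l : C) : Prop :=
  forall eps, 0 < eps -> exists d, 0 < d /\
    forall w, Cmod (w - z) < d -> Cmod (f w - f z - l * (w - z)) <= eps * Cmod (w - z).

Lemma is_derive_Cderiv f z l :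
  @is_derive C_AbsRing C_NormedModule f z l <-> Cderiv f z l.
Proof.
  split.
  - intros [_ H] eps He.
    specialize (H z (fun P HP => HP) (mkposreal _ He)).
    destruct H as [d Hd].
    exists d; split; [apply cond_pos|]. intros w Hw.
    specialize (Hd w Hw).
    change (Cmod (f w - f z - (w - z) * l) <= eps * Cmod (w - z)) in Hd.
    rewrite (Cmult_comm l). exact Hd.
  - intros H. split. { apply is_linear_scal_l. }
    intros x Hx eps.
    (* The filter formulation allows any limit point [x] of the neighbourhoods of [z]; separation
       forces [x = z]. *)
    apply (is_filter_lim_locally_unique (V:=AbsRing_NormedModule C_AbsRing)) in Hx. subst x.
    destruct (H eps (cond_pos eps)) as [d [Hd Hd']].
    exists (mkposreal d Hd). intros w Hw.
    specialize (Hd' w Hw).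
    change (Cmod (f w - f z - (w - z) * l) <= eps * Cmod (w - z)).
    rewrite (Cmult_comm _ l). exact Hd'.
Qed.

Lemma Cmod_pos (z : C) : z <> 0%C -> 0 < Cmod z.
Proof. exact (proj1 (Cmod_gt_0 z)). Qed.

Lemma Cmod_pos_neq (z : C) : 0 < Cmod z -> z <> 0%C.
Proof. exact (proj2 (Cmod_gt_0 z)). Qed.

Lemma Cmod_minus_sym (a b : C) : Cmod (a - b) = Cmod (b - a).
Proof. rewrite <- Cmod_opp. f_equal. ring. Qed.

Lemma Cmod_triangle_minus (a b : C) : Cmod (a - b) <= Cmod a + Cmod b.
Proof. rewrite <- (Cmod_opp b). apply Cmod_triangle. Qed.

Lemma Cmod_le_diff (a b : C) : Cmod a <= Cmod b + Cmod (a - b).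
Proof. replace a with (b + (a - b))%C at 1 by ring. apply Cmod_triangle. Qed.

Lemma Ccont_ext f g z : (forall w, f w = g w) -> Ccont f z -> Ccont g z.
Proof.
  intros E H eps He. destruct (H eps He) as [d [Hd H']].
  exists d; split; auto. intros w Hw. rewrite <- !E. auto.
Qed.

Lemma Ccont_const (c z : C) : Ccont (fun _ => c) z.
Proof.
  intros eps He. exists 1; split; [lra|]. intros.
  replace (c - c)%C with (RtoC 0) by ring. rewrite Cmod_0. exact He.
Qed.

Lemma Ccont_id (z : C) : Ccont (fun w => w) z.
Proof. intros eps He. exists eps; split; auto. Qed.

Lemma Ccont_plus f g z : Ccont f z -> Ccont g z -> Ccont (fun w => f w + g w)%C z.
Proof.
  intros Hf Hg eps He.
  destruct (Hf (eps/2)) as [d1 [H1 H1']]; [lra|].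
  destruct (Hg (eps/2)) as [d2 [H2 H2']]; [lra|].
  exists (Rmin d1 d2); split; [apply Rmin_glb_lt; auto|].
  intros w Hw.
  specialize (H1' w (Rlt_le_trans _ _ _ Hw (Rmin_l _ _))).
  specialize (H2' w (Rlt_le_trans _ _ _ Hw (Rmin_r _ _))).
  replace (f w + g w - (f z + g z))%C with ((f w - f z) + (g w - g z))%C by ring.
  eapply Rle_lt_trans; [apply Cmod_triangle|]. lra.
Qed.

Lemma Ccont_mult f g z : Ccont f z -> Ccont g z -> Ccont (fun w => f w * g w)%C z.
Proof.
  intros Hf Hg eps He.
  set (M := 1 + Cmod (f z) + Cmod (g z)).
  assert (HM : 1 <= M) by (unfold M; pose proof (Cmod_ge_0 (f z)); pose proof (Cmod_ge_0 (g z)); lra).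
  (* The error is at most [e * e + e * |g z| + |f z| * e <= e * M] because [e <= 1]; the factor 2
     makes the conclusion strict. *)
  set (e := Rmin 1 (eps / (2 * M))).
  assert (He0 : 0 < e).
  { unfold e; apply Rmin_glb_lt; [lra|]. apply Rdiv_lt_0_compat; lra. }
  destruct (Hf e He0) as [d1 [H1 H1']].
  destruct (Hg e He0) as [d2 [H2 H2']].
  exists (Rmin d1 d2); split; [apply Rmin_glb_lt; auto|].
  intros w Hw.
  specialize (H1' w (Rlt_le_trans _ _ _ Hw (Rmin_l _ _))).
  specialize (H2' w (Rlt_le_trans _ _ _ Hw (Rmin_r _ _))).
  replace (f w * g w - f z * g z)%C
    with ((f w - f z) * (g w - g z) + (f w - f z) * g z + f z * (g w - g z))%C by ring.
  eapply Rle_lt_trans; [apply Cmod_triangle|].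
  eapply Rle_lt_trans; [apply Rplus_le_compat_r, Cmod_triangle|].
  rewrite !Cmod_mult.
  assert (E1 : e <= 1) by apply Rmin_l.
  assert (E2 : e * (2 * M) <= eps).
  { apply Rle_trans with (eps / (2 * M) * (2 * M)).
    - apply Rmult_le_compat_r; [lra|apply Rmin_r].
    - right; field; lra. }
  unfold M in *.
  pose proof (Cmod_ge_0 (f z)); pose proof (Cmod_ge_0 (g z)).
  pose proof (Cmod_ge_0 (f w - f z)); pose proof (Cmod_ge_0 (g w - g z)).
  assert (Cmod (f w - f z) * Cmod (g w - g z) <= e * 1) by (apply Rmult_le_compat; lra).
  assert (Cmod (f w - f z) * Cmod (g z) <= e * Cmod (g z)) by (apply Rmult_le_compat_r; lra).
  assert (Cmod (f z) * Cmod (g w - g z) <= Cmod (f z) * e) by (apply Rmult_le_compat_l; lra).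
  nra.
Qed.

Lemma Ccont_comp f g z : Ccont g z -> Ccont f (g z) -> Ccont (fun w => f (g w)) z.
Proof.
  intros Hg Hf eps He. destruct (Hf eps He) as [d [Hd Hd']].
  destruct (Hg d Hd) as [d2 [H2 H2']]. exists d2; split; auto.
Qed.

Lemma Ccont_inv (z : C) : z <> 0%C -> Ccont Cinv z.
Proof.
  intros Hz eps He.
  assert (Hm : 0 < Cmod z) by (apply Cmod_pos; auto).
  set (m := Cmod z) in *.
  exists (Rmin (m/2) (eps * m * m / 2)). split.
  { apply Rmin_glb_lt; [lra|]. apply Rdiv_lt_0_compat; [|lra]. repeat apply Rmult_lt_0_compat; lra. }
  intros w Hw.
  assert (H1 := Rlt_le_trans _ _ _ Hw (Rmin_l _ _)).
  assert (H2 := Rlt_le_trans _ _ _ Hw (Rmin_r _ _)).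
  assert (Hwm : m/2 < Cmod w).
  { pose proof (Cmod_le_diff z w). rewrite Cmod_minus_sym in H. fold m in H. lra. }
  assert (Hw0 : w <> 0%C) by (apply Cmod_pos_neq; lra).
  replace (/ w - / z)%C with ((z - w) / (w * z))%C by (field; auto).
  rewrite Cmod_div by (apply Cmult_neq_0; auto).
  rewrite Cmod_minus_sym, Cmod_mult. fold m.
  apply Rlt_div_l; [apply Rmult_lt_0_compat; lra|].
  eapply Rlt_le_trans; [apply H2|].
  replace (eps * m * m / 2) with (eps * (m/2 * m)) by field.
  apply Rmult_le_compat_l; [lra|]. apply Rmult_le_compat_r; lra.
Qed.

(* Carathéodory's form of differentiability turns the differentiation rules
   into continuity statements. *)
Lemma Cderiv_carath f z l :
  Cderiv f z l <-> exists phi, phi z = l /\ Ccont phi z /\ forall w, f w = (f z + phi w * (w - z))%C.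
Proof.
  split.
  - intros H.
    exists (fun w => if Ceq_dec w z then l else (f w - f z) / (w - z))%C. split; [|split].
    + destruct (Ceq_dec z z); congruence.
    + intros eps He. destruct (H (eps/2)) as [d [Hd Hd']]; [lra|].
      exists d; split; auto. intros w Hw.
      destruct (Ceq_dec z z); [|congruence]. destruct (Ceq_dec w z).
      * replace (l - l)%C with (RtoC 0) by ring. rewrite Cmod_0; lra.
      * assert (Hn := Cminus_eq_contra _ _ n).
        replace ((f w - f z) / (w - z) - l)%C with ((f w - f z - l * (w - z)) / (w - z))%C by (field; auto).
        rewrite Cmod_div by auto. assert (0 < Cmod (w - z)) by (apply Cmod_pos; auto).
        apply Rlt_div_l; auto. specialize (Hd' w Hw). nra.
    + intros w. destruct (Ceq_dec w z). subst; ring. field. apply Cminus_eq_contra; auto.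
  - intros [phi [E [Hc Hf]]] eps He. destruct (Hc eps He) as [d [Hd Hd']].
    exists d; split; auto. intros w Hw. rewrite (Hf w), <- E.
    replace (f z + phi w * (w - z) - f z - phi z * (w - z))%C with ((phi w - phi z) * (w - z))%C by ring.
    rewrite Cmod_mult. apply Rmult_le_compat_r; [apply Cmod_ge_0|]. specialize (Hd' w Hw); lra.
Qed.

Lemma Cderiv_Ccont f z l : Cderiv f z l -> Ccont f z.
Proof.
  intros H. apply Cderiv_carath in H. destruct H as [phi [E [Hc Hf]]].
  apply Ccont_ext with (fun w => f z + phi w * (w + - z))%C.
  { intros w. rewrite (Hf w). ring. }
  apply Ccont_plus; [apply Ccont_const|]. apply Ccont_mult; auto.
  apply Ccont_plus; [apply Ccont_id|apply Ccont_const].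
Qed.

Lemma Cderiv_ext f g z l : (forall w, f w = g w) -> Cderiv f z l -> Cderiv g z l.
Proof.
  intros E H eps He. destruct (H eps He) as [d [Hd H']].
  exists d; split; auto. intros w Hw. rewrite <- !E. auto.
Qed.

Lemma Cderiv_ext_loc f g z l r : 0 < r -> (forall w, Cmod (w - z) < r -> f w = g w) ->
  Cderiv f z l -> Cderiv g z l.
Proof.
  intros Hr E H eps He. destruct (H eps He) as [d [Hd H']].
  exists (Rmin d r); split; [apply Rmin_glb_lt; auto|]. intros w Hw.
  assert (Ez : f z = g z).
  { apply E. replace (z - z)%C with (RtoC 0) by ring. rewrite Cmod_0; auto. }
  rewrite <- Ez, <- E.
  - apply H'. eapply Rlt_le_trans; [apply Hw|apply Rmin_l].
  - eapply Rlt_le_trans; [apply Hw|apply Rmin_r].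
Qed.

Lemma Cderiv_eq f z l l' : Cderiv f z l -> l = l' -> Cderiv f z l'.
Proof. intros; subst; auto. Qed.

Lemma Cderiv_const (c z : C) : Cderiv (fun _ => c) z 0%C.
Proof.
  apply Cderiv_carath. exists (fun _ => 0%C). split; [|split]; auto.
  - apply Ccont_const.
  - intros; ring.
Qed.

Lemma Cderiv_id (z : C) : Cderiv (fun w => w) z 1%C.
Proof.
  apply Cderiv_carath. exists (fun _ => 1%C). split; [|split]; auto.
  - apply Ccont_const.
  - intros; ring.
Qed.

Lemma Cderiv_plus f g z l m : Cderiv f z l -> Cderiv g z m -> Cderiv (fun w => f w + g w)%C z (l + m)%C.
Proof.
  rewrite !Cderiv_carath. intros [p [Ep [Cp Fp]]] [q [Eq [Cq Fq]]].
  exists (fun w => p w + q w)%C. split; [|split].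
  - rewrite Ep, Eq; auto.
  - apply Ccont_plus; auto.
  - intros w. rewrite (Fp w), (Fq w). ring.
Qed.

Lemma Cderiv_mult f g z l m : Cderiv f z l -> Cderiv g z m ->
  Cderiv (fun w => f w * g w)%C z (l * g z + f z * m)%C.
Proof.
  intros Hf Hg. pose proof (Cderiv_Ccont _ _ _ Hg) as Cg.
  rewrite Cderiv_carath in *. destruct Hf as [p [Ep [Cp Fp]]]. destruct Hg as [q [Eq [Cq Fq]]].
  exists (fun w => p w * g w + f z * q w)%C. split; [|split].
  - rewrite Ep, Eq; auto.
  - apply Ccont_plus; apply Ccont_mult; auto. apply Ccont_const.
  - intros w. rewrite (Fp w) at 1. rewrite (Fq w). ring.
Qed.

Lemma Cderiv_scal c f z l : Cderiv f z l -> Cderiv (fun w => c * f w)%C z (c * l)%C.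
Proof.
  intros H. eapply Cderiv_eq. apply (Cderiv_mult (fun _ => c) f); [apply Cderiv_const|apply H]. ring.
Qed.

Lemma Cderiv_opp f z l : Cderiv f z l -> Cderiv (fun w => - f w)%C z (- l)%C.
Proof.
  intros H. apply Cderiv_ext with (fun w => (- RtoC 1) * f w)%C. { intros; ring. }
  eapply Cderiv_eq. apply Cderiv_scal, H. ring.
Qed.

Lemma Cderiv_minus f g z l m : Cderiv f z l -> Cderiv g z m -> Cderiv (fun w => f w - g w)%C z (l - m)%C.
Proof. intros Hf Hg. apply Cderiv_plus; auto. apply Cderiv_opp; auto. Qed.

Lemma Cderiv_comp f g z l m : Cderiv g z m -> Cderiv f (g z) l -> Cderiv (fun w => f (g w)) z (l * m)%C.
Proof.
  intros Hg Hf. pose proof (Cderiv_Ccont _ _ _ Hg) as Cg.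
  rewrite Cderiv_carath in *. destruct Hf as [p [Ep [Cp Fp]]]. destruct Hg as [q [Eq [Cq Fq]]].
  exists (fun w => p (g w) * q w)%C. split; [|split].
  - rewrite Ep, Eq; auto.
  - apply Ccont_mult; auto. apply Ccont_comp; auto.
  - intros w. rewrite (Fp (g w)) at 1. rewrite (Fq w) at 2. ring.
Qed.

(** The Carathéodory factor is [- / (w z)], but the factorisation needs [w <> 0]; hence the direct
    estimate on a radius below [|z|]. *)
Lemma Cderiv_Cinv (z : C) : z <> 0%C -> Cderiv Cinv z (- (/ z * / z))%C.
Proof.
  intros Hz.
  set (m := Cmod z). assert (Hm : 0 < m) by (apply Cmod_pos; auto).
  assert (Hc : Ccont (fun w => - (/ w * / z))%C z).
  { apply Ccont_ext with (fun w => (- / z) * / w)%C. { intros; ring. }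
    apply Ccont_mult; [apply Ccont_const| apply Ccont_inv; auto]. }
  intros eps He. destruct (Hc eps He) as [d [Hd Hd']].
  exists (Rmin d m); split; [apply Rmin_glb_lt; auto|]. intros w Hw.
  assert (H1 := Rlt_le_trans _ _ _ Hw (Rmin_l _ _)).
  assert (H2 := Rlt_le_trans _ _ _ Hw (Rmin_r _ _)).
  assert (Hw0 : w <> 0%C).
  { intros ->. rewrite Cmod_minus_sym in H2. replace (z - 0)%C with z in H2 by ring. unfold m in H2; lra. }
  replace (/ w - / z - - (/ z * / z) * (w - z))%C
    with ((- (/ w * / z) - - (/ z * / z)) * (w - z))%C by (field; auto).
  rewrite Cmod_mult. apply Rmult_le_compat_r; [apply Cmod_ge_0|]. specialize (Hd' w H1); lra.
Qed.

Lemma Cderiv_div f g z l m : Cderiv f z l -> Cderiv g z m -> g z <> 0%C ->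
  Cderiv (fun w => f w / g w)%C z ((l * g z - f z * m) / (g z * g z))%C.
Proof.
  intros Hf Hg Hz. eapply Cderiv_eq.
  - apply (Cderiv_mult f (fun w => / g w)%C); [apply Hf|].
    apply (Cderiv_comp Cinv g); [apply Hg|apply Cderiv_Cinv; auto].
  - field; auto.
Qed.

Lemma Cderiv_pow n (z : C) : Cderiv (fun w => w ^ n)%C z (RtoC (INR n) * z ^ (pred n))%C.
Proof.
  induction n.
  - simpl. eapply Cderiv_eq; [apply Cderiv_const|]. ring.
  - apply Cderiv_ext with (fun w => w * w ^ n)%C. { intros; reflexivity. }
    eapply Cderiv_eq. apply (Cderiv_mult (fun w => w) (fun w => w ^ n)%C); [apply Cderiv_id|apply IHn].
    rewrite S_INR, RtoC_plus. destruct n; simpl; ring.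
Qed.

Lemma Cderiv_uniq f z l m : Cderiv f z l -> Cderiv f z m -> l = m.
Proof.
  rewrite <- !is_derive_Cderiv. intros H1 H2.
  rewrite <- (is_C_derive_unique _ _ _ H1). apply is_C_derive_unique; auto.
Qed.

Definition Centire (f : C -> C) := forall z, exists l, Cderiv f z l.

Lemma entire_Centire f : entire f <-> Centire f.
Proof.
  split; intros H z; destruct (H z) as [l Hl]; exists l; apply is_derive_Cderiv; auto.
Qed.

Lemma Centire_Ccont f : Centire f -> forall z, Ccont f z.
Proof. intros H z. destruct (H z) as [l Hl]. eapply Cderiv_Ccont; eauto. Qed.

Lemma Centire_ext f g : (forall w, f w = g w) -> Centire f -> Centire g.
Proof. intros E H z. destruct (H z) as [l Hl]. exists l. eapply Cderiv_ext; eauto. Qed.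
Lemma Centire_const c : Centire (fun _ => c).
Proof. intros z; eexists; apply Cderiv_const. Qed.
Lemma Centire_id : Centire (fun z => z).
Proof. intros z; eexists; apply Cderiv_id. Qed.
Lemma Centire_plus f g : Centire f -> Centire g -> Centire (fun z => f z + g z)%C.
Proof. intros Hf Hg z. destruct (Hf z), (Hg z). eexists; apply Cderiv_plus; eauto. Qed.
Lemma Centire_minus f g : Centire f -> Centire g -> Centire (fun z => f z - g z)%C.
Proof. intros Hf Hg z. destruct (Hf z), (Hg z). eexists; apply Cderiv_minus; eauto. Qed.
Lemma Centire_mult f g : Centire f -> Centire g -> Centire (fun z => f z * g z)%C.
Proof. intros Hf Hg z. destruct (Hf z), (Hg z). eexists; apply Cderiv_mult; eauto. Qed.
Lemma Centire_comp f g : Centire f -> Centire g -> Centire (fun z => f (g z))%C.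
Proof. intros Hf Hg z. destruct (Hg z). destruct (Hf (g z)). eexists; apply Cderiv_comp; eauto. Qed.
Lemma Centire_pow n : Centire (fun z => z ^ n)%C.
Proof. intros z; eexists; apply Cderiv_pow. Qed.
Lemma Centire_div f g : Centire f -> Centire g -> (forall z, g z <> 0%C) -> Centire (fun z => f z / g z)%C.
Proof. intros Hf Hg H0 z. destruct (Hf z), (Hg z). eexists; apply Cderiv_div; eauto. Qed.
Lemma Centire_shift f a : Centire f -> Centire (fun z => f (z + a)%C).
Proof. intros H. apply (Centire_comp f (fun z => z + a)%C H). apply Centire_plus; [apply Centire_id|apply Centire_const]. Qed.

(** * The complex exponential *)

Definition Cexp (z : C) : C := (exp (Re z) * cos (Im z), exp (Re z) * sin (Im z)).

Lemma Cexp_plus a b : Cexp (a + b) = (Cexp a * Cexp b)%C.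
Proof.
  unfold Cexp. rewrite re_plus, im_plus, exp_plus, cos_plus, sin_plus.
  unfold Cmult; simpl. f_equal; ring.
Qed.

Lemma Cexp_0 : Cexp 0%C = 1%C.
Proof. unfold Cexp; simpl. rewrite exp_0, cos_0, sin_0. unfold RtoC; f_equal; ring. Qed.

Lemma Cmod_Cexp z : Cmod (Cexp z) = exp (Re z).
Proof.
  unfold Cmod, Cexp; cbn [fst snd].
  replace ((exp (Re z) * cos (Im z)) ^ 2 + (exp (Re z) * sin (Im z)) ^ 2)
    with (Rsqr (exp (Re z))).
  - apply sqrt_Rsqr. left; apply exp_pos.
  - pose proof (sin2_cos2 (Im z)). unfold Rsqr in *.
    transitivity (exp (Re z) * exp (Re z) * (sin (Im z) * sin (Im z) + cos (Im z) * cos (Im z))).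
    rewrite H; ring. ring.
Qed.

Lemma Cexp_neq_0 z : Cexp z <> 0%C.
Proof. apply Cmod_pos_neq. rewrite Cmod_Cexp. apply exp_pos. Qed.

Lemma Cexp_opp (z : C) : Cexp (- z) = (/ Cexp z)%C.
Proof.
  pose proof (Cexp_neq_0 z).
  replace (Cexp (-z)) with (Cexp (-z) * Cexp z * / Cexp z)%C by (field; auto).
  rewrite <- Cexp_plus. replace (- z + z)%C with (RtoC 0) by ring. rewrite Cexp_0. ring.
Qed.

Lemma Cexp_minus (a b : C) : Cexp (a - b) = (Cexp a / Cexp b)%C.
Proof. unfold Cminus. rewrite Cexp_plus, Cexp_opp. reflexivity. Qed.

Lemma Cmod_le_sum (z : C) : Cmod z <= Rabs (Re z) + Rabs (Im z).
Proof.
  replace z with ((RtoC (Re z)) + Ci * RtoC (Im z))%C at 1.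
  - eapply Rle_trans; [apply Cmod_triangle|]. rewrite Cmod_mult, !Cmod_R, Cmod_Ci. lra.
  - destruct z; unfold Cplus, Cmult, RtoC, Ci; simpl; f_equal; ring.
Qed.

Lemma im_le_Cmod (z : C) : Rabs (Im z) <= Cmod z.
Proof. eapply Rle_trans; [apply Rmax_r | apply Rmax_Cmod]. Qed.

(** From [exp (- x) >= 1 - x] one gets [exp x <= 1 / (1 - x) = 1 + x + x^2 / (1 - x)], and
    [1 - x >= 1/2]. *)
Lemma exp_taylor1 x : Rabs x <= /2 -> Rabs (exp x - 1 - x) <= 2 * x ^ 2.
Proof.
  intros H. apply Rabs_le_between in H.
  pose proof (exp_ineq1_le x). pose proof (exp_ineq1_le (-x)).
  rewrite exp_Ropp in H1. pose proof (exp_pos x).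
  assert (exp x * (1 - x) <= 1).
  { apply Rle_trans with (exp x * / exp x). apply Rmult_le_compat_l; lra. right; field; lra. }
  apply Rabs_le_between. split; nra.
Qed.

(** Half-angle formula [1 - cos y = 2 sin^2 (y/2)] together with [|sin t| <= |t|]. *)
Lemma one_minus_cos_bound y : 0 <= 1 - cos y <= y ^ 2 / 2.
Proof.
  split. pose proof (COS_bound y); lra.
  assert (E : cos y = 1 - 2 * sin (y/2) * sin (y/2)).
  { replace y with (2 * (y/2)) at 1 by field. apply cos_2a_sin. }
  assert (H : Rabs (sin (y/2)) <= Rabs (y/2)).
  { assert (P : forall t, 0 <= t -> Rabs (sin t) <= t).
    { intros t Ht. destruct (Req_dec t 0) as [->|]. rewrite sin_0, Rabs_R0; lra.
      destruct (Rle_lt_dec t 1).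
      - assert (0 < sin t) by (apply sin_gt_0; pose proof PI2_1; unfold PI2 in *; lra).
        rewrite Rabs_right by lra. left; apply sin_lt_x; lra.
      - apply Rle_trans with 1; [|lra]. apply Rabs_le_between. pose proof (SIN_bound t); lra. }
    destruct (Rle_lt_dec 0 (y/2)).
    - rewrite (Rabs_right (y/2)) by lra. apply P; auto.
    - rewrite (Rabs_left (y/2)) by lra. rewrite <- (Rabs_Ropp (sin _)), <- sin_neg. apply P; lra. }
  rewrite E. apply Rsqr_le_abs_1 in H. unfold Rsqr in H. nra.
Qed.

(** The mean value theorem for [sin t - t], whose derivative [cos t - 1] is quadratically small;
    [|y| <= 1] then lowers the cubic bound to a quadratic one. *)
Lemma sin_taylor1 y : Rabs y <= 1 -> Rabs (sin y - y) <= y ^ 2 / 2.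
Proof.
  intros Hy.
  destruct (MVT_gen (fun t => sin t - t) 0 y (fun t => cos t - 1)) as [c [Hc E]].
  - intros; auto_derive; auto; ring.
  - intros u _. apply derivable_continuous_pt.
    exists (cos u - 1). apply is_derive_Reals. auto_derive; auto; ring.
  - cbv beta in E. rewrite sin_0 in E. replace (sin y - y) with ((cos c - 1) * y) by lra.
    rewrite Rabs_mult.
    assert (Rabs c <= Rabs y).
    { unfold Rmin, Rmax in Hc. destruct (Rle_dec 0 y).
      rewrite !Rabs_right by lra; lra. rewrite !Rabs_left1 by lra; lra. }
    pose proof (one_minus_cos_bound c). rewrite Rabs_left1 by lra.
    assert (c ^ 2 <= Rabs y ^ 2). { rewrite <- (pow2_abs c). apply pow_incr. split; auto. apply Rabs_pos. }
    pose proof (Rabs_pos y). rewrite <- (pow2_abs y).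
    nra.
Qed.

(** Both components split into products of the real estimates, which add up to at most [4 |h|^2];
    the constant 10 is generous. *)
Lemma Cexp_taylor1 (h : C) : Cmod h <= /2 -> Cmod (Cexp h - 1 - h) <= 10 * Cmod h ^ 2.
Proof.
  intros Hh. eapply Rle_trans; [apply Cmod_le_sum|].
  pose proof (re_le_Cmod h) as Hx. pose proof (im_le_Cmod h) as Hy.
  pose proof (Cmod2_alt h) as E'.
  set (x := Re h) in *. set (y := Im h) in *.
  replace (Re (Cexp h - 1 - h)) with ((exp x - 1 - x) + exp x * (cos y - 1))
   by (unfold Cexp, x, y, Re, Im; simpl; ring).
  replace (Im (Cexp h - 1 - h)) with ((sin y - y) + (exp x - 1) * sin y)
   by (unfold Cexp, x, y, Re, Im; simpl; ring).
  pose proof (exp_taylor1 x ltac:(lra)). pose proof (one_minus_cos_bound y).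
  pose proof (sin_taylor1 y ltac:(lra)).
  assert (Rabs x <= /2) by lra. assert (Rabs y <= /2) by lra.
  clearbody x y. clear Hx Hy. rewrite E'. clear E' Hh.
  apply Rabs_le_between in H2. 
  assert (Hs : Rabs (sin y) <= 2 * Rabs y).
  { replace (sin y) with ((sin y - y) + y) by ring. eapply Rle_trans; [apply Rabs_triang|].
    rewrite <- (pow2_abs y) in H1. pose proof (Rabs_pos y). nra. }
  assert (He : Rabs (exp x - 1) <= 2 * Rabs x).
  { replace (exp x - 1) with ((exp x - 1 - x) + x) by ring. eapply Rle_trans; [apply Rabs_triang|].
    rewrite <- (pow2_abs x) in H. pose proof (Rabs_pos x).
    assert (Rabs x <= /2) by (apply Rabs_le_between; lra). nra. }
  assert (Hm : Rabs ((exp x - 1) * sin y) <= 2 * (x ^ 2 + y ^ 2)).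
  { rewrite Rabs_mult. apply Rle_trans with ((2 * Rabs x) * (2 * Rabs y)).
    apply Rmult_le_compat; auto; apply Rabs_pos.
    rewrite <- (pow2_abs x), <- (pow2_abs y). pose proof (pow2_ge_0 (Rabs x - Rabs y)). nra. }
  assert (Hx2 : Rabs (exp x * (cos y - 1)) <= y ^ 2).
  { rewrite Rabs_mult, (Rabs_right (exp x)), (Rabs_left1 (cos y - 1)) by (try lra; left; apply exp_pos).
    pose proof (exp_pos x). apply Rabs_le_between in H. assert (exp x <= 2) by nra. nra. }
  pose proof (Rabs_triang (exp x - 1 - x) (exp x * (cos y - 1))).
  pose proof (Rabs_triang (sin y - y) ((exp x - 1) * sin y)).
  pose proof (pow2_ge_0 x). pose proof (pow2_ge_0 y). lra.
Qed.

(** Serves where no algebraic rule applies: the exponential, integrals with a parameter, divided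
    differences at their centre. *)
Lemma Cderiv_of_square_bound f (z l : C) K r : 0 < r -> 0 <= K ->
  (forall w, Cmod (w - z) < r -> Cmod (f w - f z - l * (w - z)) <= K * Cmod (w - z) ^ 2) ->
  Cderiv f z l.
Proof.
  intros Hr HK H eps He.
  exists (Rmin r (eps / (K + 1))). split.
  { apply Rmin_glb_lt; auto. apply Rdiv_lt_0_compat; lra. }
  intros w Hw. eapply Rle_trans.
  { apply H. eapply Rlt_le_trans; [apply Hw|apply Rmin_l]. }
  assert (Cmod (w - z) < eps / (K + 1)) by (eapply Rlt_le_trans; [apply Hw|apply Rmin_r]).
  apply Rlt_div_r in H0; [|lra]. pose proof (Cmod_ge_0 (w - z)). nra.
Qed.

Lemma Cderiv_Cexp z : Cderiv Cexp z (Cexp z).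
Proof.
  apply Cderiv_of_square_bound with (Cmod (Cexp z) * 10) (/2); try lra.
  { pose proof (Cmod_ge_0 (Cexp z)); lra. }
  intros w Hw.
  replace (Cexp w - Cexp z - Cexp z * (w - z))%C with (Cexp z * (Cexp (w - z) - 1 - (w - z)))%C.
  - rewrite Cmod_mult, Rmult_assoc. apply Rmult_le_compat_l; [apply Cmod_ge_0|].
    apply Cexp_taylor1; lra.
  - rewrite Cexp_minus. field. apply Cexp_neq_0.
Qed.

Lemma Centire_Cexp : Centire Cexp.
Proof. intros z; eexists; apply Cderiv_Cexp. Qed.

(** * Integrals of complex functions of a real variable *)

Definition path_cont (g : R -> C) : Prop := forall t eps, 0 < eps -> exists d, 0 < d /\
  forall u, Rabs (u - t) < d -> Cmod (g u - g t) < eps.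

Definition CInt (g : R -> C) (a b : R) : C :=
  (RInt (fun t => Re (g t)) a b, RInt (fun t => Im (g t)) a b).

Lemma continuous_eps (g : R -> R) t : (forall eps, 0 < eps -> exists d, 0 < d /\
  forall u, Rabs (u - t) < d -> Rabs (g u - g t) < eps) -> continuous g t.
Proof.
  intros H. apply filterlim_locally. intros eps.
  destruct (H eps (cond_pos eps)) as [d [Hd H']].
  exists (mkposreal d Hd). intros u Hu. apply H'. exact Hu.
Qed.

Lemma continuous_eps_inv (g : R -> R) t : continuous g t -> forall eps, 0 < eps -> exists d, 0 < d /\
  forall u, Rabs (u - t) < d -> Rabs (g u - g t) < eps.
Proof.
  intros H eps He. apply filterlim_locally with (eps := mkposreal eps He) in H.
  destruct H as [d H]. exists d; split; [apply cond_pos|]. intros u Hu. apply (H u Hu).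
Qed.

Lemma path_cont_re g : path_cont g -> forall t, continuous (fun t => Re (g t)) t.
Proof.
  intros H t. apply continuous_eps. intros eps He. destruct (H t eps He) as [d [Hd H']].
  exists d; split; auto. intros u Hu.
  eapply Rle_lt_trans; [|apply (H' u Hu)]. replace (Re (g u) - Re (g t)) with (Re (g u - g t)) by reflexivity.
  apply re_le_Cmod.
Qed.

Lemma path_cont_im g : path_cont g -> forall t, continuous (fun t => Im (g t)) t.
Proof.
  intros H t. apply continuous_eps. intros eps He. destruct (H t eps He) as [d [Hd H']].
  exists d; split; auto. intros u Hu.
  eapply Rle_lt_trans; [|apply (H' u Hu)]. replace (Im (g u) - Im (g t)) with (Im (g u - g t)) by reflexivity.
  apply im_le_Cmod.
Qed.

Lemma path_cont_comp f g : (forall t, Ccont f (g t)) -> path_cont g -> path_cont (fun t => f (g t)).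
Proof.
  intros Hf Hg t eps He. destruct (Hf t eps He) as [d [Hd H']].
  destruct (Hg t d Hd) as [d2 [Hd2 H2']]. exists d2; split; auto.
Qed.

Lemma path_cont_of_parts (x y : R -> R) : (forall t, continuous x t) -> (forall t, continuous y t) ->
  path_cont (fun t => (x t, y t)).
Proof.
  intros Hx Hy t eps He.
  destruct (continuous_eps_inv x t (Hx t) (eps/2) ltac:(lra)) as [d1 [H1 H1']].
  destruct (continuous_eps_inv y t (Hy t) (eps/2) ltac:(lra)) as [d2 [H2 H2']].
  exists (Rmin d1 d2); split; [apply Rmin_glb_lt; auto|]. intros u Hu.
  specialize (H1' u (Rlt_le_trans _ _ _ Hu (Rmin_l _ _))).
  specialize (H2' u (Rlt_le_trans _ _ _ Hu (Rmin_r _ _))).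
  eapply Rle_lt_trans; [apply Cmod_le_sum|]. simpl. unfold Rminus in *. lra.
Qed.

Lemma path_cont_const c : path_cont (fun _ => c).
Proof. intros t eps He. exists 1; split; [lra|]. intros. replace (c - c)%C with (RtoC 0) by ring. rewrite Cmod_0; auto. Qed.

Lemma path_cont_RtoC : path_cont RtoC.
Proof. apply (path_cont_of_parts (fun t => t) (fun _ => 0)); intros; [apply continuous_id|apply continuous_const]. Qed.

Lemma path_cont_plus f g : path_cont f -> path_cont g -> path_cont (fun t => f t + g t)%C.
Proof.
  intros Hf Hg t eps He.
  destruct (Hf t (eps/2)) as [d1 [H1 H1']]; [lra|].
  destruct (Hg t (eps/2)) as [d2 [H2 H2']]; [lra|].
  exists (Rmin d1 d2); split; [apply Rmin_glb_lt; auto|]. intros u Hu.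
  specialize (H1' u (Rlt_le_trans _ _ _ Hu (Rmin_l _ _))).
  specialize (H2' u (Rlt_le_trans _ _ _ Hu (Rmin_r _ _))).
  replace (f u + g u - (f t + g t))%C with ((f u - f t) + (g u - g t))%C by ring.
  eapply Rle_lt_trans; [apply Cmod_triangle|]. lra.
Qed.

Lemma path_cont_mult f g : path_cont f -> path_cont g -> path_cont (fun t => f t * g t)%C.
Proof.
  intros Hf Hg.
  assert (H : forall t, continuous (fun t => Re (f t)) t) by (apply path_cont_re; auto).
  assert (H0 : forall t, continuous (fun t => Im (f t)) t) by (apply path_cont_im; auto).
  assert (H1 : forall t, continuous (fun t => Re (g t)) t) by (apply path_cont_re; auto).
  assert (H2 : forall t, continuous (fun t => Im (g t)) t) by (apply path_cont_im; auto).
  apply (path_cont_of_parts (fun t => Re (f t) * Re (g t) - Im (f t) * Im (g t))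
                     (fun t => Re (f t) * Im (g t) + Im (f t) * Re (g t))); intros t.
  - apply (continuous_minus (V:=R_NormedModule)); apply (continuous_mult (K:=R_AbsRing)); auto.
  - apply (continuous_plus (V:=R_NormedModule)); apply (continuous_mult (K:=R_AbsRing)); auto.
Qed.

Lemma path_cont_ext f g : (forall t, f t = g t) -> path_cont f -> path_cont g.
Proof. intros E H t eps He. destruct (H t eps He) as [d [Hd H']]. exists d; split; auto. intros; rewrite <- !E; auto. Qed.

Lemma ex_int_re g a b : path_cont g -> ex_RInt (fun t => Re (g t)) a b.
Proof. intros H. apply (ex_RInt_continuous (V:=R_CompleteNormedModule)). intros; apply path_cont_re; auto. Qed.
Lemma ex_int_im g a b : path_cont g -> ex_RInt (fun t => Im (g t)) a b.
Proof. intros H. apply (ex_RInt_continuous (V:=R_CompleteNormedModule)). intros; apply path_cont_im; auto. Qed.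

Lemma CInt_ext f g a b : (forall t, f t = g t) -> CInt f a b = CInt g a b.
Proof. intros E. unfold CInt. f_equal; apply RInt_ext; intros; rewrite E; auto. Qed.

Lemma CInt_plus f g a b : path_cont f -> path_cont g ->
  CInt (fun t => f t + g t)%C a b = (CInt f a b + CInt g a b)%C.
Proof.
  intros Hf Hg. unfold CInt, Cplus; cbn [fst snd].
  pose proof (RInt_plus (V:=R_CompleteNormedModule) _ _ _ _ (ex_int_re f a b Hf) (ex_int_re g a b Hg)) as H1.
  pose proof (RInt_plus (V:=R_CompleteNormedModule) _ _ _ _ (ex_int_im f a b Hf) (ex_int_im g a b Hg)) as H2.
  exact (f_equal2 pair H1 H2).
Qed.

Lemma CInt_scal c f a b : path_cont f -> CInt (fun t => c * f t)%C a b = (c * CInt f a b)%C.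
Proof.
  intros Hf. destruct c as [x y].
  assert (H1 := ex_int_re f a b Hf). assert (H2 := ex_int_im f a b Hf).
  assert (S : forall k (h : R -> R), ex_RInt h a b -> RInt (fun t => k * h t) a b = k * RInt h a b).
  { intros. apply (RInt_scal (V:=R_CompleteNormedModule)); auto. }
  assert (X : forall k (h : R -> R), ex_RInt h a b -> ex_RInt (fun t => k * h t) a b).
  { intros. apply (ex_RInt_scal (V:=R_NormedModule)); auto. }
  unfold CInt, Cmult; cbn [fst snd]. f_equal.
  - rewrite <- (S x), <- (S y) by auto.
    exact (RInt_minus (V:=R_CompleteNormedModule) _ _ _ _ (X x _ H1) (X y _ H2)).
  - rewrite <- (S x), <- (S y) by auto.
    exact (RInt_plus (V:=R_CompleteNormedModule) _ _ _ _ (X x _ H2) (X y _ H1)).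
Qed.

Lemma CInt_opp f a b : path_cont f -> CInt (fun t => - f t)%C a b = (- CInt f a b)%C.
Proof.
  intros Hf. rewrite (CInt_ext _ (fun t => (- RtoC 1) * f t)%C) by (intros; ring).
  rewrite CInt_scal by auto. ring.
Qed.

Lemma path_cont_scal c f : path_cont f -> path_cont (fun t => c * f t)%C.
Proof. intros; apply path_cont_mult; auto; apply path_cont_const. Qed.

Lemma path_cont_opp f : path_cont f -> path_cont (fun t => - f t)%C.
Proof. intros H. apply path_cont_ext with (fun t => (- RtoC 1) * f t)%C. intros; ring. apply path_cont_scal; auto. Qed.

Lemma path_cont_minus f g : path_cont f -> path_cont g -> path_cont (fun t => f t - g t)%C.
Proof. intros; apply path_cont_plus; auto; apply path_cont_opp; auto. Qed.

Lemma CInt_minus f g a b : path_cont f -> path_cont g ->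
  CInt (fun t => f t - g t)%C a b = (CInt f a b - CInt g a b)%C.
Proof. intros Hf Hg. unfold Cminus. rewrite CInt_plus, CInt_opp; auto. apply path_cont_opp; auto. Qed.

Lemma CInt_Chasles f a b c : path_cont f -> (CInt f a b + CInt f b c)%C = CInt f a c.
Proof.
  intros Hf. unfold CInt, Cplus; cbn [fst snd].
  pose proof (RInt_Chasles (V:=R_CompleteNormedModule) _ _ _ _ (ex_int_re f a b Hf) (ex_int_re f b c Hf)) as H1.
  pose proof (RInt_Chasles (V:=R_CompleteNormedModule) _ _ _ _ (ex_int_im f a b Hf) (ex_int_im f b c Hf)) as H2.
  exact (f_equal2 pair H1 H2).
Qed.

Lemma CInt_const c a b : CInt (fun _ => c) a b = ((b - a)%R * c)%C.
Proof.
  unfold CInt. rewrite !RInt_const. unfold scal, mult, Cmult, RtoC; simpl. unfold mult; simpl.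
  unfold Re, Im; f_equal; ring.
Qed.

Lemma CInt_bound f a b M : path_cont f -> a <= b -> (forall t, a <= t <= b -> Cmod (f t) <= M) ->
  Cmod (CInt f a b) <= 2 * (M * (b - a)).
Proof.
  intros Hf Hab HM.
  assert (B : forall h : R -> R, ex_RInt h a b -> (forall t, a <= t <= b -> Rabs (h t) <= M) ->
     Rabs (RInt h a b) <= M * (b - a)).
  { intros h Hh Hb. rewrite Rmult_comm. apply abs_RInt_le_const; auto. }
  eapply Rle_trans; [apply Cmod_le_sum|]. unfold CInt; simpl.
  assert (H1 := B _ (ex_int_re f a b Hf)). assert (H2 := B _ (ex_int_im f a b Hf)).
  assert (Rabs (RInt (fun t => Re (f t)) a b) <= M * (b - a)).
  { apply H1. intros t Ht. eapply Rle_trans; [apply re_le_Cmod|auto]. }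
  assert (Rabs (RInt (fun t => Im (f t)) a b) <= M * (b - a)).
  { apply H2. intros t Ht. eapply Rle_trans; [apply im_le_Cmod|auto]. }
  lra.
Qed.

Lemma path_re F (p v l : C) (t : R) : Cderiv F (p + t * v)%C l ->
  is_derive (fun u : R => Re (F (p + u * v)%C)) t (Re (l * v)%C) /\
  is_derive (fun u : R => Im (F (p + u * v)%C)) t (Im (l * v)%C).
Proof.
  intros H.
  (* [pr] is [Re] or [Im]; additivity, real homogeneity and [|pr z| <= |z|] suffice, so both
     components are handled at once. *)
  assert (K : forall pr : C -> R, (forall a b, pr (a - b)%C = pr a - pr b) ->
     (forall (x : R) b, pr (x * b)%C = x * pr b) -> (forall z, Rabs (pr z) <= Cmod z) ->
     is_derive (fun u : R => pr (F (p + u * v)%C)) t (pr (l * v)%C)).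
  { intros pr Hs Hm Hb. apply is_derive_Reals. intros eps He.
    destruct (H (eps / (2 * (1 + Cmod v)))) as [d [Hd H']].
    { pose proof (Cmod_ge_0 v). apply Rdiv_lt_0_compat; lra. }
    assert (Hv := Cmod_ge_0 v).
    assert (Hd2 : 0 < d / (1 + Cmod v)) by (apply Rdiv_lt_0_compat; lra).
    exists (mkposreal _ Hd2). intros h Hh Hhd. simpl in Hhd.
    specialize (H' (p + (t + h)%R * v)%C).
    replace (p + (t + h)%R * v - (p + t * v))%C with (h * v)%C in H' by (rewrite RtoC_plus; ring).
    rewrite Cmod_mult, Cmod_R in H'.
    assert (Hlt : Rabs h * Cmod v < d).
    { apply Rlt_div_r in Hhd; [|lra]. pose proof (Rabs_pos h). nra. }
    specialize (H' Hlt).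
    assert (Hp := Hb (F (p + (t + h)%R * v) - F (p + t * v) - l * (h * v))%C).
    rewrite !Hs in Hp. replace (l * (h * v))%C with (h * (l * v))%C in Hp by ring. rewrite Hm in Hp.
    replace (l * (h * v))%C with (h * (l * v))%C in H' by ring.
    replace ((pr (F (p + (t + h)%R * v)%C) - pr (F (p + t * v)%C)) / h - pr (l * v)%C)
      with ((pr (F (p + (t + h)%R * v)%C) - pr (F (p + t * v)%C) - h * pr (l * v)%C) / h) by (field; auto).
    rewrite Rabs_div by auto. assert (0 < Rabs h) by (apply Rabs_pos_lt; auto).
    apply Rlt_div_l; auto. eapply Rle_lt_trans; [apply Hp|]. eapply Rle_lt_trans; [apply H'|].
    replace (eps / (2 * (1 + Cmod v)) * (Rabs h * Cmod v)) with (eps * Rabs h * (Cmod v / (2 * (1 + Cmod v)))) by (field; lra).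
    apply Rlt_le_trans with (eps * Rabs h * 1); [|lra]. apply Rmult_lt_compat_l.
    apply Rmult_lt_0_compat; auto. apply Rlt_div_l; lra. }
  split.
  - apply (K Re); [intros; unfold Re; simpl; ring| intros; unfold Re, Cmult; simpl; ring | apply re_le_Cmod].
  - apply (K Im); [intros; unfold Im; simpl; ring| intros; unfold Im, Cmult; simpl; ring | apply im_le_Cmod].
Qed.

Lemma CInt_FTC F f (p v : C) a b : (forall z, Cderiv F z (f z)) -> (forall z, Ccont f z) ->
  CInt (fun t => f (p + t * v) * v)%C a b = (F (p + b * v) - F (p + a * v))%C.
Proof.
  intros HF Hf.
  assert (Hrc : path_cont (fun t => f (p + t * v) * v)%C).
  { apply path_cont_mult; [|apply path_cont_const]. apply (path_cont_comp f); auto.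
    apply path_cont_plus; [apply path_cont_const|]. apply path_cont_mult; [apply path_cont_RtoC|apply path_cont_const]. }
  assert (H1 := is_RInt_derive (V:=R_CompleteNormedModule) (fun t : R => Re (F (p + t * v)%C))
    (fun t => Re (f (p + t * v) * v)%C) a b
    (fun t _ => proj1 (path_re F p v _ t (HF _))) (fun t _ => path_cont_re _ Hrc t)).
  assert (H2 := is_RInt_derive (V:=R_CompleteNormedModule) (fun t : R => Im (F (p + t * v)%C))
    (fun t => Im (f (p + t * v) * v)%C) a b
    (fun t _ => proj2 (path_re F p v _ t (HF _))) (fun t _ => path_cont_im _ Hrc t)).
  apply is_RInt_unique in H1. apply is_RInt_unique in H2.
  exact (f_equal2 pair H1 H2).
Qed.

(** A substitute for compactness: a rectangle violating [Pr] has a violating quarter, and the nested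
    quarters shrink to a point where the local hypothesis is contradicted. It yields both
    boundedness on discs and Goursat's lemma. *)
Lemma bisect (Pr : R -> R -> R -> R -> Prop) :
  (forall a b c d, a <= b -> c <= d ->
     let m := (a + b) / 2 in let n := (c + d) / 2 in
     Pr a m c n -> Pr m b c n -> Pr a m n d -> Pr m b n d -> Pr a b c d) ->
  (forall x y, exists del, 0 < del /\ forall a b c d, a <= x <= b -> c <= y <= d ->
     b - a < del -> d - c < del -> Pr a b c d) ->
  forall a b c d, a <= b -> c <= d -> Pr a b c d.
Proof.
  intros Hadd Hloc a0 b0 c0 d0 Hab Hcd.
  apply NNPP. intros Hbad.
  set (T := (R * R * (R * R))%type).
  set (P := fun q : T => Pr (fst (fst q)) (snd (fst q)) (fst (snd q)) (snd (snd q))).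
  set (good := fun q : T => fst (fst q) <= snd (fst q) /\ fst (snd q) <= snd (snd q) /\ ~ P q).
  set (half := fun q q' : T =>
     fst (fst q) <= fst (fst q') /\ snd (fst q') <= snd (fst q) /\
     fst (snd q) <= fst (snd q') /\ snd (snd q') <= snd (snd q) /\
     snd (fst q') - fst (fst q') = (snd (fst q) - fst (fst q)) / 2 /\
     snd (snd q') - fst (snd q') = (snd (snd q) - fst (snd q)) / 2).
  assert (Hstep : forall q, good q -> exists q', good q' /\ half q q').
  { intros [[a b] [c d]] [H1 [H2 H3]]. unfold P in H3; simpl in *.
    apply NNPP. intros Hn. apply H3. apply Hadd; auto; apply NNPP; intros Hq; apply Hn.
    - exists ((a, (a+b)/2), (c, (c+d)/2)). unfold good, half, P; simpl. repeat split; auto; lra.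
    - exists (((a+b)/2, b), (c, (c+d)/2)). unfold good, half, P; simpl. repeat split; auto; lra.
    - exists ((a, (a+b)/2), ((c+d)/2, d)). unfold good, half, P; simpl. repeat split; auto; lra.
    - exists (((a+b)/2, b), ((c+d)/2, d)). unfold good, half, P; simpl. repeat split; auto; lra. }
  (* The chosen quarter is meaningful only when [q] is itself bad ([good] here means a bad rectangle
     with ordered sides), so [good] is carried along the sequence by induction. *)
  set (nxt := fun q => epsilon (inhabits q) (fun q' => good q' /\ half q q')).
  set (s := nat_rect (fun _ => T) ((a0, b0), (c0, d0)) (fun _ q => nxt q)).
  assert (Hs : forall n, good (s n)).
  { induction n. unfold good, P; simpl; auto.
    simpl. exact (proj1 (epsilon_spec (inhabits (s n)) _ (Hstep _ IHn))). }
  assert (Hh : forall n, half (s n) (s (S n))).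
  { intros n. simpl. exact (proj2 (epsilon_spec (inhabits (s n)) _ (Hstep _ (Hs n)))). }
  set (A := fun n => fst (fst (s n))). set (B := fun n => snd (fst (s n))).
  set (C' := fun n => fst (snd (s n))). set (D := fun n => snd (snd (s n))).
  assert (Hpt : forall (u v : nat -> R), (forall n, u n <= v n) ->
     (forall n, u n <= u (S n)) -> (forall n, v (S n) <= v n) -> exists x, forall n, u n <= x <= v n).
  { intros u v H1 H2 H3.
    assert (Hu : forall n k, u n <= u (n + k)%nat).
    { induction k. rewrite Nat.add_0_r; lra. rewrite Nat.add_succ_r. pose proof (H2 (n + k)%nat). lra. }
    assert (Hv : forall n k, v (n + k)%nat <= v n).
    { induction k. rewrite Nat.add_0_r; lra. rewrite Nat.add_succ_r. pose proof (H3 (n + k)%nat). lra. }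
    assert (Huv : forall n m, u n <= v m).
    { intros n m. pose proof (Hu n m). pose proof (Hv m n). rewrite Nat.add_comm in H0.
      pose proof (H1 (n + m)%nat). lra. }
    destruct (completeness (fun x => exists n, x = u n)) as [x [Hx1 Hx2]].
    - exists (v O). intros y [n ->]. auto.
    - exists (u O), O; auto.
    - exists x. intros n. split. apply Hx1; eauto. apply Hx2. intros y [m ->]. auto. }
  destruct (Hpt A B) as [x Hx].
  { intros n; apply (Hs n). } { intros n; apply (Hh n). } { intros n; apply (Hh n). }
  destruct (Hpt C' D) as [y Hy].
  { intros n; apply (Hs n). } { intros n; apply (Hh n). } { intros n; apply (Hh n). }
  destruct (Hloc x y) as [del [Hdel Hloc']].
  assert (Hw : forall n, B n - A n = (b0 - a0) * (/2) ^ n /\ D n - C' n = (d0 - c0) * (/2) ^ n).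
  { induction n. unfold A, B, C', D; simpl; lra.
    destruct (Hh n) as [_ [_ [_ [_ [E1 E2]]]]]. unfold A, B, C', D in *.
    destruct IHn as [I1 I2]. rewrite I1 in E1. rewrite I2 in E2. rewrite E1, E2. simpl. lra. }
  (* One bound on [2^-n] makes both sides shorter than [del]; the 1 covers degenerate rectangles. *)
  destruct (pow_lt_1_zero (/2) ltac:(rewrite Rabs_right; lra) (del / (1 + (b0 - a0) + (d0 - c0)))) as [n Hn].
  { apply Rdiv_lt_0_compat; lra. }
  specialize (Hn n (le_n _)). assert (Hp : 0 < (/2)^n) by (apply pow_lt; lra).
  rewrite Rabs_right in Hn by lra. apply Rlt_div_r in Hn; [|lra].
  destruct (Hw n) as [W1 W2].
  apply (proj2 (proj2 (Hs n))). unfold P. apply Hloc'; [apply Hx|apply Hy| |].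
  - fold (A n) (B n). rewrite W1. nra.
  - fold (C' n) (D n). rewrite W2. nra.
Qed.

Lemma Ceq_parts (z : C) : z = (RtoC (Re z) + Im z * Ci)%C.
Proof. destruct z; unfold Cplus, Cmult, RtoC, Ci; simpl; f_equal; ring. Qed.

(** Bisection of the square around the disc: having a bound passes from the four quarters to the
    whole by taking the maximum, and holds near each point by continuity. *)
Lemma Ccont_bounded f : (forall z, Ccont f z) ->
  forall R0, exists M, 0 <= M /\ forall z, Cmod z <= R0 -> Cmod (f z) <= M.
Proof.
  intros Hf R0. destruct (Rle_lt_dec 0 R0).
  2:{ exists 0; split; [lra|]. intros z Hz. pose proof (Cmod_ge_0 z); lra. }
  assert (H : exists M, forall x y, - R0 <= x <= R0 -> - R0 <= y <= R0 -> Cmod (f (RtoC x + RtoC y * Ci)%C) <= M).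
  { apply (bisect (fun a b c d => exists M, forall x y, a <= x <= b -> c <= y <= d ->
       Cmod (f (RtoC x + RtoC y * Ci)%C) <= M)); try lra.
    - intros a b c d _ _ m n [M1 H1] [M2 H2] [M3 H3] [M4 H4].
      exists (Rmax (Rmax M1 M2) (Rmax M3 M4)). intros x y Hx Hy.
      pose proof (Rmax_l M1 M2); pose proof (Rmax_r M1 M2).
      pose proof (Rmax_l M3 M4); pose proof (Rmax_r M3 M4).
      pose proof (Rmax_l (Rmax M1 M2) (Rmax M3 M4)); pose proof (Rmax_r (Rmax M1 M2) (Rmax M3 M4)).
      destruct (Rle_lt_dec x m); destruct (Rle_lt_dec y n).
      + specialize (H1 x y ltac:(lra) ltac:(lra)); lra.
      + specialize (H3 x y ltac:(lra) ltac:(lra)); lra.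
      + specialize (H2 x y ltac:(lra) ltac:(lra)); lra.
      + specialize (H4 x y ltac:(lra) ltac:(lra)); lra.
    - intros x y. destruct (Hf (RtoC x + RtoC y * Ci)%C 1 ltac:(lra)) as [d [Hd Hd']].
      exists (d / 2). split; [lra|]. intros a b c e Hx Hy H1 H2.
      exists (Cmod (f (RtoC x + RtoC y * Ci)%C) + 1). intros x' y' Hx' Hy'.
      eapply Rle_trans; [apply (Cmod_le_diff _ (f (RtoC x + RtoC y * Ci)%C))|].
      apply Rplus_le_compat_l. left. apply Hd'.
      eapply Rle_lt_trans; [apply Cmod_le_sum|].
      replace (Re (x' + y' * Ci - (x + y * Ci))) with (x' - x) by (unfold Re, Ci; simpl; ring).
      replace (Im (x' + y' * Ci - (x + y * Ci))) with (y' - y) by (unfold Im, Ci; simpl; ring).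
      assert (Rabs (x' - x) < d/2) by (apply Rabs_lt_between; lra).
      assert (Rabs (y' - y) < d/2) by (apply Rabs_lt_between; lra). lra. }
  destruct H as [M HM]. exists (Rmax 0 M). split; [apply Rmax_l|]. intros z Hz.
  eapply Rle_trans; [|apply Rmax_r]. rewrite (Ceq_parts z).
  pose proof (re_le_Cmod z). pose proof (im_le_Cmod z).
  apply HM; apply Rabs_le_between; lra.
Qed.

(** * Cauchy's theorem for rectangles *)

Definition side (f : C -> C) (p v : C) (a b : R) : C := CInt (fun t : R => f (p + t * v) * v)%C a b.

(** The boundary is traversed counterclockwise: bottom and right side forwards, top and left side
    backwards. *)
Definition rect_int (f : C -> C) (a b c d : R) : C :=
  (side f (Ci * c) 1 a b + side f b Ci c d - side f (Ci * d) 1 a b - side f a Ci c d)%C.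

Lemma path_cont_line (p v : C) : path_cont (fun t : R => p + t * v)%C.
Proof. apply path_cont_plus; [apply path_cont_const|]. apply path_cont_mult; [apply path_cont_RtoC|apply path_cont_const]. Qed.

Lemma path_cont_side f (p v : C) : (forall z, Ccont f z) -> path_cont (fun t : R => f (p + t * v) * v)%C.
Proof. intros H. apply path_cont_mult; [|apply path_cont_const]. apply (path_cont_comp f); auto. apply path_cont_line. Qed.

Lemma side_Chasles f p v a b c : (forall z, Ccont f z) -> (side f p v a b + side f p v b c)%C = side f p v a c.
Proof. intros H. apply CInt_Chasles. apply path_cont_side; auto. Qed.

Lemma rect_int_add f a b c d m n : (forall z, Ccont f z) ->
  rect_int f a b c d = (rect_int f a m c n + rect_int f m b c n + rect_int f a m n d + rect_int f m b n d)%C.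
Proof.
  intros H. unfold rect_int.
  rewrite <- (side_Chasles f (Ci * c) 1 a m b H), <- (side_Chasles f (Ci * d) 1 a m b H),
   <- (side_Chasles f b Ci c n d H), <- (side_Chasles f a Ci c n d H). ring.
Qed.

Lemma rect_int_ext f g a b c d : (forall z, f z = g z) -> rect_int f a b c d = rect_int g a b c d.
Proof.
  intros E.
  assert (S : forall p v x y, side f p v x y = side g p v x y).
  { intros. apply CInt_ext. intros; rewrite E; auto. }
  unfold rect_int. rewrite !S. auto.
Qed.

Lemma rect_int_plus f g a b c d : (forall z, Ccont f z) -> (forall z, Ccont g z) ->
  rect_int (fun z => f z + g z)%C a b c d = (rect_int f a b c d + rect_int g a b c d)%C.
Proof.
  intros Hf Hg.
  assert (S : forall p v x y, side (fun z => f z + g z)%C p v x y = (side f p v x y + side g p v x y)%C).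
  { intros. unfold side. rewrite <- CInt_plus by (apply path_cont_side; auto). apply CInt_ext. intros; ring. }
  unfold rect_int. rewrite !S. ring.
Qed.

Lemma rect_int_primitive F f a b c d : (forall z, Cderiv F z (f z)) -> (forall z, Ccont f z) ->
  rect_int f a b c d = 0%C.
Proof.
  intros HF Hf. unfold rect_int, side. rewrite !(CInt_FTC F f) by auto.
  assert (E : forall x y : R, F (Ci * y + x * 1)%C = F (x + y * Ci)%C) by (intros; f_equal; ring).
  rewrite !E. ring.
Qed.

Lemma rect_int_bound f a b c d M : (forall z, Ccont f z) -> a <= b -> c <= d ->
  (forall x y, a <= x <= b -> c <= y <= d -> Cmod (f (RtoC x + y * Ci)%C) <= M) ->
  Cmod (rect_int f a b c d) <= 4 * (M * ((b - a) + (d - c))).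
Proof.
  intros Hf Hab Hcd HM.
  assert (Hh : forall y, c <= y <= d -> Cmod (side f (Ci * y) 1 a b) <= 2 * (M * (b - a))).
  { intros y Hy. apply CInt_bound; auto. apply path_cont_side; auto. intros t Ht. rewrite Cmult_1_r.
    replace (Ci * y + t * 1)%C with (t + y * Ci)%C by ring. auto. }
  assert (Hv : forall x, a <= x <= b -> Cmod (side f x Ci c d) <= 2 * (M * (d - c))).
  { intros x Hx. apply CInt_bound; auto. apply path_cont_side; auto. intros t Ht. rewrite Cmod_mult, Cmod_Ci, Rmult_1_r. auto. }
  pose proof (Hh c ltac:(lra)). pose proof (Hh d ltac:(lra)).
  pose proof (Hv a ltac:(lra)). pose proof (Hv b ltac:(lra)).
  unfold rect_int.
  eapply Rle_trans; [apply Cmod_triangle_minus|].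
  eapply Rle_trans; [apply Rplus_le_compat_r, Cmod_triangle_minus|].
  eapply Rle_trans; [apply Rplus_le_compat_r, Rplus_le_compat_r, Cmod_triangle|]. lra.
Qed.

(** The target bound is [4 eps] times the squared half-perimeter: quartering halves the perimeter,
    so the four bounds add up exactly to the bound of the whole. Near a point it follows from
    differentiability, and [eps] is arbitrary. *)
Lemma goursat f a b c d : Centire f -> a <= b -> c <= d -> rect_int f a b c d = 0%C.
Proof.
  intros Hf Hab Hcd. pose proof (Centire_Ccont f Hf) as Cf.
  assert (H : forall eps, 0 < eps -> Cmod (rect_int f a b c d) <= 4 * eps * ((b - a) + (d - c)) ^ 2).
  { intros eps He.
    apply (bisect (fun a b c d => Cmod (rect_int f a b c d) <= 4 * eps * ((b - a) + (d - c)) ^ 2)); auto.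
    - clear - Cf. intros a b c d _ _ m n H1 H2 H3 H4.
      rewrite (rect_int_add f a b c d m n Cf).
      eapply Rle_trans; [apply Cmod_triangle|].
      eapply Rle_trans; [apply Rplus_le_compat_r, Cmod_triangle|].
      eapply Rle_trans; [apply Rplus_le_compat_r, Rplus_le_compat_r, Cmod_triangle|].
      unfold m, n in *. nra.
    - clear - Hf Cf He. intros x y. set (p := (RtoC x + y * Ci)%C).
      destruct (Hf p) as [l Hl]. destruct (Hl eps He) as [del [Hdel Hd]].
      exists (del / 2). split; [lra|]. intros a b c d Hx Hy Hab Hcd.
      (* The tangent map [h] has a quadratic primitive and integrates to zero, so only the remainder
         [r] counts: it is at most [eps] times the half-perimeter, on a boundary of comparable
         length. *)
      set (r := fun z => (f z - (f p + l * (z - p)))%C).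
      set (h := fun z => (f p + l * (z - p))%C).
      assert (Ch : forall z, Ccont h z).
      { intros z. apply Ccont_plus; [apply Ccont_const|]. apply Ccont_mult; [apply Ccont_const|].
        apply Ccont_plus; [apply Ccont_id|apply Ccont_const]. }
      assert (Cr : forall z, Ccont r z).
      { intros z. apply Ccont_ext with (fun z => f z + (- RtoC 1) * h z)%C. { intros; unfold r, h; ring. }
        apply Ccont_plus; auto. apply Ccont_mult; auto; apply Ccont_const. }
      assert (E : rect_int f a b c d = (rect_int h a b c d + rect_int r a b c d)%C).
      { rewrite <- rect_int_plus by auto.
        apply rect_int_ext. intros; unfold h, r; ring. }
      rewrite E. rewrite (rect_int_primitive (fun z => f p * z + l * ((z - p) * (z - p)) * / 2)%C h); auto.
      + rewrite Cplus_0_l. eapply Rle_trans.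
        * apply rect_int_bound with (M := eps * ((b - a) + (d - c))); auto; try lra.
          intros x' y' Hx' Hy'. unfold r.
          replace (f (x' + y' * Ci) - (f p + l * (x' + y' * Ci - p)))%C
            with (f (x' + y' * Ci) - f p - l * (x' + y' * Ci - p))%C by ring.
          assert (Hs : Cmod (x' + y' * Ci - p) <= (b - a) + (d - c)).
          { eapply Rle_trans; [apply Cmod_le_sum|]. unfold p.
            replace (Re (x' + y' * Ci - (x + y * Ci))) with (x' - x) by (unfold Re, Ci; simpl; ring).
            replace (Im (x' + y' * Ci - (x + y * Ci))) with (y' - y) by (unfold Im, Ci; simpl; ring).
            assert (Rabs (x' - x) <= b - a) by (apply Rabs_le_between; lra).
            assert (Rabs (y' - y) <= d - c) by (apply Rabs_le_between; lra). lra. }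
          eapply Rle_trans; [apply Hd; lra|]. apply Rmult_le_compat_l; lra.
        * right; ring.
      + intros z. unfold h. eapply Cderiv_eq.
        * apply Cderiv_plus. apply Cderiv_scal, Cderiv_id.
          apply Cderiv_ext with (fun z => (l * /2) * ((z - p) * (z - p)))%C. { intros; field; intros K; apply RtoC_inj in K; lra. }
          apply Cderiv_scal. apply Cderiv_mult; apply Cderiv_minus; try apply Cderiv_id; apply Cderiv_const.
        * cbv beta; field; intros K; apply RtoC_inj in K; lra. }
  apply Cmod_eq_0. apply Rle_antisym; [|apply Cmod_ge_0].
  apply le_epsilon. intros eps He. rewrite Rplus_0_l.
  set (s := (b - a) + (d - c)) in *. assert (0 <= s) by (unfold s; lra).
  assert (K : 0 < 4 * (1 + s ^ 2)) by (pose proof (pow2_ge_0 s); lra).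
  eapply Rle_trans; [apply (H (eps / (4 * (1 + s ^ 2))))|].
  - apply Rdiv_lt_0_compat; lra.
  - replace (4 * (eps / (4 * (1 + s ^ 2))) * s ^ 2) with (eps * (s ^ 2 / (1 + s ^ 2))) by (field; nra).
    assert (s ^ 2 / (1 + s ^ 2) <= 1). { apply Rle_div_l; pose proof (pow2_ge_0 s); lra. } nra.
Qed.

Lemma Cexp_period z : Cexp (z + Ci * RtoC (2 * PI))%C = Cexp z.
Proof.
  rewrite Cexp_plus. replace (Cexp (Ci * RtoC (2 * PI))) with (RtoC 1). ring.
  unfold Cexp.
  replace (Re (Ci * RtoC (2 * PI))) with 0 by (unfold Re, Ci; simpl; ring).
  replace (Im (Ci * RtoC (2 * PI))) with (2 * PI) by (unfold Im, Ci; simpl; ring).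
  rewrite exp_0, cos_2PI, sin_2PI. unfold RtoC; f_equal; ring.
Qed.

(* The circle of radius [exp x] about [a] is the image of a vertical segment
   under [w |-> a + exp w], which carries the circle mean to rectangle integrals. *)
Lemma mean_value f (a : C) : Ccont f a -> (forall z, z <> a -> exists l, Cderiv f z l) ->
  forall x : R, CInt (fun t : R => f (a + Cexp (x + t * Ci))%C) 0 (2 * PI) = (RtoC (2 * PI) * f a)%C.
Proof.
  intros Ha Hf.
  set (g := fun w => f (a + Cexp w)%C).
  (* The exponential omits 0, so [g] never evaluates [f] at [a]; continuity is all that is asked of
     [f] there. *)
  assert (Hg : Centire g).
  { intros w. destruct (Hf (a + Cexp w)%C) as [l Hl].
    { intros E. apply (Cexp_neq_0 w). replace (Cexp w) with (a + Cexp w - a)%C by ring. rewrite E. ring. }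
    eexists. apply (Cderiv_comp f (fun w => a + Cexp w)%C w).
    - apply Cderiv_plus; [apply Cderiv_const|apply Cderiv_Cexp].
    - apply Hl. }
  pose proof (Centire_Ccont _ Hg) as Cg. pose proof PI_RGT_0 as Hpi.
  set (M := fun x : R => CInt (fun t : R => g (x + t * Ci)%C) 0 (2 * PI)).
  assert (Rg : forall x : R, path_cont (fun t : R => g (x + t * Ci)%C)).
  { intros x. apply (path_cont_comp g); auto. apply path_cont_line. }
  (* Goursat on the rectangle of height [2 PI]: the horizontal sides cancel by periodicity, so the
     circle integral does not depend on the radius. *)
  assert (HM : forall x1 x2, x1 <= x2 -> M x1 = M x2).
  { intros x1 x2 Hx. pose proof (goursat g x1 x2 0 (2 * PI) Hg Hx ltac:(lra)) as G.
    assert (S : forall x : R, side g x Ci 0 (2 * PI) = (Ci * M x)%C).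
    { intros x. unfold side, M. rewrite <- CInt_scal by auto. apply CInt_ext. intros; ring. }
    unfold rect_int in G. rewrite !S in G.
    assert (E : side g (Ci * RtoC 0) 1 x1 x2 = side g (Ci * RtoC (2 * PI)) 1 x1 x2).
    { unfold side. apply CInt_ext. intros t. f_equal. unfold g.
      replace (Ci * RtoC (2 * PI) + t * 1)%C with ((Ci * RtoC 0 + t * 1) + Ci * RtoC (2 * PI))%C by ring.
      rewrite Cexp_period. auto. }
    rewrite E in G.
    assert (G' : (Ci * (M x2 - M x1))%C = 0%C) by (rewrite <- G; ring).
    apply Ceq_minus. replace (M x1 - M x2)%C with (Ci * (Ci * (M x2 - M x1)))%C.
    - rewrite G'. ring.
    - replace (Ci * (Ci * (M x2 - M x1)))%C with ((Ci * Ci) * (M x2 - M x1))%C by ring.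
      replace (Ci * Ci)%C with (- RtoC 1)%C. ring.
      unfold Cmult, Copp, Ci, RtoC; simpl; f_equal; ring. }
  intros x. change (M x = (RtoC (2 * PI) * f a)%C).
  apply Ceq_minus. apply Cmod_eq_0. apply Rle_antisym; [|apply Cmod_ge_0].
  apply le_epsilon. intros eps He. rewrite Rplus_0_l.
  assert (He' : 0 < eps / (4 * PI)) by (apply Rdiv_lt_0_compat; lra).
  destruct (Ha _ He') as [d [Hd Hd']].
  (* The radius shrinks to [exp x1 < d], where [f] is within [eps / (4 PI)] of [f a]; the length
     [2 PI] and the factor 2 of [CInt_bound] restore [eps]. *)
  set (x1 := Rmin x (ln d - 1)). rewrite <- (HM x1 x) by apply Rmin_l.
  assert (E : (M x1 - RtoC (2 * PI) * f a)%C = CInt (fun t : R => g (x1 + t * Ci) - f a)%C 0 (2 * PI)).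
  { rewrite CInt_minus by (auto; apply path_cont_const). rewrite CInt_const. rewrite Rminus_0_r. reflexivity. }
  rewrite E. eapply Rle_trans.
  - apply CInt_bound with (M := eps / (4 * PI)); try lra.
    + apply path_cont_minus; auto; apply path_cont_const.
    + intros t _. left. unfold g. apply Hd'.
      replace (a + Cexp (x1 + t * Ci) - a)%C with (Cexp (x1 + t * Ci)) by ring.
      rewrite Cmod_Cexp. replace (Re (x1 + t * Ci)) with x1 by (unfold Re, Ci; simpl; ring).
      assert (x1 <= ln d - 1) by apply Rmin_r.
      rewrite <- (exp_ln d) by auto. apply exp_increasing. lra.
  - right. field. lra.
Qed.

(** * Derivatives, primitives and logarithms of entire functions *)

(** There is no mean value equality for complex values, so the real theorem is applied to [Re F] and
    [Im F] separately, whence the factor 2. *)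
Lemma mvt_segment F (p v : C) B :
  (forall t, 0 <= t <= 1 -> exists l, Cderiv F (p + RtoC t * v)%C l /\ Cmod l <= B) ->
  Cmod (F (p + v) - F p)%C <= 2 * B * Cmod v.
Proof.
  intros H.
  set (L := fun t : R => C_derive F (p + t * v)%C).
  assert (HL : forall t, 0 <= t <= 1 -> Cderiv F (p + RtoC t * v)%C (L t) /\ Cmod (L t) <= B).
  { intros t Ht. destruct (H t Ht) as [l [H1 H2]]. unfold L.
    replace (C_derive F (p + t * v)%C) with l; auto.
    symmetry. apply is_C_derive_unique, is_derive_Cderiv; auto. }
  assert (K : forall (pr : C -> R), (forall z, Rabs (pr z) <= Cmod z) ->
    (forall t, 0 <= t <= 1 -> is_derive (fun u : R => pr (F (p + u * v)%C)) t (pr (L t * v)%C)) ->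
    Rabs (pr (F (p + RtoC 1 * v)%C) - pr (F (p + RtoC 0 * v)%C)) <= B * Cmod v).
  { intros pr Hp Hd.
    destruct (MVT_gen (fun u : R => pr (F (p + u * v)%C)) 0 1 (fun t => pr (L t * v)%C)) as [c [Hc E]].
    - rewrite Rmin_left, Rmax_right by lra. intros; apply Hd; lra.
    - rewrite Rmin_left, Rmax_right by lra. intros u Hu. apply derivable_continuous_pt.
      exists (pr (L u * v)%C). apply is_derive_Reals. auto.
    - rewrite Rmin_left, Rmax_right in Hc by lra. rewrite E.
      replace (pr (L c * v)%C * (1 - 0)) with (pr (L c * v)%C) by ring.
      eapply Rle_trans; [apply Hp|]. rewrite Cmod_mult. apply Rmult_le_compat_r; [apply Cmod_ge_0|].
      apply HL; auto. }
  replace (p + v)%C with (p + RtoC 1 * v)%C by ring.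
  replace (F p) with (F (p + RtoC 0 * v)%C) by (f_equal; ring).
  eapply Rle_trans; [apply Cmod_le_sum|].
  assert (K1 := K Re re_le_Cmod (fun t Ht => proj1 (path_re F p v _ t (proj1 (HL t Ht))))).
  assert (K2 := K Im im_le_Cmod (fun t Ht => proj2 (path_re F p v _ t (proj1 (HL t Ht))))).
  unfold Cminus. rewrite re_plus, im_plus, re_opp, im_opp. unfold Rminus in *. lra.
Qed.

Lemma Centire_zero_derive F : (forall z, Cderiv F z 0%C) -> forall z w, F z = F w.
Proof.
  intros H z w. apply Ceq_minus, Cmod_eq_0, Rle_antisym; [|apply Cmod_ge_0].
  replace z with (w + (z - w))%C at 1 by ring.
  eapply Rle_trans. apply mvt_segment with (B := 0).
  - intros t _. exists 0%C. split; auto. rewrite Cmod_0; lra.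
  - lra.
Qed.

(** Differentiation under the integral sign: a quadratic remainder that is uniform in [t] stays
    quadratic after integration. *)
Lemma CInt_param (K : C -> R -> C) k (z : C) r B a b : a <= b -> 0 < r -> 0 <= B ->
  (forall w, path_cont (K w)) -> path_cont k ->
  (forall w t, Cmod (w - z) < r -> a <= t <= b ->
     Cmod (K w t - K z t - k t * (w - z)) <= B * Cmod (w - z) ^ 2) ->
  Cderiv (fun w => CInt (K w) a b) z (CInt k a b).
Proof.
  intros Hab Hr HB HK Hk H.
  apply Cderiv_of_square_bound with (2 * (B * (b - a))) r; auto. { nra. }
  intros w Hw.
  replace (CInt (K w) a b - CInt (K z) a b - CInt k a b * (w - z))%C
    with (CInt (fun t => K w t - K z t - (w - z) * k t)%C a b).
  - replace (2 * (B * (b - a)) * Cmod (w - z) ^ 2) with (2 * ((B * Cmod (w - z) ^ 2) * (b - a))) by ring.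
    apply CInt_bound; auto.
    + apply path_cont_minus; [apply path_cont_minus; auto|apply path_cont_scal; auto].
    + intros t Ht. rewrite (Cmult_comm (w - z)). auto.
  - rewrite CInt_minus by (try apply path_cont_minus; auto; apply path_cont_scal; auto).
    rewrite CInt_minus by auto. rewrite CInt_scal by auto. ring.
Qed.

(** The summand 0 keeps the shape of the integrand of [mean_value] at [x = 0], which is the circle
    of radius 1. *)
Definition cis (t : R) : C := Cexp (0 + t * Ci)%C.

Lemma path_cont_cis : path_cont cis.
Proof. apply (path_cont_comp Cexp). intros; apply Centire_Ccont, Centire_Cexp. apply path_cont_line. Qed.

Lemma Cmod_cis t : Cmod (cis t) = 1.
Proof. unfold cis. rewrite Cmod_Cexp. replace (Re (0 + t * Ci)) with 0 by (unfold Re, Ci; simpl; ring). apply exp_0. Qed.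

Lemma cis_neq_0 t : cis t <> 0%C.
Proof. apply Cexp_neq_0. Qed.

Lemma path_cont_inv_cis : path_cont (fun t => / cis t)%C.
Proof. apply (path_cont_comp Cinv); [|apply path_cont_cis]. intros; apply Ccont_inv, cis_neq_0. Qed.

Lemma RtoC_neq_0 (x : R) : x <> 0 -> RtoC x <> RtoC 0.
Proof. intros H E. apply RtoC_inj in E. auto. Qed.

Lemma CInt_inv_cis : CInt (fun t => / cis t)%C 0 (2 * PI) = 0%C.
Proof.
  assert (HC : (- Ci)%C <> 0%C). { intros E. apply Ci_nz. replace Ci with (- - Ci)%C by ring. rewrite E. ring. }
  assert (E : CInt (fun t : R => Cexp (0 + t * (- Ci)) * (- Ci))%C 0 (2 * PI) = 0%C).
  { rewrite (CInt_FTC Cexp Cexp) by (intros; (apply Cderiv_Cexp || apply Centire_Ccont, Centire_Cexp)).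
    rewrite <- (Cexp_period (0 + RtoC (2 * PI) * - Ci)).
    replace (0 + RtoC (2 * PI) * - Ci + Ci * RtoC (2 * PI))%C with (0 + 0 * - Ci)%C by ring. ring. }
  assert (E2 : CInt (fun t : R => (- Ci) * / cis t)%C 0 (2 * PI) = 0%C).
  { rewrite <- E. apply CInt_ext. intros t. unfold cis. rewrite <- Cexp_opp, Cmult_comm. f_equal. f_equal. ring. }
  rewrite CInt_scal in E2 by apply path_cont_inv_cis.
  replace (CInt (fun t => / cis t)%C 0 (2 * PI)) with (/ (- Ci) * (- Ci * CInt (fun t => / cis t)%C 0 (2 * PI)))%C by (field; apply Ci_nz).
  rewrite E2. ring.
Qed.

Lemma PI2_neq_0 : RtoC (2 * PI) <> RtoC 0.
Proof. apply RtoC_neq_0. pose proof PI_RGT_0; lra. Qed.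

(** The mean value property of the divided difference is Cauchy's formula for the derivative as an
    integral over the unit circle. This formula transfers bounds from [f] to [d] and can be
    differentiated under the integral. *)
Lemma Centire_derive f : Centire f -> exists d, (forall z, Cderiv f z (d z)) /\ Centire d.
Proof.
  intros Hf. pose proof (Centire_Ccont f Hf) as Cf. pose proof PI_RGT_0 as Hpi. pose proof PI2_neq_0 as Hpi2.
  set (d := fun a : C => (/ RtoC (2 * PI) * CInt (fun t => f (a + cis t)%C * / cis t)%C 0 (2 * PI))%C).
  assert (Rf : forall g, (forall z, Ccont g z) -> forall a : C, path_cont (fun t => g (a + cis t)%C * / cis t)%C).
  { intros g Cg a. apply path_cont_mult; [|apply path_cont_inv_cis]. apply (path_cont_comp g); auto.
    apply path_cont_plus; [apply path_cont_const|apply path_cont_cis]. }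
  assert (Hd : forall z, Cderiv f z (d z)).
  { intros a. destruct (Hf a) as [l Hl]. eapply Cderiv_eq; [apply Hl|].
    (* Only continuity of [q] at [a] is known at this point; [mean_value] was stated with that weak
       hypothesis for this use. *)
    set (q := fun z => if Ceq_dec z a then l else ((f z - f a) / (z - a))%C).
    assert (Ca : Ccont q a).
    { apply Cderiv_carath in Hl. destruct Hl as [phi [E [Cp F]]].
      apply Ccont_ext with phi; auto. intros w. unfold q. destruct (Ceq_dec w a); subst; auto.
      rewrite (F w). field. apply Cminus_eq_contra; auto. }
    assert (Hq : forall z, z <> a -> exists m, Cderiv q z m).
    { intros z Hz. destruct (Hf z) as [m Hm]. eexists.
      apply Cderiv_ext_loc with (fun z => (f z - f a) / (z - a))%C (Cmod (a - z)).
      - apply Cmod_pos, Cminus_eq_contra; auto.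
      - intros w Hw. unfold q. destruct (Ceq_dec w a); auto. subst. lra.
      - apply Cderiv_div. apply Cderiv_minus; [apply Hm|apply Cderiv_const].
        apply Cderiv_minus; [apply Cderiv_id|apply Cderiv_const]. apply Cminus_eq_contra; auto. }
    pose proof (mean_value q a Ca Hq 0) as MV.
    rewrite (CInt_ext _ (fun t => f (a + cis t)%C * / cis t - f a * / cis t)%C) in MV.
    - rewrite CInt_minus, CInt_scal, CInt_inv_cis in MV; try apply path_cont_scal; try apply path_cont_inv_cis; auto.
      unfold d. replace (q a) with l in MV by (unfold q; destruct (Ceq_dec a a); congruence).
      replace l with (/ RtoC (2 * PI) * (RtoC (2 * PI) * l))%C by (field; auto).
      rewrite <- MV. f_equal. ring.
    - intros t. fold (cis t). unfold q. pose proof (cis_neq_0 t) as Ht.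
      destruct (Ceq_dec (a + cis t) a).
      + exfalso. apply Ht. replace (cis t) with (a + cis t - a)%C by ring. rewrite e. ring.
      + replace (a + cis t - a)%C with (cis t) by ring. field. auto. }
  assert (Mean : forall g M, (forall z, Ccont g z) -> forall a : C, (forall t, Cmod (g (a + cis t)%C) <= M) ->
     Cmod (/ RtoC (2 * PI) * CInt (fun t => g (a + cis t)%C * / cis t)%C 0 (2 * PI))%C <= 2 * M).
  { intros g M Cg a HM. rewrite Cmod_mult, Cmod_inv, Cmod_R by auto. rewrite Rabs_right by lra.
    assert (Hb : Cmod (CInt (fun t => g (a + cis t)%C * / cis t)%C 0 (2 * PI)) <= 2 * (M * (2 * PI - 0))).
    { apply CInt_bound; auto; try lra. intros t _. rewrite Cmod_mult, Cmod_inv, Cmod_cis by apply cis_neq_0.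
      rewrite Rinv_1, Rmult_1_r; auto. }
    apply Rmult_le_reg_l with (2 * PI); [lra|]. rewrite <- Rmult_assoc, Rinv_r, Rmult_1_l by lra. lra. }
  exists d. split; auto. intros a.
  (* Concentric discs about [a]: [f] is bounded on radius 5, [d] bounded and [f] Lipschitz on 4, [d]
     Lipschitz on 3 and continuous on 2. Each passage through the unit circle costs 1. *)
  destruct (Ccont_bounded f Cf (Cmod a + 5)) as [M [HM0 HM]].
  assert (Hdb : forall u, Cmod (u - a) <= 4 -> Cmod (d u) <= 2 * M).
  { intros u Hu. apply Mean; auto. intros t. apply HM.
    eapply Rle_trans; [apply Cmod_triangle|]. rewrite Cmod_cis. pose proof (Cmod_le_diff u a). lra. }
  assert (Hlip : forall u v, Cmod (u - a) <= 4 -> Cmod (v - a) <= 4 -> Cmod (f u - f v) <= 4 * M * Cmod (u - v)).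
  { intros u v Hu Hv. replace u with (v + (u - v))%C at 1 by ring.
    replace (4 * M) with (2 * (2 * M)) by ring. apply mvt_segment.
    intros t Ht. exists (d (v + t * (u - v))%C). split; auto. apply Hdb.
    replace (v + t * (u - v) - a)%C with ((RtoC (1 - t)) * (v - a) + t * (u - a))%C by (rewrite RtoC_minus; ring).
    eapply Rle_trans; [apply Cmod_triangle|]. rewrite !Cmod_mult, !Cmod_R, !Rabs_right by lra.
    pose proof (Cmod_ge_0 (u - a)). pose proof (Cmod_ge_0 (v - a)). nra. }
  assert (Hdlip : forall u v, Cmod (u - a) <= 3 -> Cmod (v - a) <= 3 -> Cmod (d u - d v) <= 8 * M * Cmod (u - v)).
  { intros u v Hu Hv.
    assert (E : (d u - d v)%C = (/ RtoC (2 * PI) * CInt (fun t => (fun c : C => f (u + c) - f (v + c))%C (0 + cis t)%C * / cis t)%C 0 (2 * PI))%C).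
    { unfold d. rewrite (CInt_ext (fun t => (fun c : C => f (u + c) - f (v + c))%C (0 + cis t)%C * / cis t)%C
        (fun t => f (u + cis t) * / cis t - f (v + cis t) * / cis t)%C).
      - rewrite CInt_minus by auto. ring.
      - intros t. rewrite Cplus_0_l. ring. }
    rewrite E. replace (8 * M * Cmod (u - v)) with (2 * (4 * M * Cmod (u - v))) by ring.
    apply (Mean (fun c : C => f (u + c) - f (v + c))%C (4 * M * Cmod (u - v))).
    - intros z. apply Centire_Ccont, Centire_minus.
      + apply (Centire_comp f (fun c => u + c)%C); auto. apply Centire_plus; [apply Centire_const|apply Centire_id].
      + apply (Centire_comp f (fun c => v + c)%C); auto. apply Centire_plus; [apply Centire_const|apply Centire_id].
    - intros t. rewrite Cplus_0_l. eapply Rle_trans; [apply Hlip|].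
      + replace (u + cis t - a)%C with ((u - a) + cis t)%C by ring. eapply Rle_trans; [apply Cmod_triangle|]. rewrite Cmod_cis; lra.
      + replace (v + cis t - a)%C with ((v - a) + cis t)%C by ring. eapply Rle_trans; [apply Cmod_triangle|]. rewrite Cmod_cis; lra.
      + replace (u + cis t - (v + cis t))%C with (u - v)%C by ring. lra. }
  eexists.
  assert (Hdc : forall z, Cmod (z - a) <= 2 -> Ccont d z).
  { intros z Hz eps He. exists (Rmin 1 (eps / (8 * M + 1))). split.
    { apply Rmin_glb_lt; [lra|]. apply Rdiv_lt_0_compat; lra. }
    intros w Hw. assert (H1 := Rlt_le_trans _ _ _ Hw (Rmin_l _ _)). assert (H2 := Rlt_le_trans _ _ _ Hw (Rmin_r _ _)).
    apply Rlt_div_r in H2; [|lra]. eapply Rle_lt_trans; [apply Hdlip|].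
    - replace (w - a)%C with ((w - z) + (z - a))%C by ring. eapply Rle_trans; [apply Cmod_triangle|]. lra.
    - lra.
    - pose proof (Cmod_ge_0 (w - z)). nra. }
  unfold d. apply Cderiv_scal.
  apply (CInt_param (fun w t => f (w + cis t) * / cis t)%C (fun t => d (a + cis t)%C * / cis t)%C a 1 (16 * M)); try lra.
  - intros; auto.
  - apply path_cont_mult; [|apply path_cont_inv_cis]. apply (path_cont_comp d).
    + intros t. apply Hdc. replace (a + cis t - a)%C with (cis t) by ring. rewrite Cmod_cis; lra.
    + apply path_cont_plus; [apply path_cont_const|apply path_cont_cis].
  - intros w t Hw _.
    replace (f (w + cis t) * / cis t - f (a + cis t) * / cis t - d (a + cis t) * / cis t * (w - a))%C
     with ((f (w + cis t) - f (a + cis t) - d (a + cis t) * (w - a)) * / cis t)%C by ring.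
    rewrite Cmod_mult, Cmod_inv, Cmod_cis, Rinv_1, Rmult_1_r by apply cis_neq_0.
    set (p := (a + cis t)%C). set (h := (w - a)%C) in *. replace (w + cis t)%C with (p + h)%C by (unfold p, h; ring).
    (* The remainder is the increment of [f z - d p * z], whose derivative [d z - d p] is at most
       [8 M |h|] on the segment; the factor 2 of [mvt_segment] gives [16 M]. *)
    pose proof (mvt_segment (fun z => f z - d p * z)%C p h (8 * M * Cmod h)) as S. cbv beta in S.
    replace (f (p + h) - d p * (p + h) - (f p - d p * p))%C with (f (p + h) - f p - d p * h)%C in S by ring.
    eapply Rle_trans; [apply S|].
    + intros s Hs. exists (d (p + s * h) - d p)%C. split.
      * eapply Cderiv_eq; [apply Cderiv_minus; [apply Hd|apply Cderiv_scal, Cderiv_id]|]. ring.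
      * assert (Hpa : Cmod (p - a) <= 1). { unfold p. replace (a + cis t - a)%C with (cis t) by ring. rewrite Cmod_cis; lra. }
        assert (Hsh : Cmod (s * h) <= Cmod h). { rewrite Cmod_mult, Cmod_R, Rabs_right by lra. pose proof (Cmod_ge_0 h). nra. }
        eapply Rle_trans; [apply Hdlip|].
        -- replace (p + s * h - a)%C with ((p - a) + s * h)%C by ring. eapply Rle_trans; [apply Cmod_triangle|]. lra.
        -- lra.
        -- replace (p + s * h - p)%C with (s * h)%C by ring. apply Rmult_le_compat_l; lra.
    + right; ring.
Qed.

(** [mvt_segment] is applied twice: a bound [M] on the second derivative makes [d] Lipschitz with
    constant [2 M], which bounds the derivative of [f z - d u * z]. *)
Lemma second_order_bound f d : (forall z, Cderiv f z (d z)) -> forall R0, exists B, 0 <= B /\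
  forall u h : C, Cmod u <= R0 -> Cmod h <= 1 -> Cmod (f (u + h) - f u - d u * h)%C <= B * Cmod h ^ 2.
Proof.
  intros Hd R0.
  assert (Ed : Centire d).
  { destruct (Centire_derive f) as [d' [H1 H2]]. intros z; eexists; eauto.
    apply Centire_ext with d'; auto. intros w. apply (Cderiv_uniq f w); auto. }
  destruct (Centire_derive d Ed) as [d2 [Hd2 Ed2]].
  destruct (Ccont_bounded d2 (Centire_Ccont _ Ed2) (R0 + 1)) as [M [HM0 HM]].
  exists (4 * M). split; [lra|]. intros u h Hu Hh.
  pose proof (mvt_segment (fun z => f z - d u * z)%C u h (2 * M * Cmod h)) as S. cbv beta in S.
  replace (f (u + h) - d u * (u + h) - (f u - d u * u))%C with (f (u + h) - f u - d u * h)%C in S by ring.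
  eapply Rle_trans; [apply S|right; ring].
  intros s Hs. exists (d (u + s * h) - d u)%C. split.
  - eapply Cderiv_eq; [apply Cderiv_minus; [apply Hd|apply Cderiv_scal, Cderiv_id]|]. ring.
  - assert (Hsh : Cmod (s * h) <= Cmod h). { rewrite Cmod_mult, Cmod_R, Rabs_right by lra. pose proof (Cmod_ge_0 h). nra. }
    apply Rle_trans with (2 * M * Cmod (s * h)); [|apply Rmult_le_compat_l; lra].
    apply mvt_segment. intros s' Hs'. eexists. split; [apply Hd2|]. apply HM.
    eapply Rle_trans; [apply Cmod_triangle|]. rewrite Cmod_mult, Cmod_R, Rabs_right by lra.
    pose proof (Cmod_ge_0 (s * h)). nra.
Qed.

(** The removable singularity of the divided difference: at [a] its derivative is half the second
    derivative of [f]. *)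
Lemma Centire_divide f (a : C) : Centire f -> exists q, Centire q /\ forall z, f z = (f a + (z - a) * q z)%C.
Proof.
  intros Hf. destruct (Centire_derive f Hf) as [d [Hd Ed]]. destruct (Centire_derive d Ed) as [d2 [Hd2 Ed2]].
  set (q := fun z => if Ceq_dec z a then d a else ((f z - f a) / (z - a))%C).
  assert (F : forall z, f z = (f a + (z - a) * q z)%C).
  { intros z. unfold q. destruct (Ceq_dec z a). subst; ring. field. apply Cminus_eq_contra; auto. }
  exists q. split; auto. intros z. destruct (Ceq_dec z a) as [->|Hz].
  - exists (d2 a / 2)%C. destruct (second_order_bound d d2 Hd2 (Cmod a)) as [B [HB0 HB]].
    apply Cderiv_of_square_bound with (2 * B) 1; try lra. intros w Hw.
    destruct (Ceq_dec w a) as [->|Hwa].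
    { replace (q a - q a - d2 a / 2 * (a - a))%C with (RtoC 0) by ring.
      rewrite Cmod_0. apply Rmult_le_pos; [lra|apply pow2_ge_0]. }
    assert (H2 : RtoC 2 <> RtoC 0) by (apply RtoC_neq_0; lra).
    assert (Hn := Cminus_eq_contra _ _ Hwa).
    set (h := (w - a)%C) in *.
    (* Multiplied by [h], the remainder of [q] is the second-order Taylor remainder of [f]; that one
       is cubic in [h], by the bound on the first-order remainder of [d]. *)
    assert (E : ((q w - q a - d2 a / 2 * h) * h)%C
       = ((fun z => f z - d a * z - d2 a / 2 * ((z - a) * (z - a))) (a + h)
          - (fun z => f z - d a * z - d2 a / 2 * ((z - a) * (z - a))) a)%C).
    { cbv beta. unfold q. destruct (Ceq_dec w a); [contradiction|]. destruct (Ceq_dec a a); [|congruence].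
      replace (a + h)%C with w by (unfold h; ring). unfold h. field. auto. }
    assert (Hh := Cmod_pos _ Hn).
    apply Rmult_le_reg_r with (Cmod h); auto. rewrite <- Cmod_mult, E.
    eapply Rle_trans; [apply (mvt_segment (fun z => f z - d a * z - d2 a / 2 * ((z - a) * (z - a)))%C a h (B * Cmod h ^ 2))|right; ring].
    intros t Ht. exists (d (a + t * h) - d a - d2 a * (t * h))%C. split.
    + eapply Cderiv_eq.
      * apply Cderiv_minus; [apply Cderiv_minus; [apply Hd|apply Cderiv_scal, Cderiv_id]|].
        apply Cderiv_scal. apply Cderiv_mult; apply Cderiv_minus; try apply Cderiv_id; apply Cderiv_const.
      * cbv beta. field. auto.
    + assert (Hsh : Cmod (t * h) <= Cmod h). { rewrite Cmod_mult, Cmod_R, Rabs_right by lra. nra. }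
      eapply Rle_trans; [apply HB; lra|]. apply Rmult_le_compat_l; auto. apply pow_incr. split; auto. apply Cmod_ge_0.
  - destruct (Hf z) as [m Hm]. eexists.
    apply Cderiv_ext_loc with (fun z => (f z - f a) / (z - a))%C (Cmod (a - z)).
    + apply Cmod_pos, Cminus_eq_contra; auto.
    + intros w Hw. unfold q. destruct (Ceq_dec w a); auto. subst. lra.
    + apply Cderiv_div. apply Cderiv_minus; [apply Hm|apply Cderiv_const].
      apply Cderiv_minus; [apply Cderiv_id|apply Cderiv_const]. apply Cminus_eq_contra; auto.
Qed.

(** Integrate along the ray from 0 to [z]. The derivative under the integral is
    [f (t z) + t z d (t z)], the [t]-derivative of [t f (t z)], so it integrates to [f z]. *)
Lemma Centire_primitive f : Centire f -> exists P, forall z, Cderiv P z (f z).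
Proof.
  intros Hf. destruct (Centire_derive f Hf) as [d [Hd Ed]].
  pose proof (Centire_Ccont _ Hf) as Cf. pose proof (Centire_Ccont _ Ed) as Cd.
  exists (fun z => CInt (fun t : R => z * f (t * z))%C 0 1). intros z.
  set (k := fun t : R => (f (t * z) + (t * z) * d (t * z))%C).
  assert (Rl : forall w : C, path_cont (fun t : R => t * w)%C) by (intros; apply path_cont_mult; [apply path_cont_RtoC|apply path_cont_const]).
  assert (Rk : path_cont k).
  { apply path_cont_plus; [apply (path_cont_comp f); auto|]. apply path_cont_mult; auto. apply (path_cont_comp d); auto. }
  assert (E : CInt k 0 1 = f z).
  { destruct (Ceq_dec z 0) as [->|Hz].
    - rewrite (CInt_ext k (fun _ => f 0%C)). rewrite CInt_const, Rminus_0_r. ring.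
      intros t. unfold k. rewrite Cmult_0_r. ring.
    - assert (E : CInt (fun t => z * k t)%C 0 1 = (z * f z)%C).
      { rewrite (CInt_ext _ (fun t : R => (fun u => f u + u * d u) (0 + t * z) * z)%C).
        - rewrite (CInt_FTC (fun u => u * f u)%C (fun u => f u + u * d u)%C).
          + replace (0 + 1 * z)%C with z by ring. replace (0 + 0 * z)%C with (RtoC 0) by ring. ring.
          + intros u. eapply Cderiv_eq. apply Cderiv_mult; [apply Cderiv_id|apply Hd]. cbv beta; ring.
          + intros u. apply Ccont_plus; auto. apply Ccont_mult; auto. apply Ccont_id.
        - intros t. unfold k. rewrite Cplus_0_l. ring. }
      rewrite CInt_scal in E by auto.
      replace (CInt k 0 1) with (/ z * (z * CInt k 0 1))%C by (field; auto). rewrite E. field; auto. }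
  rewrite <- E.
  destruct (second_order_bound f d Hd (Cmod z)) as [B [HB0 HB]].
  destruct (Ccont_bounded d Cd (Cmod z)) as [M [HM0 HM]].
  apply (CInt_param (fun w t => w * f (t * w))%C k z 1 ((Cmod z + 1) * B + M)); try lra.
  - pose proof (Cmod_ge_0 z). nra.
  - intros w. apply path_cont_scal. apply (path_cont_comp f); auto.
  - auto.
  - intros w t Hw Ht. set (h := (w - z)%C) in *. replace w with (z + h)%C by (unfold h; ring). unfold k.
    replace ((z + h) * f (t * (z + h)) - z * f (t * z) - (f (t * z) + t * z * d (t * z)) * h)%C
      with ((z + h) * (f (t * z + t * h) - f (t * z) - d (t * z) * (t * h)) + t * (d (t * z) * (h * h)))%C
      by (replace (t * (z + h))%C with (t * z + t * h)%C by ring; ring).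
    assert (Htz : Cmod (t * z) <= Cmod z). { rewrite Cmod_mult, Cmod_R, Rabs_right by lra. pose proof (Cmod_ge_0 z). nra. }
    assert (Hth : Cmod (t * h) <= Cmod h). { rewrite Cmod_mult, Cmod_R, Rabs_right by lra. pose proof (Cmod_ge_0 h). nra. }
    eapply Rle_trans; [apply Cmod_triangle|]. rewrite !Cmod_mult, (Cmod_R t), (Rabs_right t) by lra.
    assert (H1 := HB (t * z)%C (t * h)%C Htz ltac:(lra)).
    assert (H2 := HM (t * z)%C Htz).
    assert (H3 : Cmod (t * h) ^ 2 <= Cmod h ^ 2) by (apply pow_incr; split; auto; apply Cmod_ge_0).
    assert (H4 : Cmod (z + h) <= Cmod z + 1) by (eapply Rle_trans; [apply Cmod_triangle|lra]).
    rewrite Rmult_plus_distr_r. apply Rplus_le_compat.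
    + rewrite Rmult_assoc. apply Rmult_le_compat; auto; try apply Cmod_ge_0.
      eapply Rle_trans; [apply H1|]. apply Rmult_le_compat_l; auto.
    + pose proof (Cmod_ge_0 h). pose proof (Cmod_ge_0 (d (t * z)%C)).
      assert (0 <= Cmod h * Cmod h) by nra.
      assert (Cmod (d (t * z)%C) * (Cmod h * Cmod h) <= M * (Cmod h * Cmod h)) by (apply Rmult_le_compat_r; auto).
      assert (0 <= Cmod (d (t * z)%C) * (Cmod h * Cmod h)) by nra.
      simpl. nra.
Qed.

(** For a primitive [P] of the logarithmic derivative, [f z * Cexp (P a - P z)] has derivative zero
    and equals 1 at [a]. *)
Lemma Centire_log f (a : C) : Centire f -> (forall z, f z <> 0%C) -> f a = 1%C ->
  exists P, Centire P /\ P a = 0%C /\ forall z, f z = Cexp (P z).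
Proof.
  intros Hf H0 Ha. destruct (Centire_derive f Hf) as [d [Hd Ed]].
  destruct (Centire_primitive (fun z => d z / f z)%C) as [P HP].
  { apply Centire_div; auto. }
  assert (HE : forall z, Cderiv (fun z => Cexp (P a - P z))%C z (Cexp (P a - P z) * (- (d z / f z)))%C).
  { intros z. eapply Cderiv_eq. apply (Cderiv_comp Cexp (fun z => P a - P z)%C).
    - apply Cderiv_minus; [apply Cderiv_const|apply HP].
    - apply Cderiv_Cexp.
    - cbv beta. ring. }
  exists (fun z => P z - P a)%C. split; [|split].
  - apply Centire_minus; [|apply Centire_const]. intros z; eexists; apply HP.
  - ring.
  - intros z.
    assert (E : (f z * Cexp (P a - P z))%C = 1%C).
    { transitivity (f a * Cexp (P a - P a))%C.
      - apply (Centire_zero_derive (fun z => f z * Cexp (P a - P z))%C). intros w. eapply Cderiv_eq.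
        apply Cderiv_mult; [apply Hd|apply HE]. cbv beta; field; auto.
      - rewrite Ha. replace (P a - P a)%C with (RtoC 0) by ring. rewrite Cexp_0. ring. }
    replace (P z - P a)%C with (- (P a - P z))%C by ring. rewrite Cexp_opp.
    replace (f z) with (f z * Cexp (P a - P z) * / Cexp (P a - P z))%C by (field; apply Cexp_neq_0).
    rewrite E. ring.
Qed.

(** * Zeros and growth *)

(** The mean value property as a weak maximum principle. *)
Lemma circle_bound f (a : C) r B : Centire f -> 0 < r -> (forall z, Cmod (z - a) = r -> Cmod (f z) <= B) ->
  Cmod (f a) <= 2 * B.
Proof.
  intros Hf Hr HB. pose proof PI_RGT_0 as Hpi. pose proof (Centire_Ccont _ Hf) as Cf.
  pose proof (mean_value f a (Cf a) (fun z _ => Hf z) (ln r)) as MV.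
  assert (H : Cmod (CInt (fun t : R => f (a + Cexp (ln r + t * Ci))%C) 0 (2 * PI)) <= 2 * (B * (2 * PI - 0))).
  { apply CInt_bound; try lra.
    - apply (path_cont_comp f); auto. apply path_cont_plus; [apply path_cont_const|].
      apply (path_cont_comp Cexp). intros; apply Centire_Ccont, Centire_Cexp. apply path_cont_line.
    - intros t _. apply HB. replace (a + Cexp (ln r + t * Ci) - a)%C with (Cexp (ln r + t * Ci)) by ring.
      rewrite Cmod_Cexp. replace (Re (ln r + t * Ci)) with (ln r) by (unfold Re, Ci; simpl; ring).
      apply exp_ln; auto. }
  rewrite MV, Cmod_mult, Cmod_R, Rabs_right in H by lra.
  apply Rmult_le_reg_l with (2 * PI); lra.
Qed.

(** No power series: the cofactor [q] is bounded at [z0] through the circle of radius [3 d + 1]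
    about [z0], on which [|z - a| >= 2 d + 1]. With [|z0 - a| = d] this gives
    [|f z0| <= 2 M (d / (2 d + 1))^m], which is at most [2 M / 2^m]. *)
Lemma Centire_flat f (a : C) : Centire f ->
  (forall m, exists q, Centire q /\ forall z, f z = ((z - a) ^ m * q z)%C) -> forall z, f z = 0%C.
Proof.
  intros Hf H z0. destruct (Ceq_dec z0 a) as [->|Hz].
  { destruct (H 1%nat) as [q [_ E]]. rewrite E. simpl. ring. }
  pose proof (Cmod_pos _ (Cminus_eq_contra _ _ Hz)) as Hd. set (d := Cmod (z0 - a)) in *.
  destruct (Ccont_bounded f (Centire_Ccont _ Hf) (Cmod z0 + (3 * d + 1))) as [M [HM0 HM]].
  assert (Hm : forall m, Cmod (f z0) <= 2 * M * (/2) ^ m).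
  { intros m. destruct (H m) as [q [Hq E]].
    assert (Hp : 0 < (2 * d + 1) ^ m) by (apply pow_lt; lra).
    assert (Hb : Cmod (q z0) <= 2 * (M / (2 * d + 1) ^ m)).
    { apply circle_bound with (3 * d + 1); auto; try lra. intros z Hr.
      apply Rle_div_r; auto.
      assert (Hfz : Cmod (f z) <= M).
      { apply HM. pose proof (Cmod_le_diff z z0). lra. }
      rewrite E, Cmod_mult, Cmod_pow in Hfz.
      assert (H2 : 2 * d + 1 <= Cmod (z - a)).
      { pose proof (Cmod_triangle_minus (z - a) (z0 - a)) as T.
        replace (z - a - (z0 - a))%C with (z - z0)%C in T by ring. fold d in T. lra. }
      pose proof (pow_incr _ _ m (conj (ltac:(lra) : 0 <= 2 * d + 1) H2)).
      pose proof (Cmod_ge_0 (q z)). nra. }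
    rewrite E, Cmod_mult, Cmod_pow. fold d.
    apply Rle_trans with (d ^ m * (2 * (M / (2 * d + 1) ^ m))).
    - apply Rmult_le_compat_l; auto. apply pow_le; lra.
    - replace (d ^ m * (2 * (M / (2 * d + 1) ^ m))) with (2 * M * (d / (2 * d + 1)) ^ m).
      + apply Rmult_le_compat_l; [lra|]. apply pow_incr. split.
        * apply Rle_mult_inv_pos; lra.
        * apply Rle_div_l; lra.
      + unfold Rdiv. rewrite Rpow_mult_distr, pow_inv. field. lra. }
  apply Cmod_eq_0, Rle_antisym; [|apply Cmod_ge_0]. apply le_epsilon. intros eps He. rewrite Rplus_0_l.
  destruct (pow_lt_1_zero (/2) ltac:(rewrite Rabs_right; lra) (eps / (2 * M + 1))) as [n Hn].
  { apply Rdiv_lt_0_compat; lra. }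
  specialize (Hn n (le_n _)). assert (Hp : 0 < (/2)^n) by (apply pow_lt; lra).
  rewrite Rabs_right in Hn by lra. apply Rlt_div_r in Hn; [|lra].
  eapply Rle_trans; [apply (Hm n)|]. nra.
Qed.

(** Dividing by [z - a] must stop, as otherwise [Centire_flat] applies; the last cofactor is nonzero
    near [a]. *)
Lemma Centire_isolated_zeros f (a : C) : Centire f -> (exists z, f z <> 0%C) ->
  exists eps, 0 < eps /\ forall w, 0 < Cmod (w - a) < eps -> f w <> 0%C.
Proof.
  intros Hf [z0 Hz0].
  assert (H : exists m q, Centire q /\ (forall z, f z = ((z - a) ^ m * q z)%C) /\ q a <> 0%C).
  { apply NNPP. intros Hn. apply Hz0. apply (Centire_flat f a Hf). intros m. induction m.
    - exists f. split; auto. intros; simpl; ring.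
    - destruct IHm as [q [Hq E]].
      assert (Hqa : q a = 0%C). { apply NNPP. intros K. apply Hn. exists m, q. auto. }
      destruct (Centire_divide q a Hq) as [q' [Hq' E']]. exists q'. split; auto.
      intros z. rewrite E, E', Hqa. simpl. ring. }
  destruct H as [m [q [Hq [E Hqa]]]].
  destruct (Centire_Ccont _ Hq a (Cmod (q a)) (Cmod_pos _ Hqa)) as [d [Hd Hd']].
  exists d. split; auto. intros w [Hw1 Hw2]. rewrite E. apply Cmult_neq_0.
  - apply Cpow_nz. apply Cmod_pos_neq; auto.
  - intros K. specialize (Hd' w Hw2). rewrite K in Hd'.
    replace (0 - q a)%C with (- q a)%C in Hd' by ring. rewrite Cmod_opp in Hd'. lra.
Qed.

Lemma exp_le_mono x y : x <= y -> exp x <= exp y.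
Proof. intros [H| ->]; [left; apply exp_increasing; auto|right; auto]. Qed.

Lemma re_scale (z : C) (x : R) : Re (z * x)%C = Re z * x.
Proof. unfold Re; simpl; ring. Qed.

(* The real part of the test exponent [Q] below equals [Re P * (1 + Re w) / 2] on
   the circle [|z| = r], hence lies below the positive part of [Re P], so that
   [|V exp Q| <= max (|U|, |V|)] there, while [Q 0 = r^n |q 0| / 4]. *)
Lemma growth_leading_coef U V q n m C0 R0 : Centire V -> Centire q -> V 0%C <> 0%C -> (m < n)%nat -> 0 <= C0 ->
  (forall z, R0 <= Cmod z -> Cmod (U z) <= exp (C0 * Cmod z ^ m) /\ Cmod (V z) <= exp (C0 * Cmod z ^ m)) ->
  (forall z, U z = Cexp (z ^ n * q z) * V z)%C -> q 0%C = 0%C.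
Proof.
  intros HV Hq HV0 Hmn HC0 Hg HU.
  apply NNPP. intros Hc. pose proof (Cmod_pos _ Hc) as Hc'. pose proof (Cmod_pos _ HV0) as HV0'.
  set (c := q 0%C) in *.
  assert (HcC : RtoC (Cmod c) <> RtoC 0) by (apply RtoC_neq_0; lra).
  (* The phase of [c]; multiplying by its conjugate makes the value of the test exponent at 0 real
     and positive. *)
  set (mu := (c / Cmod c)%C).
  assert (Hmu : Cmod mu = 1).
  { unfold mu. rewrite Cmod_div by auto. rewrite Cmod_R, Rabs_right by lra. field; lra. }
  assert (Hmuc : (Cconj mu * c)%C = RtoC (Cmod c)).
  { unfold mu. rewrite Cdiv_conj by auto.
    replace (Cconj (Cmod c)) with (RtoC (Cmod c)) by (unfold Cconj, RtoC; simpl; f_equal; ring).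
    replace (Cconj c / Cmod c * c)%C with ((c * Cconj c) / Cmod c)%C by (field; auto).
    rewrite <- Cmod2_conj. simpl. rewrite Rmult_1_r, RtoC_mult. field; auto. }
  (* Chosen so that [2 < |V 0| exp K]: this excess beats the factor 2 of [circle_bound]. *)
  set (K := Rabs (ln (2 / Cmod (V 0%C))) + 1).
  assert (HK : 0 < K) by (unfold K; pose proof (Rabs_pos (ln (2 / Cmod (V 0%C)))); lra).
  (* Large enough for the growth bounds, and for [C0 r^m + K <= |c| r^n / 4], which uses [m < n]. *)
  set (r := Rmax (Rmax R0 1) (4 * (C0 + K) / Cmod c)).
  assert (Hr1 : 1 <= r) by (eapply Rle_trans; [apply Rmax_r|apply Rmax_l]).
  assert (HrR : R0 <= r) by (eapply Rle_trans; [apply Rmax_l|apply Rmax_l]).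
  assert (HrC : C0 + K <= / 4 * Cmod c * r).
  { apply Rle_trans with (/4 * Cmod c * (4 * (C0 + K) / Cmod c)). right; field; lra.
    apply Rmult_le_compat_l; [lra|apply Rmax_r]. }
  assert (HrC0 : RtoC r <> RtoC 0) by (apply RtoC_neq_0; lra).
  set (w := fun z : C => (mu * (z * / r) ^ n)%C).
  set (Q := fun z : C => (RtoC (/2) * (z ^ n * q z) + RtoC (/4) * ((z ^ n * q z) * w z + Cconj mu * r ^ n * q z))%C).
  assert (EP : Centire (fun z => z ^ n * q z)%C) by (apply Centire_mult; auto; apply Centire_pow).
  assert (EQ : Centire Q).
  { apply Centire_plus; (apply Centire_mult; [apply Centire_const|]); auto.
    apply Centire_plus.
    - apply Centire_mult; auto. apply Centire_mult; [apply Centire_const|].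
      apply (Centire_comp (fun z => z ^ n)%C (fun z => z * / r)%C). apply Centire_pow. apply Centire_mult; [apply Centire_id|apply Centire_const].
    - apply Centire_mult; auto. apply Centire_const. }
  assert (EF : Centire (fun z => V z * Cexp (Q z))%C).
  { apply Centire_mult; auto. apply Centire_comp; auto. apply Centire_Cexp. }
  assert (HB : Cmod (V 0 * Cexp (Q 0))%C <= 2 * exp (C0 * r ^ m)).
  { apply (circle_bound (fun z => V z * Cexp (Q z))%C 0 r); auto; [lra|]. intros z Hz.
    replace (z - 0)%C with z in Hz by ring.
    assert (Hw : Cmod (w z) = 1).
    { unfold w. rewrite Cmod_mult, Cmod_pow, Cmod_mult, Cmod_inv, Cmod_R, Rabs_right, Hz, Hmu, Rinv_r, pow1 by (auto; lra). ring. }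
    (* On the circle [Cconj z = r^2 / z], so multiplication by the conjugate of [w] agrees there
       with an entire expression; this is how [Re w] enters a holomorphic exponent. *)
    assert (Hwc : (z ^ n * Cconj (w z))%C = (Cconj mu * r ^ n)%C).
    { unfold w. rewrite Cmult_conj, Cpow_conj, Cmult_conj, Cinv_conj by auto.
      replace (Cconj r) with (RtoC r) by (unfold Cconj, RtoC; simpl; f_equal; ring).
      replace (z ^ n * (Cconj mu * (Cconj z * / r) ^ n))%C with (Cconj mu * (z ^ n * (Cconj z * / r) ^ n))%C by ring.
      f_equal. rewrite <- Cpow_mult_l. f_equal.
      replace (z * (Cconj z * / r))%C with ((z * Cconj z) * / r)%C by ring.
      rewrite <- Cmod2_conj, Hz. simpl. rewrite Rmult_1_r, RtoC_mult. field; auto. }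
    assert (HQ : Q z = ((z ^ n * q z) * RtoC ((1 + Re (w z)) / 2))%C).
    { unfold Q. replace (Cconj mu * r ^ n * q z)%C with (q z * (Cconj mu * r ^ n))%C by ring. rewrite <- Hwc.
      replace (RtoC (/ 2) * (z ^ n * q z) + RtoC (/ 4) * (z ^ n * q z * w z + q z * (z ^ n * Cconj (w z))))%C
        with ((z ^ n * q z) * (RtoC (/2) + RtoC (/ 4) * (w z + Cconj (w z))))%C by ring.
      f_equal. destruct (w z) as [u v]. unfold Cconj, Cplus, Cmult, RtoC, Re; simpl. f_equal; field. }
    assert (Hre : Rabs (Re (w z)) <= 1) by (rewrite <- Hw; apply re_le_Cmod).
    apply Rabs_le_between in Hre.
    rewrite Cmod_mult, Cmod_Cexp, HQ, re_scale.
    destruct (Hg z) as [HgU HgV]. { lra. } rewrite Hz in HgU, HgV.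
    rewrite HU, Cmod_mult, Cmod_Cexp in HgU.
    set (u := Re (z ^ n * q z)) in *. pose proof (Cmod_ge_0 (V z)).
    assert (Hs : 0 <= (1 + Re (w z)) / 2 <= 1) by lra.
    set (s := (1 + Re (w z)) / 2) in *.
    destruct (Rle_lt_dec u 0).
    - eapply Rle_trans; [|apply HgV]. rewrite <- (Rmult_1_r (Cmod (V z))) at 2.
      apply Rmult_le_compat_l; auto. rewrite <- exp_0. apply exp_le_mono. clear - Hs r0. nra.
    - eapply Rle_trans; [|apply HgU]. rewrite Rmult_comm. apply Rmult_le_compat_r; auto.
      apply exp_le_mono. clear - Hs r0. nra. }
  (* All summands with the factor [z ^ n] vanish at 0, since [n > 0]; only the conjugate term
     remains. *)
  assert (HQ0 : Q 0%C = RtoC (/4 * Cmod c * r ^ n)).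
  { unfold Q. fold c. replace (0 ^ n)%C with (RtoC 0).
    - replace (Cconj mu * r ^ n * c)%C with ((Cconj mu * c) * r ^ n)%C by ring. rewrite Hmuc.
      rewrite !RtoC_mult, RtoC_pow. ring.
    - destruct n; [lia|]. simpl. ring. }
  rewrite Cmod_mult, Cmod_Cexp, HQ0, re_RtoC in HB.
  assert (Hrm : 1 <= r ^ m) by (apply pow_R1_Rle; auto).
  assert (Hrn : r ^ m * r <= r ^ n).
  { replace (r ^ m * r) with (r ^ (S m)) by (simpl; ring). apply Rle_pow; auto. }
  assert (Hge : C0 * r ^ m + K <= / 4 * Cmod c * r ^ n).
  { apply Rle_trans with (/4 * Cmod c * (r ^ m * r)).
    - replace (/ 4 * Cmod c * (r ^ m * r)) with ((/ 4 * Cmod c * r) * r ^ m) by ring.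
      apply Rle_trans with ((C0 + K) * r ^ m); [|apply Rmult_le_compat_r; lra]. nra.
    - apply Rmult_le_compat_l; lra. }
  assert (HKexp : 2 < Cmod (V 0%C) * exp K).
  { apply Rlt_le_trans with (Cmod (V 0%C) * exp (ln (2 / Cmod (V 0%C)) + 1)).
    - rewrite exp_plus, exp_ln by (apply Rdiv_lt_0_compat; lra).
      pose proof (exp_ineq1 1 ltac:(lra)).
      replace (Cmod (V 0%C) * (2 / Cmod (V 0%C) * exp 1)) with (2 * exp 1) by (field; lra). lra.
    - apply Rmult_le_compat_l; [lra|]. apply exp_le_mono. unfold K. pose proof (Rle_abs (ln (2 / Cmod (V 0%C)))). lra. }
  assert (Hexp : exp (C0 * r ^ m) * exp K <= exp (/ 4 * Cmod c * r ^ n)).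
  { rewrite <- exp_plus. apply exp_le_mono; auto. }
  pose proof (exp_pos (C0 * r ^ m)).
  assert (Cmod (V 0%C) * (exp (C0 * r ^ m) * exp K) <= 2 * exp (C0 * r ^ m)).
  { eapply Rle_trans; [|apply HB]. apply Rmult_le_compat_l; lra. }
  nra.
Qed.

(** * Polynomial functions *)

(** Polynomials are functions given up to pointwise equality; [d] bounds the degree, since the top
    coefficient may be zero, and [K] records where the coefficients lie. *)
Fixpoint polyfun (K : C -> Prop) (d : nat) (f : C -> C) : Prop :=
  match d with
  | O => exists c, K c /\ forall z, f z = c
  | S d' => exists c g, K c /\ polyfun K d' g /\ forall z, f z = (g z + c * z ^ d)%C
  end.

(** All rationals are included because summing powers divides by integers; inverses of other
    elements are assumed separately where needed. *)
Record subring (K : C -> Prop) : Prop := {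
  sr_rat : forall q : Q, K (RtoC (Q2R q));
  sr_add : forall x y, K x -> K y -> K (x + y)%C;
  sr_mul : forall x y, K x -> K y -> K (x * y)%C;
  sr_opp : forall x, K x -> K (- x)%C }.

Lemma sr_int K : subring K -> forall n : Z, K (RtoC (IZR n)).
Proof.
  intros HK n. replace (IZR n) with (Q2R (inject_Z n)). apply HK.
  unfold Q2R, inject_Z; simpl. field.
Qed.

Section Pol.
Context (K : C -> Prop) (HK : subring K).

Lemma polyfun_ext d f g : (forall z, f z = g z) -> polyfun K d f -> polyfun K d g.
Proof.
  destruct d; simpl; intros E.
  - intros [c [Hc H]]. exists c; split; auto. intros; rewrite <- E; auto.
  - intros [c [h [Hc [Hh H]]]]. exists c, h. repeat split; auto. intros; rewrite <- E; auto.
Qed.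

Lemma polyfun_weaken1 d f : polyfun K d f -> polyfun K (S d) f.
Proof.
  intros H. exists 0%C, f. repeat split; auto. apply (sr_int K HK 0). intros; ring.
Qed.

Lemma polyfun_weaken d e f : (d <= e)%nat -> polyfun K d f -> polyfun K e f.
Proof. induction 1; auto. intros; apply polyfun_weaken1; auto. Qed.

Lemma polyfun_const d c : K c -> polyfun K d (fun _ => c).
Proof. intros Hc. apply (polyfun_weaken 0); [lia|]. exists c; auto. Qed.

Lemma polyfun_add d f g : polyfun K d f -> polyfun K d g -> polyfun K d (fun z => f z + g z)%C.
Proof.
  revert f g. induction d; simpl; intros f g.
  - intros [c [Hc H]] [c' [Hc' H']]. exists (c + c')%C. split. apply HK; auto. intros; rewrite H, H'; auto.
  - intros [c [h [Hc [Hh H]]]] [c' [h' [Hc' [Hh' H']]]].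
    exists (c + c')%C, (fun z => h z + h' z)%C. split; [apply HK; auto|]. split; auto.
    intros; rewrite H, H'. ring.
Qed.

Lemma polyfun_scal d c f : K c -> polyfun K d f -> polyfun K d (fun z => c * f z)%C.
Proof.
  intros Hc. revert f. induction d; simpl; intros f.
  - intros [c' [Hc' H']]. exists (c * c')%C. split. apply HK; auto. intros; rewrite H'; auto.
  - intros [c' [h' [Hc' [Hh' H']]]].
    exists (c * c')%C, (fun z => c * h' z)%C. split; [apply HK; auto|]. split; auto.
    intros; rewrite H'. ring.
Qed.

Lemma polyfun_minus d f g : polyfun K d f -> polyfun K d g -> polyfun K d (fun z => f z - g z)%C.
Proof.
  intros Hf Hg. apply polyfun_ext with (fun z => f z + (RtoC (IZR (-1))) * g z)%C.
  { intros z. change (IZR (-1)) with (-(1)). rewrite RtoC_opp. ring. }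
  apply polyfun_add; auto. apply polyfun_scal; auto. apply (sr_int K HK).
Qed.

Lemma polyfun_mulz d f : polyfun K d f -> polyfun K (S d) (fun z => z * f z)%C.
Proof.
  revert f. induction d; intros f.
  - intros [c [Hc H]]. exists c, (fun _ => 0%C). split; auto. split.
    + apply polyfun_const. apply (sr_int K HK 0).
    + intros; rewrite H. simpl. ring.
  - intros [c [h [Hc [Hh H]]]]. exists c, (fun z => z * h z)%C. split; auto. split; auto.
    intros z. rewrite H. simpl. ring.
Qed.

Lemma polyfun_pow n : polyfun K n (fun z => z ^ n)%C.
Proof.
  induction n.
  - exists (RtoC 1). split; auto. apply (sr_int K HK 1).
  - apply (polyfun_mulz _ _ IHn).
Qed.

Lemma polyfun_shift d f a : K a -> polyfun K d f -> polyfun K d (fun z => f (z + a)%C).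
Proof.
  intros Ha.
  assert (Hp : forall n, polyfun K n (fun z => (z + a) ^ n)%C).
  { induction n. exists (RtoC 1). split; auto. apply (sr_int K HK 1).
    eapply polyfun_ext; [|apply polyfun_add; [apply (polyfun_mulz _ _ IHn)|apply polyfun_weaken1, (polyfun_scal _ a _ Ha IHn)]].
    intros; simpl; ring. }
  revert f. induction d; intros f.
  - intros [c [Hc H]]. exists c; split; auto.
  - intros [c [h [Hc [Hh H]]]].
    eapply polyfun_ext; [|apply polyfun_add; [apply polyfun_weaken1, (IHd _ Hh)|apply (polyfun_scal _ c _ Hc (Hp (S d)))]].
    intros z. rewrite (H (z + a)%C). reflexivity.
Qed.

Lemma polyfun_divide d f a : K a -> polyfun K (S d) f ->
  exists g, polyfun K d g /\ forall z, f z = (f a + (z - a) * g z)%C.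
Proof.
  intros Ha. revert f. induction d; intros f [c [h [Hc [Hh H]]]].
  - destruct Hh as [c' [Hc' E]]. exists (fun _ => c). split. exists c; auto.
    intros z. rewrite !H, !E. simpl. ring.
  - destruct (IHd _ Hh) as [g [Hg E]].
    assert (Hp : forall n, exists s, polyfun K n s /\ forall z, (z ^ (S n) = a ^ (S n) + (z - a) * s z)%C).
    { induction n.
      - exists (fun _ => RtoC 1). split. apply polyfun_const, (sr_int K HK 1). intros; simpl; ring.
      - destruct IHn as [s [Hs Es]]. exists (fun z => z ^ (S n) + a * s z)%C. split.
        + apply polyfun_add.
          * apply polyfun_pow.
          * apply polyfun_weaken1, polyfun_scal; auto.
        + intros z. replace (z ^ S (S n))%C with (z * z ^ (S n))%C by reflexivity.
          replace (a ^ S (S n))%C with (a * a ^ (S n))%C by reflexivity.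
          transitivity ((z - a) * z ^ (S n) + a * z ^ (S n))%C; [ring|]. rewrite (Es z) at 2. ring. }
    destruct (Hp (S d)) as [s [Hs Es]].
    exists (fun z => g z + c * s z)%C. split.
    + apply polyfun_add. apply polyfun_weaken1; auto. apply polyfun_scal; auto.
    + intros z. rewrite (H z), (H a), (E z), (Es z). ring.
Qed.
End Pol.

Definition AllC (_ : C) : Prop := True.

Lemma subring_AllC : subring AllC.
Proof. split; intros; exact I. Qed.

Lemma polyfun_AllC K d f : polyfun K d f -> polyfun AllC d f.
Proof.
  revert f. induction d; simpl; intros f.
  - intros [c [_ H]]. exists c; split; auto. exact I.
  - intros [c [g [_ [Hg H]]]]. exists c, g. split; [exact I|auto].
Qed.

Lemma polyfun_value K d f x : subring K -> polyfun K d f -> K x -> K (f x).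
Proof.
  intros HK Hf Hx. assert (Hp : forall n, K (x ^ n)%C).
  { induction n; simpl. apply (sr_int K HK 1). apply HK; auto. }
  revert f Hf. induction d; intros f.
  - intros [c [Hc H]]. rewrite H; auto.
  - intros [c [g [Hc [Hg H]]]]. rewrite H. apply HK; auto. apply HK; auto.
Qed.

Lemma polyfun_bound d f : polyfun AllC d f -> exists B, 0 <= B /\
  forall z, 1 <= Cmod z -> Cmod (f z) <= B * Cmod z ^ d.
Proof.
  revert f. induction d; intros f.
  - intros [c [_ H]]. exists (Cmod c). split; [apply Cmod_ge_0|]. intros. rewrite H. simpl; lra.
  - intros [c [g [_ [Hg H]]]]. destruct (IHd _ Hg) as [B [HB0 HB]].
    exists (B + Cmod c). pose proof (Cmod_ge_0 c). split; [lra|]. intros z Hz. rewrite H.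
    eapply Rle_trans; [apply Cmod_triangle|]. rewrite Cmod_mult, Cmod_pow.
    specialize (HB z Hz).
    assert (Cmod z ^ d <= Cmod z ^ S d) by (apply Rle_pow; [auto|lia]). nra.
Qed.

(** Induction on the degree: after the zero [a] is split off, the rest of the progression consists
    of zeros of the quotient. *)
Lemma polyfun_zeros d f (a om : C) : om <> 0%C -> polyfun AllC d f ->
  (forall k : nat, f (a + INR k * om)%C = 0%C) -> forall z, f z = 0%C.
Proof.
  intros Hom. revert f a. induction d; intros f a Hf H.
  - destruct Hf as [c [_ E]]. intros z. rewrite E, <- (E (a + INR 0 * om)%C). auto.
  - destruct (polyfun_divide AllC subring_AllC d f a I Hf) as [g [Hg E]].
    assert (Ha : f a = 0%C). { rewrite <- (H O). f_equal. simpl. ring. }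
    assert (Hg0 : forall z, g z = 0%C).
    { apply (IHd g (a + om)%C Hg). intros k. specialize (H (S k)).
      rewrite E, Ha, Cplus_0_l, S_INR, RtoC_plus in H.
      replace (a + om + INR k * om)%C with (a + (INR k + 1) * om)%C by ring.
      replace (a + (INR k + 1) * om - a)%C with ((INR k + 1) * om)%C in H by ring.
      apply NNPP. intros K. revert H. apply Cmult_neq_0; auto. apply Cmult_neq_0; auto.
      rewrite <- RtoC_plus. apply RtoC_neq_0. pose proof (pos_INR k). lra. }
    intros z. rewrite E, Ha, Hg0. ring.
Qed.

(** [f - f t] vanishes along the progression [t + k om]. *)
Lemma polyfun_periodic d f (om : C) : om <> 0%C -> polyfun AllC d f ->
  (forall s, f (s + om)%C = f s) -> forall s t, f s = f t.
Proof.
  intros Hom Hf Hp s t. apply Ceq_minus.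
  apply (polyfun_zeros d (fun z => f z - f t)%C t om Hom).
  - apply (polyfun_minus AllC subring_AllC); auto. apply (polyfun_const AllC subring_AllC); exact I.
  - intros k. assert (E : f (t + INR k * om)%C = f t).
    { induction k. f_equal; simpl; ring. rewrite <- IHk, <- (Hp (t + INR k * om)%C). f_equal.
      rewrite S_INR, RtoC_plus. ring. }
    rewrite E. ring.
Qed.

(** * Exponents of nonvanishing quotients of finite order *)

(** Finite order with a natural exponent, to be compared with polynomial degrees; the constant [C0]
    makes the class closed under products. *)
Definition tempered (h : C -> C) : Prop := exists (m : nat) C0 R0, 0 <= C0 /\ 1 <= R0 /\
  forall z, R0 <= Cmod z -> Cmod (h z) <= exp (C0 * Cmod z ^ m).

Lemma tempered_of_finite_order h : finite_order_growth h -> tempered h.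
Proof.
  intros [rho [Rr [HRr H]]].
  destruct (INR_archimed 1 (Rabs rho)) as [m Hm]; [lra|].
  exists m, 1, (Rmax 1 Rr). split; [lra|]. split; [apply Rmax_l|]. intros z Hz.
  assert (1 <= Cmod z) by (eapply Rle_trans; [apply Rmax_l|apply Hz]).
  eapply Rle_trans; [apply H; eapply Rle_trans; [apply Rmax_r|apply Hz]|].
  apply exp_le_mono. rewrite Rmult_1_l, <- Rpower_pow by lra.
  apply Rle_Rpower; auto. pose proof (Rle_abs rho). lra.
Qed.

Lemma tempered_common g h : tempered g -> tempered h -> exists (m : nat) C0 R0, 0 <= C0 /\ 1 <= R0 /\
  forall z, R0 <= Cmod z -> Cmod (g z) <= exp (C0 * Cmod z ^ m) /\ Cmod (h z) <= exp (C0 * Cmod z ^ m).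
Proof.
  intros [m [A [R1 [HA [HR1 Hg]]]]] [n [B [R2 [HB [HR2 Hh]]]]].
  exists (m + n)%nat, (A + B), (Rmax R1 R2).
  split; [lra|]. split; [eapply Rle_trans; [apply HR1|apply Rmax_l]|]. intros z Hz.
  assert (H1 : R1 <= Cmod z) by (eapply Rle_trans; [apply Rmax_l|apply Hz]).
  assert (H2 : R2 <= Cmod z) by (eapply Rle_trans; [apply Rmax_r|apply Hz]).
  assert (Cmod z ^ m <= Cmod z ^ (m + n)) by (apply Rle_pow; [lra|lia]).
  assert (Cmod z ^ n <= Cmod z ^ (m + n)) by (apply Rle_pow; [lra|lia]).
  assert (0 <= Cmod z ^ m) by (apply pow_le; lra). assert (0 <= Cmod z ^ n) by (apply pow_le; lra).
  split.
  - eapply Rle_trans; [apply Hg; auto|]. apply exp_le_mono. nra.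
  - eapply Rle_trans; [apply Hh; auto|]. apply exp_le_mono. nra.
Qed.

Lemma tempered_mult g h : tempered g -> tempered h -> tempered (fun z => g z * h z)%C.
Proof.
  intros Hg Hh. destruct (tempered_common g h Hg Hh) as [m [A [R0 [HA [HR H]]]]].
  exists m, (A + A), R0. split; [lra|]. split; auto. intros z Hz. destruct (H z Hz).
  rewrite Cmod_mult, Rmult_plus_distr_r, exp_plus.
  apply Rmult_le_compat; auto; apply Cmod_ge_0.
Qed.

(** [growth_leading_coef] removes one Taylor coefficient of [q] after another, so [q] is divisible
    by every power of [z]. *)
Lemma growth_zero_exponent U V q m C0 R0 : Centire V -> Centire q -> V 0%C <> 0%C -> 0 <= C0 ->
  (forall z, R0 <= Cmod z -> Cmod (U z) <= exp (C0 * Cmod z ^ m) /\ Cmod (V z) <= exp (C0 * Cmod z ^ m)) ->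
  (forall z, U z = Cexp (z ^ (S m) * q z) * V z)%C -> forall z, q z = 0%C.
Proof.
  intros HV Hq HV0 HC0 Hg HU. apply (Centire_flat q 0%C Hq). intros k. induction k.
  - exists q. split; auto. intros; simpl; ring.
  - destruct IHk as [q' [Hq' E]].
    assert (H0 : q' 0%C = 0%C).
    { apply (growth_leading_coef U V q' (S m + k) m C0 R0); auto; [lia|].
      intros z. rewrite HU, E, Cpow_add_r. replace (z - 0)%C with z by ring. f_equal. f_equal. ring. }
    destruct (Centire_divide q' 0%C Hq') as [p [Hp Ep]]. exists p. split; auto.
    intros z. rewrite E, Ep, H0. simpl. ring.
Qed.

Lemma taylor P m : Centire P -> exists p q, polyfun AllC m p /\ Centire q /\ forall z, P z = (p z + z ^ (S m) * q z)%C.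
Proof.
  intros HP. induction m.
  - destruct (Centire_divide P 0%C HP) as [q [Hq E]]. exists (fun _ => P 0%C), q. split.
    + exists (P 0%C). split; [exact I|auto].
    + split; auto. intros z. rewrite E. simpl. ring.
  - destruct IHm as [p [q [Hp [Hq E]]]]. destruct (Centire_divide q 0%C Hq) as [q' [Hq' E']].
    exists (fun z => p z + q 0 * z ^ (S m))%C, q'. split; [|split; auto].
    + exists (q 0%C), p. split; [exact I|]. auto.
    + intros z. rewrite E, E'. simpl. ring.
Qed.

Lemma polyfun_Centire d f : polyfun AllC d f -> Centire f.
Proof.
  revert f. induction d; intros f.
  - intros [c [_ H]]. apply Centire_ext with (fun _ => c). intros; rewrite H; auto. apply Centire_const.
  - intros [c [g [_ [Hg H]]]]. apply Centire_ext with (fun z => g z + c * z ^ S d)%C. intros; rewrite H; auto.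
    apply Centire_plus; auto. apply Centire_mult; [apply Centire_const|apply Centire_pow].
Qed.

(** A Hadamard-type statement. After a shift to a point where [V] is nonzero, the Taylor part of [P]
    of degree at most [m] moves into [U] without changing its growth exponent [m]; the remaining
    exponent must vanish. *)
Lemma log_polynomial U V P : Centire V -> Centire P -> tempered U -> tempered V -> (exists a, V a <> 0%C) ->
  (forall z, U z = Cexp (P z) * V z)%C -> exists d, polyfun AllC d P.
Proof.
  intros HV HP TU TV [a Ha] HU.
  destruct (tempered_common U V TU TV) as [m [A [R0 [HA [HR H]]]]].
  destruct (taylor (fun z => P (z + a)%C) m) as [p [q [Hp [Hq E]]]]. { apply Centire_shift; auto. }
  destruct (polyfun_bound m p Hp) as [B [HB0 HB]].
  assert (Hq0 : forall z, q z = 0%C).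
  (* For [|z| >= |a|] one has [|z + a| <= 2 |z|], whence [2 ^ m]; [B] bounds the transferred
     polynomial [p]. *)
  { apply (growth_zero_exponent (fun z => U (z + a) * Cexp (- p z))%C (fun z => V (z + a)%C) q m (A * 2 ^ m + B) (R0 + Cmod a)); auto.
    - apply Centire_shift; auto.
    - rewrite Cplus_0_l; auto.
    - assert (0 < 2 ^ m) by (apply pow_lt; lra). nra.
    - intros z Hz. pose proof (Cmod_ge_0 a).
      assert (H1 : R0 <= Cmod (z + a)).
      { pose proof (Cmod_triangle_minus (z + a) a). replace (z + a - a)%C with z in H1 by ring. lra. }
      assert (H2 : Cmod (z + a) <= 2 * Cmod z) by (eapply Rle_trans; [apply Cmod_triangle|]; lra).
      destruct (H _ H1) as [HU' HV'].
      assert (H3 : A * Cmod (z + a) ^ m <= A * 2 ^ m * Cmod z ^ m).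
      { rewrite Rmult_assoc, <- Rpow_mult_distr. apply Rmult_le_compat_l; auto. apply pow_incr. split; auto. apply Cmod_ge_0. }
      assert (H4 : 0 <= Cmod z ^ m) by (apply pow_le; lra).
      assert (Hpz := HB z ltac:(lra)).
      rewrite Rmult_plus_distr_r, exp_plus. split.
      + rewrite Cmod_mult, Cmod_Cexp. apply Rmult_le_compat; try apply Cmod_ge_0. left; apply exp_pos.
        * eapply Rle_trans; [apply HU'|]. apply exp_le_mono; auto.
        * apply exp_le_mono. eapply Rle_trans; [|apply Hpz]. rewrite re_opp.
          pose proof (re_le_Cmod (p z)) as K. apply Rabs_le_between in K. lra.
      + eapply Rle_trans; [apply HV'|]. rewrite <- exp_plus. apply exp_le_mono.
        assert (0 <= B * Cmod z ^ m) by (apply Rmult_le_pos; auto). lra.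
    - intros z. rewrite HU, E.
      replace (Cexp (p z + z ^ S m * q z) * V (z + a) * Cexp (- p z))%C
        with (Cexp (p z + z ^ S m * q z) * Cexp (- p z) * V (z + a))%C by ring.
      rewrite <- Cexp_plus. f_equal. f_equal. ring. }
  exists m. apply (polyfun_ext AllC m (fun z => p (z + - a)%C)).
  - intros z. replace (P z) with (P (z + - a + a)%C) by (f_equal; ring). rewrite E, Hq0. ring.
  - apply (polyfun_shift AllC subring_AllC); auto. exact I.
Qed.

(** * Difference equations and polynomials in the step *)

(* [bipoly K d F]: [F s w] is a polynomial in [s] and [w] of total degree at most [d] over [K]. *)
Fixpoint bipoly (K : C -> Prop) (d : nat) (F : C -> C -> C) : Prop :=
  match d with
  | O => exists c, K c /\ forall s w, F s w = c
  | S d' => exists c F1 F2, K c /\ bipoly K d' F1 /\ bipoly K d' F2 /\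
      forall s w, F s w = (c * s ^ d + w * F1 s w + F2 s w)%C
  end.

Lemma sr_inv_nat K : subring K -> forall n, K (RtoC (/ INR (S n))).
Proof.
  intros HK n. replace (/ INR (S n)) with (Q2R (1 # Pos.of_succ_nat n)). apply HK.
  unfold Q2R; simpl Qnum; simpl Qden. rewrite Rmult_1_l. f_equal.
  rewrite INR_IZR_INZ. f_equal.
Qed.

Lemma sr_nat K : subring K -> forall n, K (RtoC (INR n)).
Proof. intros HK n. rewrite INR_IZR_INZ. apply sr_int; auto. Qed.

Section Bivariate.
Context (K : C -> Prop) (HK : subring K).
Let K0 : K 0%C := sr_int K HK 0.
Let K1 : K 1%C := sr_int K HK 1.

Lemma bipoly_zero d : bipoly K d (fun _ _ => 0%C).
Proof.
  induction d.
  - exists 0%C; auto.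
  - exists 0%C, (fun _ _ => 0%C), (fun _ _ => 0%C). repeat split; auto. intros; ring.
Qed.

Lemma bipoly_weaken1 d F : bipoly K d F -> bipoly K (S d) F.
Proof.
  intros H. exists 0%C, (fun _ _ => 0%C), F. split; [auto|]. split; [apply bipoly_zero|]. split; auto.
  intros; ring.
Qed.

Lemma bipoly_add d F G : bipoly K d F -> bipoly K d G -> bipoly K d (fun s w => F s w + G s w)%C.
Proof.
  revert F G. induction d; intros F G.
  - intros [c [Hc H]] [c' [Hc' H']]. exists (c + c')%C. split. apply HK; auto. intros; rewrite H, H'; auto.
  - intros [c [F1 [F2 [Hc [H1 [H2 H]]]]]] [c' [F1' [F2' [Hc' [H1' [H2' H']]]]]].
    exists (c + c')%C, (fun s w => F1 s w + F1' s w)%C, (fun s w => F2 s w + F2' s w)%C.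
    split; [apply HK; auto|]. split; [apply IHd; auto|]. split; [apply IHd; auto|].
    intros; rewrite H, H'. ring.
Qed.

Lemma bipoly_scal d c F : K c -> bipoly K d F -> bipoly K d (fun s w => c * F s w)%C.
Proof.
  intros Hc. revert F. induction d; intros F.
  - intros [c' [Hc' H']]. exists (c * c')%C. split. apply HK; auto. intros; rewrite H'; auto.
  - intros [c' [F1' [F2' [Hc' [H1' [H2' H']]]]]].
    exists (c * c')%C, (fun s w => c * F1' s w)%C, (fun s w => c * F2' s w)%C.
    split; [apply HK; auto|]. split; [apply IHd; auto|]. split; [apply IHd; auto|].
    intros; rewrite H'. ring.
Qed.

Lemma bipoly_mulw d F : bipoly K d F -> bipoly K (S d) (fun s w => w * F s w)%C.
Proof.
  intros H. exists 0%C, F, (fun _ _ => 0%C). split; [auto|]. split; auto. split; [apply bipoly_zero|].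
  intros; ring.
Qed.

Lemma bipoly_pow d : bipoly K d (fun s _ => s ^ d)%C.
Proof.
  destruct d.
  - exists 1%C; auto.
  - exists 1%C, (fun _ _ => 0%C), (fun _ _ => 0%C). split; [auto|]. split; [apply bipoly_zero|].
    split; [apply bipoly_zero|]. intros; ring.
Qed.

Lemma bipoly_muls d F : bipoly K d F -> bipoly K (S d) (fun s w => s * F s w)%C.
Proof.
  revert F. induction d; intros F.
  - intros [c [Hc H]]. exists c, (fun _ _ => 0%C), (fun _ _ => 0%C).
    split; [auto|]. split; [apply bipoly_zero|]. split; [apply bipoly_zero|]. intros; rewrite H; simpl; ring.
  - intros [c [F1 [F2 [Hc [H1 [H2 H]]]]]].
    exists c, (fun s w => s * F1 s w)%C, (fun s w => s * F2 s w)%C.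
    split; [auto|]. split; [apply IHd; auto|]. split; [apply IHd; auto|].
    intros; rewrite H; simpl; ring.
Qed.

Lemma bipoly_of_polyfun d f : polyfun K d f -> bipoly K d (fun s _ => f s).
Proof.
  revert f. induction d; intros f.
  - intros [c [Hc H]]. exists c; auto.
  - intros [c [g [Hc [Hg H]]]]. exists c, (fun _ _ => 0%C), (fun s _ => g s).
    split; [auto|]. split; [apply bipoly_zero|]. split; [auto|]. intros; rewrite H; ring.
Qed.

Lemma bipoly_polyfun_step d F s : K s -> bipoly K d F -> polyfun K d (fun w => F s w).
Proof.
  intros Hs. assert (Hp : forall n, K (s ^ n)%C). { induction n; simpl; auto. apply HK; auto. }
  revert F. induction d; intros F.
  - intros [c [Hc H]]. exists c; auto.
  - intros [c [F1 [F2 [Hc [H1 [H2 H]]]]]].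
    apply (polyfun_ext K (S d) (fun w => c * s ^ (S d) + w * F1 s w + F2 s w)%C). { intros; rewrite H; auto. }
    apply polyfun_add; auto; [apply polyfun_add; auto|].
    + apply polyfun_const; auto. apply HK; auto.
    + apply polyfun_mulz; auto.
    + apply polyfun_weaken1; auto.
Qed.

Lemma bipoly_polyfun_var (L : C -> Prop) d F w : subring L -> (forall x, K x -> L x) -> L w ->
  bipoly K d F -> polyfun L d (fun s => F s w).
Proof.
  intros HL HKL Hw. revert F. induction d; intros F.
  - intros [c [Hc H]]. exists c; auto.
  - intros [c [F1 [F2 [Hc [H1 [H2 H]]]]]]. exists c, (fun s => w * F1 s w + F2 s w)%C.
    split; auto. split.
    + apply polyfun_add; auto. apply polyfun_scal; auto.
    + intros; rewrite H. ring.
Qed.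

(** What matters is that [L] has total degree only [m]: this lets the induction for antidifferences
    apply to it. *)
Lemma binomial_remainder m : exists L, bipoly K m L /\ forall s w : C,
  ((s + w) ^ (S (S m)) = s ^ (S (S m)) + INR (S (S m)) * (w * s ^ (S m)) + w * (w * L s w))%C.
Proof.
  induction m.
  - exists (fun _ _ => 1%C). split. exists 1%C; auto. intros. replace (INR 2) with (1 + 1) by (simpl; ring).
    rewrite RtoC_plus. simpl. ring.
  - destruct IHm as [L [HL E]].
    exists (fun s w => INR (S (S m)) * s ^ (S m) + (s * L s w + w * L s w))%C. split.
    + apply bipoly_add. apply bipoly_scal, bipoly_pow. apply sr_nat; auto.
      apply bipoly_add; [apply bipoly_muls|apply bipoly_mulw]; auto.
    + intros s w. replace ((s + w) ^ S (S (S m)))%C with ((s + w) * (s + w) ^ S (S m))%C by reflexivity.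
      rewrite E. rewrite (S_INR (S (S m))), RtoC_plus.
      replace (s ^ S (S (S m)))%C with (s * s ^ S (S m))%C by reflexivity.
      replace (s ^ S (S m))%C with (s * s ^ S m)%C by reflexivity. ring.
Qed.

(** The right side is [w * F] and not [F], which keeps [G] polynomial in the step [w]; the total
    degree then grows by one only. *)
Lemma bipoly_antidifference d F : bipoly K d F -> exists G, bipoly K (S d) G /\
  forall s w : C, (G (s + w) w = G s w + w * F s w)%C.
Proof.
  revert F. induction d; intros F.
  - intros [c [Hc H]]. exists (fun s w => c * s)%C. split.
    + exists c, (fun _ _ => 0%C), (fun _ _ => 0%C). split; auto. split; [apply bipoly_zero|]. split; [apply bipoly_zero|].
      intros; simpl; ring.
    + intros; rewrite H; ring.
  - intros [c [F1 [F2 [Hc [H1 [H2 H]]]]]].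
    destruct (IHd _ H1) as [G1 [HG1 E1]]. destruct (IHd _ H2) as [G2 [HG2 E2]].
    destruct (binomial_remainder d) as [L [HL EL]].
    destruct (IHd _ HL) as [G3 [HG3 E3]].
    set (n := INR (S (S d))) in *.
    (* The difference of [s ^ n / n] is [w s ^ (n - 1)] plus [w^2 L / n]; the antidifference [G3] of
       [L] removes this excess. *)
    exists (fun s w => (c * RtoC (/ n)) * (s ^ (S (S d)) + (- RtoC 1) * (w * G3 s w)) + (w * G1 s w + G2 s w))%C.
    split.
    + apply bipoly_add; [|apply bipoly_add; [apply bipoly_mulw; auto|apply bipoly_weaken1; auto]].
      apply bipoly_scal. { apply HK; auto. unfold n. apply sr_inv_nat; auto. }
      apply bipoly_add; [apply bipoly_pow|]. apply bipoly_scal; [apply HK; auto|]. apply bipoly_mulw; auto.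
    + assert (Hn : n <> 0) by (unfold n; apply not_0_INR; lia).
      intros s w. rewrite H, E1, E2, E3, EL. fold n. rewrite RtoC_inv by auto. field. apply RtoC_neq_0; auto.
Qed.
End Bivariate.

(** [om * Q] and [G (., om)] have the same differences, so they differ by a constant, which
    [Q 1 = 0] determines. A priori [Q] has arbitrary degree and complex coefficients; this bounds
    the degree and places the coefficients in [L]. *)
Lemma polyfun_solution K L d e A Q (om : C) : subring K -> subring L -> (forall x, K x -> L x) -> L om -> L (/ om)%C ->
  om <> 0%C -> polyfun K d A -> polyfun AllC e Q -> Q 1%C = 0%C -> (forall s, Q (s + om) = Q s + A s)%C ->
  polyfun L (S d) Q.
Proof.
  intros HK HL HKL Hom Homi Hom0 HA HQ HQ1 HQA.
  destruct (bipoly_antidifference K HK d _ (bipoly_of_polyfun K HK d A HA)) as [G [HG EG]].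
  assert (HGL : polyfun L (S d) (fun s => G s om)) by (apply (bipoly_polyfun_var K L); auto).
  assert (H : forall s, (om * Q s - G s om = om * Q 1 - G 1 om)%C).
  { intros s. apply (polyfun_periodic (e + S d) (fun s => om * Q s - G s om)%C om Hom0).
    - apply polyfun_minus; [apply subring_AllC| |].
      + apply polyfun_scal; [apply subring_AllC|exact I|]. apply (polyfun_weaken AllC subring_AllC e); auto. lia.
      + apply (polyfun_weaken AllC subring_AllC (S d)); [lia|]. eapply polyfun_AllC; eauto.
    - intros t. rewrite HQA, EG. ring. }
  apply (polyfun_ext L (S d) (fun s => / om * (G s om - G 1 om))%C).
  - intros s. specialize (H s). rewrite HQ1 in H.
    replace (G s om - G 1 om)%C with (om * Q s - (om * Q s - G s om) - G 1 om)%C by ring. rewrite H. field; auto.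
  - apply polyfun_scal; auto. apply polyfun_minus; auto. apply polyfun_const; auto.
    apply (polyfun_value L (S d) (fun s => G s om)); auto. apply (sr_int L HL 1).
Qed.

(* [G r w - G 1 w - l w] vanishes at [w = om], hence by independence at
   [w = - om]; and [G s om - G s (- om) + om A s] is [om]-periodic in [s]. *)
Lemma value_descends K d e A Q (om r l : C) : subring K -> om <> 0%C ->
  (forall p, polyfun K (S d) p -> p om = 0%C -> forall x, p x = 0%C) ->
  polyfun K d A -> polyfun AllC e Q -> Q 1%C = 0%C -> (forall s, Q (s + om) = Q s + A s)%C ->
  K r -> K l -> Q r = l -> (A r - A 1 = - (l + l))%C.
Proof.
  intros HK Hom0 Hind HA HQ HQ1 HQA Hr Hl HQr.
  destruct (bipoly_antidifference K HK d _ (bipoly_of_polyfun K HK d A HA)) as [G [HG EG]].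
  assert (HGC : forall w, polyfun AllC (S d) (fun s => G s w)).
  { intros w. apply (bipoly_polyfun_var K AllC); auto. apply subring_AllC. intros; exact I. exact I. }
  assert (HAC : polyfun AllC (S d) A) by (apply polyfun_weaken1; [apply subring_AllC|eapply polyfun_AllC; eauto]).
  assert (H : (om * Q r - G r om = om * Q 1 - G 1 om)%C).
  { apply (polyfun_periodic (e + S d) (fun s => om * Q s - G s om)%C om Hom0).
    - apply polyfun_minus; [apply subring_AllC| |].
      + apply polyfun_scal; [apply subring_AllC|exact I|]. apply (polyfun_weaken AllC subring_AllC e); auto. lia.
      + apply (polyfun_weaken AllC subring_AllC (S d)); [lia|]. apply HGC.
    - intros t. rewrite HQA, EG. ring. }
  rewrite HQ1, HQr in H.
  (* As a polynomial in the step [x], the expression has coefficients in [K] because [r], [1] and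
     [l] lie in [K]; its degree is at most [S d], as [Hind] requires. *)
  assert (Hp : forall x, (G r x - G 1 x - l * x = 0)%C).
  { apply (Hind (fun x => G r x - G 1 x - l * x)%C).
    - apply polyfun_minus; auto; [apply polyfun_minus; auto|].
      + apply (bipoly_polyfun_step K HK (S d) G r); auto.
      + apply (bipoly_polyfun_step K HK (S d) G 1); auto. apply (sr_int K HK 1).
      + apply (polyfun_weaken K HK 1); [lia|]. exists l, (fun _ => 0%C). split; auto. split.
        * exists 0%C. split; auto. apply (sr_int K HK 0).
        * intros; simpl; ring.
    - replace (G r om - G 1 om - l * om)%C with ((om * 0 - G 1 om) - (om * l - G r om))%C by ring.
      rewrite H. ring. }
  assert (HX : (G r om - G r (- om) + om * A r = G 1 om - G 1 (- om) + om * A 1)%C).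
  { apply (polyfun_periodic (S d) (fun s => G s om - G s (- om) + om * A s)%C om Hom0).
    - apply polyfun_add; [apply subring_AllC| |].
      + apply polyfun_minus; [apply subring_AllC|apply HGC|apply HGC].
      + apply polyfun_scal; [apply subring_AllC|exact I|auto].
    (* The step [- om] leads from [s + om] back to [s], which gives the increment of [G s (- om)]
       over [om]. *)
    - intros s. pose proof (EG (s + om) (- om))%C as E.
      replace (s + om + - om)%C with s in E by ring. rewrite E, (EG s om). ring. }
  pose proof (Hp om) as P1. pose proof (Hp (- om)%C) as Pm.
  assert (F : (om * (A r - A 1 + (l + l)) = 0)%C).
  { transitivity ((G r om - G r (- om) + om * A r) - (G 1 om - G 1 (- om) + om * A 1)
      - (G r om - G 1 om - l * om) + (G r (- om) - G 1 (- om) - l * - om))%C; [ring|].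
    rewrite HX, P1, Pm. ring. }
  replace (A r - A 1)%C with (/ om * (om * (A r - A 1 + (l + l))) - (l + l))%C by (field; auto).
  rewrite F. ring.
Qed.

(** * Linear dependence over a subfield *)

Fixpoint dot (cs l : list C) : C :=
  match cs, l with c :: cs', x :: l' => (c * x + dot cs' l')%C | _, _ => 0%C end.

Fixpoint terms (b : nat -> C) (n : nat) : list C :=
  match n with O => nil | S n' => b O :: terms (fun i => b (S i)) n' end.

Lemma terms_length b n : length (terms b n) = n.
Proof. revert b; induction n; simpl; auto. Qed.

Lemma terms_Forall (P : C -> Prop) b n : (forall i, (i < n)%nat -> P (b i)) -> Forall P (terms b n).
Proof.
  revert b. induction n; simpl; intros b H; constructor.
  - apply H; lia.
  - apply IHn. intros; apply H; lia.
Qed.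

Lemma dot_scal cs x l : dot cs (map (fun y => x * y)%C l) = (x * dot cs l)%C.
Proof.
  revert l. induction cs; destruct l; simpl; try ring. rewrite IHcs. ring.
Qed.

Lemma dot_app cs cs' l l' : length cs = length l -> dot (cs ++ cs') (l ++ l') = (dot cs l + dot cs' l')%C.
Proof.
  revert l. induction cs; destruct l; simpl; intros H; try discriminate. ring.
  rewrite IHcs by auto. ring.
Qed.

Lemma sum_n_S_l (a : nat -> C) n :
  @sum_n C_AbelianMonoid a (S n) = (a O + @sum_n C_AbelianMonoid (fun i => a (S i)) n)%C.
Proof.
  unfold sum_n. rewrite sum_Sn_m by lia. change plus with Cplus. f_equal.
  rewrite sum_n_m_S. reflexivity.
Qed.

Lemma sum_n_dot n : forall (cs : list C) (b : nat -> C), length cs = S n ->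
  @sum_n C_AbelianMonoid (fun i => nth i cs (RtoC 0) * b i)%C n = dot cs (terms b (S n)).
Proof.
  induction n; intros cs b H.
  - destruct cs as [|c [|]]; try discriminate. rewrite sum_O. simpl. ring.
  - destruct cs as [|c cs]; try discriminate. rewrite sum_n_S_l. simpl nth at 1.
    change (dot (c :: cs) (terms b (S (S n)))) with (c * b O + dot cs (terms (fun i => b (S i)) (S n)))%C.
    f_equal. rewrite <- (IHn cs (fun i => b (S i))) by (simpl in H; lia). reflexivity.
Qed.

Section Span.
Context (K : C -> Prop) (HK : subring K) (Hinv : forall x, K x -> x <> 0%C -> K (/ x)%C) (v : C).
Let K0 : K 0%C := sr_int K HK 0.
Let K1 : K 1%C := sr_int K HK 1.

(* the [K]-span of [1, v, ..., v ^ (d - 1)] *)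
Fixpoint span (d : nat) (x : C) : Prop :=
  match d with
  | O => x = 0%C
  | S d' => exists c, K c /\ span d' (x - c * v ^ d')%C
  end.

Lemma span_0 d : span d 0%C.
Proof. induction d; simpl; auto. exists 0%C. split; auto. replace (0 - 0 * v ^ d)%C with (RtoC 0) by ring. auto. Qed.

Lemma span_add d x y : span d x -> span d y -> span d (x + y)%C.
Proof.
  revert x y. induction d; simpl; intros x y.
  - intros -> ->. ring.
  - intros [c [Hc H]] [c' [Hc' H']]. exists (c + c')%C. split. apply HK; auto.
    replace (x + y - (c + c') * v ^ d)%C with ((x - c * v ^ d) + (y - c' * v ^ d))%C by ring. auto.
Qed.

Lemma span_scal d k x : K k -> span d x -> span d (k * x)%C.
Proof.
  intros Hk. revert x. induction d; simpl; intros x.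
  - intros ->. ring.
  - intros [c [Hc H]]. exists (k * c)%C. split. apply HK; auto.
    replace (k * x - k * c * v ^ d)%C with (k * (x - c * v ^ d))%C by ring. auto.
Qed.

Lemma span_minus d x y : span d x -> span d y -> span d (x - y)%C.
Proof.
  intros Hx Hy. replace (x - y)%C with (x + (- RtoC 1) * y)%C by ring.
  apply span_add; auto. apply span_scal; auto. apply HK; auto.
Qed.

Lemma span_weaken d e x : (d <= e)%nat -> span d x -> span e x.
Proof.
  induction 1; auto. intros Hx. exists 0%C. split; auto.
  replace (x - 0 * v ^ m)%C with x by ring. auto.
Qed.

Lemma span_mulv d x : span d x -> span (S d) (v * x)%C.
Proof.
  revert x. induction d; intros x.
  - simpl; intros ->. exists 0%C. split; auto. ring.
  - intros [c [Hc H]]. exists c. split; auto.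
    replace (v * x - c * v ^ S d)%C with (v * (x - c * v ^ d))%C by (simpl; ring). auto.
Qed.

Lemma span_of_polyfun d p : polyfun K d p -> span (S d) (p v).
Proof.
  revert p. induction d; intros p.
  - intros [c [Hc H]]. rewrite H. exists c. split; auto. simpl. ring.
  - intros [c [g [Hc [Hg H]]]]. rewrite H. exists c. split; auto.
    replace (g v + c * v ^ S d - c * v ^ S d)%C with (g v) by ring. auto.
Qed.

Definition dep (l : list C) : Prop := exists cs : list C, length cs = length l /\
  Forall K cs /\ Exists (fun c : C => c <> 0%C) cs /\ dot cs l = 0%C.

Lemma dot_K cs l : Forall K cs -> Forall K l -> K (dot cs l).
Proof.
  intros H. revert l. induction H; intros l' Hl; simpl; auto.
  destruct Hl; auto. apply HK; auto. apply HK; auto.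
Qed.

(* Steinitz exchange *)
Lemma span_dep d : forall l, length l = S d -> Forall (span d) l -> dep l.
Proof.
  induction d; intros l Hl HF.
  - destruct l as [|x [|]]; try discriminate. inversion HF; subst. simpl in H1. subst.
    exists (RtoC 1 :: nil). repeat split; auto. constructor; intros E; apply RtoC_inj in E; lra.
    simpl; ring.
  (* [e y] becomes a coefficient of [v ^ d] in [y]; outside the span the value 0 is a dummy. *)
  - assert (Hc : forall y, exists c, span (S d) y -> K c /\ span d (y - c * v ^ d)%C).
    { intros y. destruct (classic (span (S d) y)) as [[c H]|H]. exists c; auto. exists 0%C; intros; contradiction. }
    apply choice in Hc. destruct Hc as [e He].
    rewrite Forall_forall in HF.
    destruct (classic (exists x, In x l /\ e x <> 0%C)) as [[x [Hx Hex]]|Hno].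
    + apply in_split in Hx. destruct Hx as [l1 [l2 ->]].
      (* [x] is the pivot: subtracting [u y * x] cancels the top coefficient of each other vector,
         so the induction hypothesis applies to the rest. *)
      set (u := fun y => (e y / e x)%C).
      assert (Hsx : span (S d) x) by (apply HF; apply in_elt). destruct (He x Hsx) as [Kx Sx].
      assert (Ku : forall y, span (S d) y -> K (u y)).
      { intros y Hy. apply HK; auto. apply He; auto. }
      assert (Hin : forall y, In y (l1 ++ l2) -> span (S d) y).
      { intros y Hy. apply HF. apply in_app_iff in Hy. apply in_app_iff. simpl. tauto. }
      rewrite length_app in Hl. simpl in Hl.
      destruct (IHd (map (fun y => y - u y * x)%C (l1 ++ l2))) as [cs [Hlen [HKcs [Hne Hdot]]]].
      * rewrite length_map, length_app. lia.
      * apply Forall_forall. intros y Hy. apply in_map_iff in Hy. destruct Hy as [z [<- Hz]].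
        destruct (He z (Hin z Hz)) as [Kz Sz].
        replace (z - u z * x)%C with ((z - e z * v ^ d) - u z * (x - e x * v ^ d))%C by (unfold u; field; auto).
        apply span_minus; auto. apply span_scal; auto.
      * rewrite length_map, length_app in Hlen.
        assert (Hd : forall cs l, dot cs (map (fun y => y - u y * x)%C l) = (dot cs l - dot cs (map u l) * x)%C).
        { clear. induction cs; destruct l; simpl; try ring. rewrite IHcs. ring. }
        rewrite Hd in Hdot.
        set (c1 := firstn (length l1) cs). set (c2 := skipn (length l1) cs).
        assert (Ec : cs = c1 ++ c2) by (symmetry; apply firstn_skipn).
        assert (L1 : length c1 = length l1) by (apply firstn_length_le; lia).
        exists (c1 ++ (- dot cs (map u (l1 ++ l2)))%C :: c2).
        assert (Kk : K (- dot cs (map u (l1 ++ l2)))%C).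
        { apply HK. apply dot_K; auto. apply Forall_forall. intros y Hy. apply in_map_iff in Hy.
          destruct Hy as [z [<- Hz]]. auto. }
        rewrite Ec in HKcs, Hne. apply Forall_app in HKcs. destruct HKcs as [F1 F2].
        apply Exists_app in Hne. repeat split.
        -- rewrite !length_app. simpl. rewrite Ec, length_app in Hlen. lia.
        -- apply Forall_app. auto.
        -- apply Exists_app. destruct Hne; auto.
        -- assert (E3 : dot cs (l1 ++ l2) = (dot c1 l1 + dot c2 l2)%C) by (rewrite <- dot_app, <- Ec; auto).
           rewrite dot_app by auto. simpl. rewrite <- Hdot, E3. ring.
    (* Without a pivot all vectors lie in the smaller span; the first one is dropped and gets
       coefficient 0. *)
    + destruct l as [|x l]; try discriminate.
      destruct (IHd l) as [cs [Hlen [HKcs [Hne Hdot]]]].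
      * simpl in Hl; lia.
      * apply Forall_forall. intros y Hy.
        destruct (He y (HF y (or_intror Hy))) as [_ Sy].
        assert (E : e y = 0%C). { apply NNPP. intros Hn. apply Hno. exists y. split; auto. right; auto. }
        rewrite E in Sy. replace y with (y - 0 * v ^ d)%C by ring. auto.
      * exists (RtoC 0 :: cs). simpl. repeat split; auto. rewrite Hdot. ring.
Qed.

Section Algebraic.
Context (d : nat) (Hvd : span (S d) (v ^ (S d))%C).
Let W := span (S d).

(** Only the top power leaves the range, and [Hvd] rewrites it in lower powers. *)
Lemma span_mulv_closed x : W x -> W (v * x)%C.
Proof.
  intros H. apply span_mulv in H. destruct H as [c [Hc H]].
  replace (v * x)%C with ((v * x - c * v ^ S d) + c * v ^ S d)%C by ring.
  apply span_add; auto. apply span_scal; auto.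
Qed.

Lemma span_mul_closed x y : W x -> W y -> W (x * y)%C.
Proof.
  unfold W at 1. generalize (S d) as k. intros k. revert x. induction k; intros x Hx Hy.
  - simpl in Hx. subst. rewrite Cmult_0_l. apply span_0.
  - destruct Hx as [c [Hc H]].
    replace (x * y)%C with ((x - c * v ^ k) * y + c * (v ^ k * y))%C by ring.
    apply span_add; [apply IHk; auto|]. apply span_scal; auto.
    clear - Hy K0 K1 Hvd HK. induction k; simpl. { rewrite Cmult_1_l; auto. }
    rewrite <- Cmult_assoc. apply span_mulv_closed; auto.
Qed.

Lemma span_const c : K c -> W c.
Proof.
  intros Hc. apply (span_weaken 1); [lia|]. exists c. split; auto. simpl. ring.
Qed.

Lemma span_dot cs l : Forall K cs -> Forall W l -> W (dot cs l).
Proof.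
  intros H. revert l. induction H; intros l' Hl; simpl; auto. apply span_0.
  destruct Hl. apply span_0. apply span_add; auto. apply span_scal; auto. apply IHForall; auto.
Qed.

(** The [d + 2] powers [1, ..., x ^ (d + 1)] are dependent in a span of [d + 1] generators.
    Cancelling [x] while the lowest coefficient is zero leaves [c + x y = 0] with [c <> 0], so
    [/ x = - y / c]. *)
Lemma span_inv_closed x : W x -> x <> 0%C -> W (/ x)%C.
Proof.
  intros Hx Hx0.
  assert (Hpow : forall n, W (x ^ n)%C).
  { induction n; simpl. apply span_const; auto. apply span_mul_closed; auto. }
  assert (Hsplit : forall n (c : C) cs, dot (c :: cs) (terms (fun i => x ^ i)%C (S n))
      = (c + x * dot cs (terms (fun i => x ^ i) n))%C).
  { intros n c cs. simpl. rewrite Cmult_1_r. f_equal. rewrite <- dot_scal. f_equal.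
    assert (E : forall n (b b' : nat -> C), (forall i, b i = x * b' i)%C -> terms b n = map (fun y => x * y)%C (terms b' n)).
    { clear. induction n; simpl; intros; auto. f_equal; auto. }
    apply E. intros; reflexivity. }
  destruct (span_dep (S d) (terms (fun i => x ^ i)%C (S (S d)))) as [cs [Hlen [HKcs [Hne Hdot]]]].
  { apply terms_length. }
  { apply terms_Forall. intros; apply Hpow. }
  rewrite terms_length in Hlen. revert Hlen Hdot. generalize (S (S d)) as n.
  clear - Hsplit Hne HKcs Hx0 Hpow Hinv HK K0 K1 Hvd. induction cs as [|c cs]; intros n Hlen Hdot.
  - inversion Hne.
  - destruct n; [discriminate|]. rewrite Hsplit in Hdot. inversion HKcs; subst.
    destruct (Ceq_dec c 0) as [->|Hc].
    + inversion Hne; subst. { congruence. }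
      apply (IHcs H2 H0 n). { simpl in Hlen; lia. }
      rewrite Cplus_0_l in Hdot. apply NNPP. intros Hn. apply (Cmult_neq_0 _ _ Hx0 Hn Hdot).
    + replace (/ x)%C with ((- / c) * dot cs (terms (fun i => x ^ i)%C n))%C.
      * apply span_scal. apply HK; auto. apply span_dot; auto. apply terms_Forall; auto.
      * set (y := dot cs (terms (fun i => x ^ i)%C n)) in *.
        replace (- / c * y)%C with (/ x - (c + x * y) * (/ c * / x))%C by (field; auto).
        rewrite Hdot. ring.
Qed.
End Algebraic.
End Span.

Lemma in_gen_field_subring om m : subring (in_gen_field om m).
Proof. split; intros; [apply gen_rat|apply gen_add|apply gen_mul|apply gen_opp]; auto. Qed.

Lemma in_gen_field_mono om m n x : (m <= n)%nat -> in_gen_field om m x -> in_gen_field om n x.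
Proof.
  intros Hmn. induction 1.
  - apply gen_rat. - apply gen_om; lia. - apply gen_add; auto. - apply gen_mul; auto.
  - apply gen_opp; auto. - apply gen_inv; auto.
Qed.

(** The degree hypothesis speaks of some [n + 1] independent elements; the proof transfers this to
    the powers of [om n]. *)
Lemma ext_degree_no_relation om n : (1 <= n)%nat -> ext_degree_ge om n (n + 1) ->
  forall p, polyfun (in_gen_field om (n - 1)) n p -> p (om n) = 0%C -> forall x, p x = 0%C.
Proof.
  intros Hn [b [Hb Hind]].
  set (K := in_gen_field om (n - 1)) in *. set (v := om n).
  assert (HK : subring K) by apply in_gen_field_subring.
  assert (Hinv : forall x, K x -> x <> 0%C -> K (/ x)%C) by (intros; apply gen_inv; auto).
  (* Otherwise the span of at most [n] powers would be a field containing every element generated by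
     [om n] over [K], and the [n + 1] elements [b] would be dependent. *)
  assert (Hno : forall d, (S d <= n)%nat -> ~ span K v (S d) (v ^ (S d))%C).
  { intros d Hd Hv.
    assert (HW : forall x, in_gen_field om n x -> span K v (S d) x).
    { induction 1.
      - apply span_const; auto. apply gen_rat.
      - destruct (Nat.eq_dec i n) as [->|].
        + replace (om n) with (v * 1)%C by (unfold v; ring). apply span_mulv_closed; auto.
          apply span_const; auto. apply (sr_int K HK 1).
        + apply span_const; auto. apply gen_om. lia.
      - apply span_add; auto.
      - apply span_mul_closed; auto.
      - replace (- x)%C with (0 - x)%C by ring. apply span_minus; auto. apply span_0; auto.
      - apply span_inv_closed; auto. }
    destruct (span_dep K HK Hinv v n (terms b (S n))) as [cs [Hlen [HKcs [Hne Hdot]]]].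
    { apply terms_length. }
    { apply terms_Forall. intros i Hi. apply (span_weaken K HK v (S d)); auto. apply HW, Hb. lia. }
    rewrite terms_length in Hlen.
    assert (Hall : forall i, (i < n + 1)%nat -> nth i cs (RtoC 0) = 0%C).
    { apply (Hind (fun i => nth i cs (RtoC 0))).
      - intros i Hi. rewrite Forall_forall in HKcs. apply HKcs. apply nth_In. lia.
      - replace (n + 1 - 1)%nat with n by lia. rewrite sum_n_dot; auto. }
    apply Exists_exists in Hne. destruct Hne as [c [Hc Hc0]].
    apply (In_nth _ _ (RtoC 0)) in Hc. destruct Hc as [i [Hi E]]. apply Hc0. rewrite <- E. apply Hall. lia. }
  intros p Hp Hpv. fold v in Hpv.
  (* A nonzero top coefficient would express [v ^ (S e)] through lower powers, against [Hno]; so the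
     degree drops down to 0. *)
  assert (Hgen : forall e, (e <= n)%nat -> forall p, polyfun K e p -> p v = 0%C -> forall x, p x = 0%C).
  { clear p Hp Hpv. induction e; intros He p Hp Hpv.
    - destruct Hp as [c [_ E]]. intros x. rewrite E, <- (E v). auto.
    - destruct Hp as [c [g [Hc [Hg E]]]]. destruct (Ceq_dec c 0) as [->|Hc0].
      + assert (E' : forall z, p z = g z) by (intros; rewrite E; ring).
        intros x. rewrite E'. apply IHe; auto. lia. rewrite <- E'; auto.
      + exfalso. apply (Hno e He).
        replace (v ^ S e)%C with ((- / c) * g v)%C.
        * apply span_scal; auto. apply HK; auto. apply span_of_polyfun; auto.
        * rewrite E in Hpv.
          replace (- / c * g v)%C with (v ^ S e - / c * (g v + c * v ^ S e))%C by (field; auto).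
          rewrite Hpv. ring. }
  apply (Hgen n); auto.
Qed.

(** * Ratios of two hierarchies *)

Definition two_pi_i : C := (RtoC (2 * PI) * Ci)%C.

Lemma two_pi_i_neq_0 : two_pi_i <> 0%C.
Proof. apply Cmult_neq_0; [apply PI2_neq_0|apply Ci_nz]. Qed.

Lemma Cexp_two_pi_i_int (k : Z) : Cexp (two_pi_i * RtoC (IZR k)) = 1%C.
Proof.
  assert (H : forall n : nat, Cexp (two_pi_i * RtoC (INR n)) = 1%C).
  { induction n.
    - simpl. rewrite Cmult_0_r. apply Cexp_0.
    - rewrite S_INR, RtoC_plus.
      replace (two_pi_i * (INR n + 1))%C with (two_pi_i * INR n + Ci * RtoC (2 * PI))%C by (unfold two_pi_i; ring).
      rewrite Cexp_period; auto. }
  destruct (Z.le_gt_cases 0 k).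
  - rewrite <- (Z2Nat.id k) by lia. rewrite <- INR_IZR_INZ. apply H.
  - replace (IZR k) with (- INR (Z.to_nat (- k))) by (rewrite INR_IZR_INZ, Z2Nat.id, opp_IZR by lia; ring).
    rewrite RtoC_opp. replace (two_pi_i * - INR (Z.to_nat (- k)))%C with (- (two_pi_i * INR (Z.to_nat (- k))))%C by ring.
    rewrite Cexp_opp, H. field.
Qed.

(** The modulus gives [Im x = 0]. The fractional part [y] of [Re x] satisfies [cos (2 PI y) = 1], so
    [sin (PI y) = 0], and [0 <= y < 1] leaves [y = 0]. *)
Lemma Cexp_two_pi_i_eq_1 (x : C) : Cexp (two_pi_i * x) = 1%C -> exists k : Z, x = RtoC (IZR k).
Proof.
  intros H. pose proof PI_RGT_0 as Hpi.
  assert (ERe : Re (two_pi_i * x) = - (2 * PI * Im x)) by (unfold two_pi_i, Re, Im, Ci; simpl; ring).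
  assert (EIm : Im (two_pi_i * x) = 2 * PI * Re x) by (unfold two_pi_i, Re, Im, Ci; simpl; ring).
  assert (H0 : Im x = 0).
  { assert (E : exp (Re (two_pi_i * x)) = 1) by (rewrite <- Cmod_Cexp, H; apply Cmod_1).
    rewrite <- exp_0 in E. apply exp_inv in E. rewrite ERe in E. nra. }
  set (k := Int_part (Re x)). destruct (base_Int_part (Re x)) as [Hk1 Hk2]. fold k in Hk1, Hk2.
  set (y := Re x - IZR k).
  assert (Hy : Cexp (two_pi_i * RtoC y) = 1%C).
  { replace (RtoC y) with (x - RtoC (IZR k))%C.
    - replace (two_pi_i * (x - RtoC (IZR k)))%C with (two_pi_i * x - two_pi_i * RtoC (IZR k))%C by ring.
      rewrite Cexp_minus, H, Cexp_two_pi_i_int. field.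
    - unfold y. destruct x as [a b]. simpl in H0. unfold Im in H0; simpl in H0. subst b.
      unfold Cminus, Cplus, Copp, RtoC, Re; simpl. f_equal; ring. }
  assert (Hc : cos (2 * PI * y) = 1).
  { apply (f_equal Re) in Hy. unfold Cexp in Hy.
    replace (Re (two_pi_i * y)) with 0 in Hy by (unfold two_pi_i, Re, Ci; simpl; ring).
    replace (Im (two_pi_i * y)) with (2 * PI * y) in Hy by (unfold two_pi_i, Im, Ci; simpl; ring).
    rewrite exp_0 in Hy. unfold Re in Hy; simpl in Hy. lra. }
  assert (Hs : sin (PI * y) = 0).
  { replace (2 * PI * y) with (2 * (PI * y)) in Hc by ring. rewrite cos_2a_sin in Hc. nra. }
  assert (Hy0 : y = 0).
  { destruct (Req_dec y 0); auto. exfalso.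
    assert (0 < sin (PI * y)). { apply sin_gt_0; unfold y in *; nra. } lra. }
  exists k. destruct x as [a b]. unfold Im in H0; simpl in H0. unfold y, Re in Hy0; simpl in Hy0.
  unfold RtoC. f_equal; lra.
Qed.

Lemma RHP_open (s : C) : 0 < Re s -> forall w, Cmod (w - s) < Re s -> 0 < Re w.
Proof.
  intros Hs w Hw. pose proof (re_le_Cmod (w - s)) as H. unfold Cminus in H at 1.
  rewrite re_plus, re_opp in H. apply Rabs_le_between in H. lra.
Qed.

Lemma Centire_identity f : Centire f -> (forall s, 0 < Re s -> f s = 0%C) -> forall s, f s = 0%C.
Proof.
  intros Hf H s. apply NNPP. intros Hs.
  destruct (Centire_isolated_zeros f 1%C Hf (ex_intro _ s Hs)) as [eps [He H']].
  set (d := Rmin (eps / 2) (/ 2)).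
  assert (Hd : 0 < d) by (apply Rmin_glb_lt; lra).
  assert (Hd1 : d <= eps / 2) by apply Rmin_l.
  apply (H' (1 + RtoC d)%C).
  - replace (1 + d - 1)%C with (RtoC d) by ring. rewrite Cmod_R, Rabs_right by lra. lra.
  - apply H. unfold Re; simpl. lra.
Qed.

Lemma Ccont_punctured F (z : C) eps : 0 < eps -> Ccont F z ->
  (forall w, 0 < Cmod (w - z) < eps -> F w = 0%C) -> F z = 0%C.
Proof.
  intros He HF H. apply NNPP. intros Hz. pose proof (Cmod_pos _ Hz) as Hp.
  destruct (HF _ Hp) as [d [Hd H']].
  set (x := Rmin d eps / 2). assert (0 < Rmin d eps) by (apply Rmin_glb_lt; auto).
  pose proof (Rmin_l d eps). pose proof (Rmin_r d eps).
  assert (E : Cmod (z + RtoC x - z) = x).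
  { replace (z + x - z)%C with (RtoC x) by ring. rewrite Cmod_R, Rabs_right; unfold x; lra. }
  specialize (H' (z + RtoC x)%C). rewrite H in H' by (rewrite E; unfold x; lra).
  rewrite E in H'. replace (0 - F z)%C with (- F z)%C in H' by ring. rewrite Cmod_opp in H'.
  assert (x < d) by (unfold x; lra). specialize (H' H3). lra.
Qed.

Lemma Ccont_minus F G (z : C) : Ccont F z -> Ccont G z -> Ccont (fun w => F w - G w)%C z.
Proof.
  intros HF HG. apply Ccont_ext with (fun w => F w + (- RtoC 1) * G w)%C. { intros; ring. }
  apply Ccont_plus; auto. apply Ccont_mult; auto. apply Ccont_const.
Qed.

(** [mer_eq] says nothing about the value at the centre of a punctured neighbourhood; continuity
    supplies it. *)
Lemma mer_eq_at F G (z : C) : mer_eq F G -> Ccont F z -> Ccont G z -> F z = G z.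
Proof.
  intros H HF HG. destruct (H z) as [eps [He H']].
  apply Ceq_minus. apply (Ccont_punctured (fun w => F w - G w)%C z eps); auto.
  - apply Ccont_minus; auto.
  - intros w Hw. rewrite H' by auto. ring.
Qed.

Lemma LLD_Ccont f s : LLD f -> 0 < Re s -> Ccont f s.
Proof. intros H Hs. destruct (H s Hs) as [[l Hl] _]. apply is_derive_Cderiv in Hl. eapply Cderiv_Ccont; eauto. Qed.

Lemma Ccont_shift f (s a : C) : Ccont f (s + a)%C -> Ccont (fun w => f (w + a)%C) s.
Proof.
  intros H. apply (Ccont_comp f (fun w => w + a)%C); auto. apply Ccont_plus; [apply Ccont_id|apply Ccont_const].
Qed.

Lemma Ccont_inv_comp f (s : C) : Ccont f s -> f s <> 0%C -> Ccont (fun w => / f w)%C s.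
Proof. intros H H0. apply (Ccont_comp Cinv f); auto. apply Ccont_inv; auto. Qed.

(* The functional equation continues a solution from the right half-plane to [C]. *)
Lemma extend_left (h H : C -> C) (om : C) : 0 < Re om -> Centire H -> (forall s, H s <> 0%C) ->
  (forall s, 0 < Re s -> exists l, Cderiv h s l) -> (forall s, 0 < Re s -> h s <> 0%C) ->
  (forall s, 0 < Re s -> h s = H s * h (s + om))%C ->
  exists X, Centire X /\ (forall s, X s <> 0%C) /\ forall s, 0 < Re s -> X s = h s.
Proof.
  intros Hom HH HH0 Hh Hh0 Heq.
  (* [E k] applies the equation [k] times and is meaningful for [Re s > - k Re om]; on common
     domains the [E k] agree. *)
  set (E := nat_rect (fun _ => C -> C) h (fun _ F s => (H s * F (s + om))%C)).
  assert (ES : forall k s, E (S k) s = (H s * E k (s + om))%C) by reflexivity.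
  assert (Hre : forall s, Re (s + om) = Re s + Re om) by (intros; apply re_plus).
  assert (E0 : forall k s, 0 < Re s -> E k s = h s).
  { induction k; intros s Hs. reflexivity. rewrite ES, IHk. symmetry; apply Heq; auto. rewrite Hre; lra. }
  assert (Eadd : forall k j s, 0 < Re s + INR k * Re om -> E (k + j)%nat s = E k s).
  { induction k; intros j s Hs.
    - simpl in Hs. simpl plus. rewrite E0 by lra. reflexivity.
    - change (S k + j)%nat with (S (k + j)). rewrite (ES (k + j)%nat s), (ES k s), IHk; auto.
      rewrite S_INR in Hs. rewrite Hre. lra. }
  assert (Edif : forall k s, 0 < Re s + INR k * Re om -> exists l, Cderiv (E k) s l).
  { induction k; intros s Hs.
    - simpl in Hs. apply Hh; lra.
    - rewrite S_INR in Hs. destruct (IHk (s + om)%C) as [l Hl]. { rewrite Hre; lra. }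
      destruct (HH s) as [m Hm]. eexists. apply Cderiv_ext with (fun s => H s * E k (s + om))%C. { intros; reflexivity. }
      apply Cderiv_mult; [apply Hm|]. apply (Cderiv_comp (E k) (fun s => s + om)%C); [|apply Hl].
      apply Cderiv_plus; [apply Cderiv_id|apply Cderiv_const]. }
  assert (Enz : forall k s, 0 < Re s + INR k * Re om -> E k s <> 0%C).
  { induction k; intros s Hs.
    - simpl in Hs. apply Hh0; lra.
    - rewrite S_INR in Hs. rewrite ES. apply Cmult_neq_0; auto. apply IHk. rewrite Hre; lra. }
  assert (Hk : forall s, exists k, 0 < Re s + INR k * Re om).
  { intros s. destruct (INR_archimed (Re om) (- Re s) Hom) as [k Hk]. exists k. lra. }
  (* The glued function uses an index depending on [s]; near each point it coincides with one fixed
     [E (k s)], hence is differentiable. *)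
  apply choice in Hk. destruct Hk as [k Hk].
  assert (HX : forall s j, 0 < Re s + INR j * Re om -> E (k s) s = E j s).
  { intros s j Hj. destruct (Nat.le_ge_cases (k s) j) as [L|L].
    - replace j with (k s + (j - k s))%nat by lia. symmetry; apply Eadd; auto.
    - replace (k s) with (j + (k s - j))%nat at 1 by lia. apply Eadd; auto. }
  exists (fun s => E (k s) s). split; [|split].
  - intros s. destruct (Edif (k s) s (Hk s)) as [l Hl]. exists l.
    apply (Cderiv_ext_loc (E (k s)) _ s l (Re s + INR (k s) * Re om)); auto.
    intros w Hw. symmetry. apply HX.
    pose proof (re_le_Cmod (w - s)) as K. unfold Cminus in K at 1. rewrite re_plus, re_opp in K.
    apply Rabs_le_between in K. lra.
  - intros s. apply Enz, Hk.
  - intros s Hs. apply E0; auto.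
Qed.

(** Cross-multiplying [g = a / b] and [gt = a' / b'] gives [U = a b'] and [V = a' b]. Entire
    functions allow the identity theorem to pass from the half-plane to [C]; the last clause is the
    way back to [mer_eq]. *)
Lemma meromorphic_pair (g gt : C -> C) : meromorphic_finite_order g -> meromorphic_finite_order gt ->
  LLD g -> LLD gt ->
  exists U V, Centire U /\ Centire V /\ tempered U /\ tempered V /\ (exists z, V z <> 0%C) /\
    (forall s, 0 < Re s -> U s = g s / gt s * V s)%C /\
    ((forall z, U z = V z) -> mer_eq g gt).
Proof.
  intros [a [b [[Ea Ga] [[Eb Gb] [Nb Hg]]]]] [a' [b' [[Ea' Ga'] [[Eb' Gb'] [Nb' Hg']]]]] Lg Lg'.
  apply entire_Centire in Ea, Eb, Ea', Eb'. apply tempered_of_finite_order in Ga, Gb, Ga', Gb'.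
  assert (Hloc : forall z, exists eps, 0 < eps /\ forall w, 0 < Cmod (w - z) < eps ->
     b w <> 0%C /\ b' w <> 0%C /\ g w = (a w / b w)%C /\ gt w = (a' w / b' w)%C).
  { intros z. destruct (Centire_isolated_zeros b z Eb Nb) as [e1 [P1 Q1]].
    destruct (Centire_isolated_zeros b' z Eb' Nb') as [e2 [R2 Q2]].
    destruct (Hg z) as [e3 [P3 Q3]]. destruct (Hg' z) as [e4 [P4 Q4]].
    exists (Rmin (Rmin e1 e2) (Rmin e3 e4)). split. { repeat apply Rmin_glb_lt; auto. }
    intros w [Hw1 Hw2].
    pose proof (Rmin_l e1 e2). pose proof (Rmin_r e1 e2). pose proof (Rmin_l e3 e4). pose proof (Rmin_r e3 e4).
    pose proof (Rmin_l (Rmin e1 e2) (Rmin e3 e4)). pose proof (Rmin_r (Rmin e1 e2) (Rmin e3 e4)).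
    repeat split; [apply Q1|apply Q2|apply Q3|apply Q4]; lra. }
  (* [gt] has no zero in the right half-plane, so its numerator is not identically zero. *)
  assert (Na' : exists z, a' z <> 0%C).
  { destruct (Hloc 1%C) as [eps [He H]]. set (d := Rmin eps 1 / 2).
    assert (0 < Rmin eps 1) by (apply Rmin_glb_lt; lra).
    pose proof (Rmin_l eps 1).
    exists (1 + RtoC d)%C. destruct (H (1 + RtoC d)%C) as [_ [_ [_ E]]].
    - replace (1 + d - 1)%C with (RtoC d) by ring. rewrite Cmod_R, Rabs_right; unfold d; lra.
    - intros K. apply (proj2 (Lg' (1 + RtoC d)%C ltac:(unfold Re, d; simpl; lra))).
      rewrite E, K. unfold Cdiv; ring. }
  exists (fun z => a z * b' z)%C, (fun z => a' z * b z)%C.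
  assert (EU : Centire (fun z => a z * b' z)%C) by (apply Centire_mult; auto).
  assert (EV : Centire (fun z => a' z * b z)%C) by (apply Centire_mult; auto).
  split; auto. split; auto. split; [apply tempered_mult; auto|]. split; [apply tempered_mult; auto|].
  split; [|split].
  - destruct (Centire_isolated_zeros b 0%C Eb Nb) as [e1 [P1 Q1]].
    destruct (Centire_isolated_zeros a' 0%C Ea' Na') as [e2 [R2 Q2]].
    set (d := Rmin e1 e2 / 2). assert (0 < Rmin e1 e2) by (apply Rmin_glb_lt; auto).
    pose proof (Rmin_l e1 e2). pose proof (Rmin_r e1 e2).
    assert (E : Cmod (RtoC d - 0) = d).
    { replace (d - 0)%C with (RtoC d) by ring. rewrite Cmod_R, Rabs_right; unfold d; lra. }
    exists (RtoC d). apply Cmult_neq_0; [apply Q2|apply Q1]; rewrite E; unfold d; lra.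
  - intros s Hs. destruct (Hloc s) as [eps [He H]]. apply Ceq_minus.
    apply (Ccont_punctured (fun s => a s * b' s - g s / gt s * (a' s * b s))%C s (Rmin eps (Re s))).
    + apply Rmin_glb_lt; auto.
    + apply Ccont_minus; [apply Centire_Ccont; auto|]. apply Ccont_mult; [|apply (Centire_Ccont _ EV)].
      apply Ccont_mult; [apply LLD_Ccont; auto|]. apply Ccont_inv_comp; [apply LLD_Ccont; auto|]. apply Lg'; auto.
    + intros w [Hw1 Hw2]. pose proof (Rmin_l eps (Re s)). pose proof (Rmin_r eps (Re s)).
      destruct (H w ltac:(lra)) as [B [B' [E E']]].
      assert (Hw : 0 < Re w) by (apply (RHP_open s Hs); lra).
      assert (Hgt := proj2 (Lg' w Hw)).
      assert (E1 : a w = (g w * b w)%C) by (rewrite E; field; auto).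
      assert (E2 : a' w = (gt w * b' w)%C) by (rewrite E'; field; auto).
      rewrite E1, E2. field. auto.
  - intros HUV z. destruct (Hloc z) as [eps [He H]]. exists eps. split; auto. intros w Hw.
    destruct (H w Hw) as [B [B' [E E']]]. specialize (HUV w). cbv beta in HUV.
    rewrite E, E'.
    replace (a w / b w)%C with ((a w * b' w) / (b w * b' w))%C by (field; auto). rewrite HUV. field; auto.
Qed.

Section Hierarchies.
Context (om : nat -> C) (f : C -> C) (g gt : nat -> C -> C).
Context (Hom : forall j : nat, (1 <= j)%nat -> 0 < Re (om j)) (Hf : LLD f).
Context (Hg : normalized_hierarchy om f g) (Hgt : normalized_hierarchy om f gt).

Let h (n : nat) (s : C) : C := (g n s / gt n s)%C.

Lemma om_neq_0 j : (1 <= j)%nat -> om j <> 0%C.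
Proof. intros Hj E. pose proof (Hom j Hj) as H. rewrite E in H. unfold Re in H; simpl in H. lra. Qed.

Lemma hierarchy_LLD G n : normalized_hierarchy om f G -> LLD (G n).
Proof. intros [_ [_ [H _]]]. apply H. Qed.

Lemma hierarchy_shift G n s : normalized_hierarchy om f G -> 0 < Re s ->
  G (S n) (s + om (S n))%C = (/ G n s * G (S n) s)%C.
Proof.
  intros HG Hs. pose proof (hierarchy_LLD G n HG) as L. pose proof (hierarchy_LLD G (S n) HG) as L'.
  destruct HG as [_ [H _]].
  apply (mer_eq_at (fun s => G (S n) (s + om (S n))%C) (fun s => / G n s * G (S n) s)%C); auto.
  - apply Ccont_shift. apply LLD_Ccont; auto. rewrite re_plus. pose proof (Hom (S n) ltac:(lia)). lra.
  - apply Ccont_mult; [|apply LLD_Ccont; auto]. apply Ccont_inv_comp; [apply LLD_Ccont; auto|apply L; auto].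
Qed.

Lemma hierarchy_0 G s : normalized_hierarchy om f G -> 0 < Re s -> G O s = (/ f s)%C.
Proof.
  intros HG Hs. pose proof (hierarchy_LLD G 0 HG) as L. destruct HG as [H _].
  apply (mer_eq_at (G O) (fun s => / f s)%C); auto.
  - apply LLD_Ccont; auto.
  - apply Ccont_inv_comp; [apply LLD_Ccont; auto|apply Hf; auto].
Qed.

Lemma ratio_0 s : 0 < Re s -> h O s = 1%C.
Proof.
  intros Hs. unfold h. rewrite (hierarchy_0 g s Hg Hs), (hierarchy_0 gt s Hgt Hs).
  assert (H := proj2 (Hf s Hs)). field. auto.
Qed.

Lemma ratio_neq_0 n s : 0 < Re s -> h n s <> 0%C.
Proof.
  intros Hs. pose proof (proj2 (hierarchy_LLD g n Hg s Hs)). pose proof (proj2 (hierarchy_LLD gt n Hgt s Hs)).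
  intros E. apply H. replace (g n s) with (h n s * gt n s)%C by (unfold h; field; auto). rewrite E. ring.
Qed.

Lemma ratio_Cderiv n s : 0 < Re s -> exists l, Cderiv (h n) s l.
Proof.
  intros Hs. destruct (hierarchy_LLD g n Hg s Hs) as [[l Hl] _]. destruct (hierarchy_LLD gt n Hgt s Hs) as [[m Hm] H0].
  apply is_derive_Cderiv in Hl, Hm. eexists. apply Cderiv_div; eauto.
Qed.

Lemma ratio_shift n s : 0 < Re s -> h (S n) s = (h n s * h (S n) (s + om (S n)))%C.
Proof.
  intros Hs. unfold h. rewrite (hierarchy_shift g n s Hg Hs), (hierarchy_shift gt n s Hgt Hs).
  pose proof (proj2 (hierarchy_LLD g n Hg s Hs)). pose proof (proj2 (hierarchy_LLD gt n Hgt s Hs)).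
  pose proof (proj2 (hierarchy_LLD g (S n) Hg s Hs)). pose proof (proj2 (hierarchy_LLD gt (S n) Hgt s Hs)).
  field. auto.
Qed.

Lemma ratio_1 n : h n 1%C = 1%C.
Proof.
  destruct n.
  - apply ratio_0. unfold Re; simpl; lra.
  - unfold h. destruct Hg as [_ [_ [_ H1]]]. destruct Hgt as [_ [_ [_ H2]]].
    rewrite H1, H2 by lia. field.
Qed.

(** Defined by recursion so that [Q] carries the whole chain of lower exponents and integers [k],
    which the descent takes apart again. *)
Fixpoint exponent (n : nat) (Q : C -> C) : Prop :=
  polyfun (in_gen_field om n) n Q /\ Q 1%C = 0%C /\
  (forall s, 0 < Re s -> h n s = Cexp (two_pi_i * Q s)) /\
  match n with
  | O => forall s, Q s = 0%C
  | S n' => exists Q' (k : Z), exponent n' Q' /\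
      forall s, Q (s + om n)%C = (Q s + (RtoC (IZR k) - Q' s))%C
  end.

Lemma exponent_polyfun n Q : exponent n Q -> polyfun (in_gen_field om n) n Q.
Proof. destruct n; simpl; tauto. Qed.
Lemma exponent_1 n Q : exponent n Q -> Q 1%C = 0%C.
Proof. destruct n; simpl; tauto. Qed.
Lemma exponent_ratio n Q : exponent n Q -> forall s, 0 < Re s -> h n s = Cexp (two_pi_i * Q s).
Proof. destruct n; simpl; tauto. Qed.

Lemma exponent_exists n : exists Q, exponent n Q.
Proof.
  induction n as [|n [Q' HQ']].
  - exists (fun _ => 0%C). simpl. repeat split; auto.
    + exists 0%C. split; auto. apply (sr_int _ (in_gen_field_subring om 0) 0).
    + intros s Hs. rewrite Cmult_0_r, Cexp_0. apply ratio_0; auto.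
  - pose proof (exponent_polyfun n Q' HQ') as PQ'. pose proof (exponent_1 n Q' HQ') as Q'1.
    pose proof (exponent_ratio n Q' HQ') as RQ'.
    pose proof (om_neq_0 (S n) ltac:(lia)) as Hom0. pose proof (Hom (S n) ltac:(lia)) as HomS.
    set (w := om (S n)) in *.
    assert (EQ' : Centire Q') by (eapply polyfun_Centire, polyfun_AllC; eauto).
    (* The entire zero-free continuation of [h n], needed to continue [h (S n)] to the left. *)
    set (H := fun s => Cexp (two_pi_i * Q' s)).
    assert (EH : Centire H). { apply (Centire_comp Cexp (fun s => two_pi_i * Q' s)%C); [apply Centire_Cexp|]. apply Centire_mult; [apply Centire_const|auto]. }
    destruct (extend_left (h (S n)) H w HomS EH) as [X [EX [X0 HX]]].
    { intros; apply Cexp_neq_0. } { apply ratio_Cderiv. } { apply ratio_neq_0. }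
    { intros s Hs. unfold H. rewrite <- RQ' by auto. apply ratio_shift; auto. }
    destruct (Centire_log X 1%C EX X0) as [P [EP [P1 HP]]].
    { rewrite HX by (unfold Re; simpl; lra). apply ratio_1. }
    assert (Hexp : forall s, Cexp (P s) = (H s * Cexp (P (s + w)))%C).
    { intros s. apply Ceq_minus. revert s. apply Centire_identity.
      - apply Centire_minus; [apply Centire_comp; auto; apply Centire_Cexp|]. apply Centire_mult; auto.
        apply (Centire_comp Cexp (fun s => P (s + w)%C)). apply Centire_Cexp. apply Centire_shift; auto.
      - intros s Hs. rewrite <- !HP, !HX by (rewrite ?re_plus; lra). unfold H. rewrite <- RQ' by auto.
        apply -> Ceq_minus. apply ratio_shift; auto. }
    destruct (meromorphic_pair (g (S n)) (gt (S n))) as [U [V [EU [EV [TU [TV [NV [HUV _]]]]]]]].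
    { apply Hg. } { apply Hgt. } { apply Hg. } { apply Hgt. }
    assert (HU : forall z, U z = (Cexp (P z) * V z)%C).
    { intros z. apply Ceq_minus. revert z. apply Centire_identity.
      - apply Centire_minus; auto. apply Centire_mult; auto. apply Centire_comp; auto. apply Centire_Cexp.
      - intros s Hs. rewrite HUV by auto. change (g (S n) s / gt (S n) s)%C with (h (S n) s).
        rewrite <- HX, HP by auto. ring. }
    destruct (log_polynomial U V P EV EP TU TV NV HU) as [e He].
    pose proof two_pi_i_neq_0 as Htpi.
    set (Q := fun s => (/ two_pi_i * P s)%C).
    assert (HPQ : forall s, P s = (two_pi_i * Q s)%C) by (intros; unfold Q; field; auto).
    assert (PQ : polyfun AllC e Q) by (apply polyfun_scal; [apply subring_AllC|exact I|auto]).
    assert (EQ : Centire Q) by (eapply polyfun_Centire; eauto).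
    assert (Q1 : Q 1%C = 0%C) by (unfold Q; rewrite P1; ring).
    (* [D] is entire with integer values; differentiating [Cexp (two_pi_i * D) = 1] shows that it is
       constant, and this constant is [k]. *)
    set (D := fun s => (Q (s + w) - Q s + Q' s)%C).
    assert (HD : forall s, Cexp (two_pi_i * D s) = 1%C).
    { intros s. replace (two_pi_i * D s)%C with (two_pi_i * Q' s + P (s + w) - P s)%C by (rewrite !HPQ; unfold D; ring).
      rewrite Cexp_minus, Cexp_plus. fold (H s). rewrite <- Hexp. field. apply Cexp_neq_0. }
    assert (ED : Centire D). { apply Centire_plus; auto. apply Centire_minus; auto. apply Centire_shift; auto. }
    assert (HDc : forall s, D s = D 1%C).
    { intros s. apply Centire_zero_derive. intros z. destruct (ED z) as [l Hl].
      eapply Cderiv_eq; [apply Hl|].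
      assert (H0 : (Cexp (two_pi_i * D z) * (two_pi_i * l))%C = 0%C).
      { apply (Cderiv_uniq (fun z => Cexp (two_pi_i * D z)) z).
        - apply (Cderiv_comp Cexp (fun z => two_pi_i * D z)%C). apply Cderiv_scal; auto. apply Cderiv_Cexp.
        - apply Cderiv_ext with (fun _ => 1%C). intros; auto. apply Cderiv_const. }
      rewrite HD in H0. replace l with (/ two_pi_i * (1 * (two_pi_i * l)))%C by (field; auto). rewrite H0. ring. }
    destruct (Cexp_two_pi_i_eq_1 (D 1%C) (HD 1%C)) as [k Hk].
    assert (HQs : forall s, Q (s + w)%C = (Q s + (RtoC (IZR k) - Q' s))%C).
    { intros s. rewrite <- Hk, <- (HDc s). unfold D. ring. }
    exists Q. split; [|split; [auto|split]].
    + assert (HSn := in_gen_field_subring om n).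
      assert (Kw : in_gen_field om (S n) w) by (apply gen_om; lia).
      apply (polyfun_solution (in_gen_field om n) (in_gen_field om (S n)) n e (fun s => RtoC (IZR k) - Q' s)%C Q w); auto.
      * apply in_gen_field_subring.
      * intros; eapply in_gen_field_mono; [|eauto]; lia.
      * apply gen_inv; auto.
      * apply polyfun_minus; auto. apply polyfun_const; auto. apply sr_int; auto.
    + intros s Hs. rewrite <- HPQ, <- HP. symmetry; auto.
    + exists Q', k. auto.
Qed.

(** Integrality at [r] is handed down to [Q'] before the induction hypothesis is used, and the
    vanishing of [Q'] is exploited afterwards; one induction covers both directions. *)
Lemma exponent_descent N r : (forall n, (1 <= n <= N)%nat -> ext_degree_ge om n (n + 1)) ->
  Q2R r <> 1 -> forall n, (n <= N)%nat -> forall Q, exponent n Q ->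
  (exists l : Z, Q (RtoC (Q2R r)) = RtoC (IZR l)) ->
  (forall s, Q s = 0%C) /\ forall m, (m <= n)%nat -> forall s, 0 < Re s -> h m s = 1%C.
Proof.
  intros Hdeg Hr n. induction n; intros Hn Q HQ [l Hl].
  - destruct HQ as [_ [_ [HR H0]]]. split; auto. intros m Hm s Hs. replace m with O by lia. apply ratio_0; auto.
  - pose proof (exponent_ratio _ _ HQ) as RQ. destruct HQ as [PQ [Q1 [_ [Q' [k [HQ' HQs]]]]]].
    pose proof (exponent_polyfun n Q' HQ') as PQ'. pose proof (exponent_1 n Q' HQ') as Q'1.
    pose proof (om_neq_0 (S n) ltac:(lia)) as Hom0.
    assert (HSn := in_gen_field_subring om n).
    assert (Hrel : forall p, polyfun (in_gen_field om n) (S n) p -> p (om (S n)) = 0%C -> forall x, p x = 0%C).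
    { pose proof (ext_degree_no_relation om (S n) ltac:(lia) (Hdeg (S n) ltac:(lia))) as E.
      replace (S n - 1)%nat with n in E by lia. exact E. }
    assert (Hv := value_descends (in_gen_field om n) n (S n) (fun s => RtoC (IZR k) - Q' s)%C Q (om (S n))
        (RtoC (Q2R r)) (RtoC (IZR l)) HSn Hom0 Hrel
        (polyfun_minus _ HSn n _ _ (polyfun_const _ HSn n _ (sr_int _ HSn k)) PQ')
        (polyfun_AllC _ _ _ PQ) Q1 HQs (gen_rat _ _ r) (sr_int _ HSn l) Hl).
    cbv beta in Hv. rewrite Q'1 in Hv.
    destruct (IHn ltac:(lia) Q' HQ') as [Q'0 Hh].
    { exists (l + l)%Z. rewrite plus_IZR, RtoC_plus.
      replace (Q' (RtoC (Q2R r))) with (- (RtoC (IZR k) - Q' (RtoC (Q2R r)) - (RtoC (IZR k) - 0)))%C by ring.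
      rewrite Hv. ring. }
    (* The relation [Q' r = 2 l] again, now read with [Q' = 0]. *)
    assert (Hl0 : RtoC (IZR l) = 0%C).
    { rewrite Q'0 in Hv. assert (E : (RtoC 2 * RtoC (IZR l))%C = 0%C).
      { replace (RtoC 2) with (RtoC 1 + RtoC 1)%C by (rewrite <- RtoC_plus; f_equal; ring).
        transitivity (- - (IZR l + IZR l))%C; [ring|]. rewrite <- Hv. ring. }
      rewrite <- RtoC_mult in E. apply RtoC_inj in E. f_equal. lra. }
    (* With [Q' = 0] each step adds [k] to [Q], so [om Q t - k t] is a periodic polynomial and [Q]
       is affine with slope [k / om]. *)
    assert (HC : forall t, (om (S n) * Q t - IZR k * t = om (S n) * Q 1 - IZR k * 1)%C).
    { intros t. apply (polyfun_periodic (S n) (fun t => om (S n) * Q t - IZR k * t)%C (om (S n)) Hom0).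
      - apply polyfun_minus; [apply subring_AllC| |].
        + apply polyfun_scal; [apply subring_AllC|exact I|]. eapply polyfun_AllC; eauto.
        + apply polyfun_scal; [apply subring_AllC|exact I|]. apply (polyfun_weaken AllC subring_AllC 1); [lia|].
          apply (polyfun_ext AllC 1 (fun t => t * 1)%C). { intros; ring. }
          apply (polyfun_mulz AllC subring_AllC 0 (fun _ => 1%C)). exists 1%C. split; [exact I|auto].
      - intros s. rewrite HQs, Q'0. ring. }
    (* The affine [Q] vanishes at 1 and at [r <> 1], so its slope is zero. *)
    assert (Hk0 : RtoC (IZR k) = 0%C).
    { pose proof (HC (RtoC (Q2R r))) as E. rewrite Hl, Hl0, Q1 in E.
      assert (E' : (IZR k * (Q2R r - 1) = 0)%C).
      { replace (IZR k * (Q2R r - 1))%C with ((om (S n) * 0 - IZR k * 1) - (om (S n) * 0 - IZR k * Q2R r))%C by ring.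
        rewrite E. ring. }
      rewrite <- RtoC_minus, <- RtoC_mult in E'. apply RtoC_inj in E'. f_equal.
      apply Rmult_integral in E'. destruct E'; lra. }
    assert (HQ0 : forall s, Q s = 0%C).
    { intros s. pose proof (HC s) as E. rewrite Hk0, Q1 in E.
      replace (Q s) with (/ om (S n) * (om (S n) * Q s - 0 * s))%C by (field; auto). rewrite E. ring. }
    split; auto. intros m Hm s Hs. destruct (Nat.eq_dec m (S n)) as [->|].
    + rewrite RQ, HQ0, Cmult_0_r, Cexp_0; auto.
    + apply Hh; auto. lia.
Qed.

Lemma hierarchy_unique N r : (forall n, (1 <= n <= N)%nat -> ext_degree_ge om n (n + 1)) ->
  0 < Q2R r -> Q2R r <> 1 -> g N (RtoC (Q2R r)) = gt N (RtoC (Q2R r)) ->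
  forall n, (n <= N)%nat -> mer_eq (g n) (gt n).
Proof.
  intros Hdeg Hr0 Hr1 HN n Hn.
  destruct (exponent_exists N) as [Q HQ].
  assert (HRr : 0 < Re (RtoC (Q2R r))) by (rewrite re_RtoC; auto).
  (* Equal values at [r] only say [h N r = 1], which determines [Q r] modulo the integers. *)
  assert (Hint : exists l : Z, Q (RtoC (Q2R r)) = RtoC (IZR l)).
  { apply Cexp_two_pi_i_eq_1. rewrite <- (exponent_ratio N Q HQ) by auto. unfold h. rewrite HN.
    field. apply (hierarchy_LLD gt N Hgt); auto. }
  destruct (exponent_descent N r Hdeg Hr1 N (le_n _) Q HQ Hint) as [_ Hh].
  destruct (meromorphic_pair (g n) (gt n)) as [U [V [EU [EV [_ [_ [_ [HUV Hmer]]]]]]]].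
  { apply Hg. } { apply Hgt. } { apply Hg. } { apply Hgt. }
  apply Hmer. intros z. apply Ceq_minus. revert z. apply Centire_identity. { apply Centire_minus; auto. }
  intros s Hs. rewrite HUV by auto. change (g n s / gt n s)%C with (h n s). rewrite (Hh n Hn s Hs). ring.
Qed.
End Hierarchies.

Theorem theorem6p20 :
  forall (om : nat -> C) (f : C -> C) (N : nat) (g gt : nat -> C -> C) (r : Q),
    (forall j : nat, (1 <= j)%nat -> 0 < Re (om j)) ->
    meromorphic_finite_order f -> LLD f -> f 1%C = 1%C ->
    (1 <= N)%nat ->
    (forall n : nat, (1 <= n <= N)%nat -> ext_degree_ge om n (n + 1)) ->
    normalized_hierarchy om f g ->
    normalized_hierarchy om f gt ->
    0 < Q2R r -> Q2R r <> 1 ->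
    g N (RtoC (Q2R r)) = gt N (RtoC (Q2R r)) ->
    forall n : nat, (1 <= n <= N)%nat -> mer_eq (g n) (gt n).
Proof.
  intros om f N g gt r Hom _ Hf _ _ Hdeg Hg Hgt Hr0 Hr1 HN n [_ Hn].
  exact (hierarchy_unique om f g gt Hom Hf Hg Hgt N r Hdeg Hr0 Hr1 HN n Hn).
Qed.
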